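(* Let $\Sigma\subset\mathbb T^3$ be one of the following: (i) a geodesic segment; (ii) a smooth curve segment whose torsion is nowhere vanishing; (iii) a real-analytic curve segment whose geodesic curvature is nowhere vanishing. Then for every $\varepsilon>0$ there is a constant $C=C(\varepsilon,\Sigma)$ such that for all $\lambda>1$ and all eigenfunctions $e_\lambda$ of frequency $\lambda$ on $\mathbb T^3$, $$\|e_\lambda\|_{L^2(\Sigma)}\le C\,\lambda^{\frac13+\varepsilon}\,\|e_\lambda\|_{L^2(\mathbb T^3)}.$$ If $\Sigma\subset\mathbb T^3$ is (iv) a smooth planar curve segment whose geodesic curvature is nowhere vanishing, then for every $\varepsilon>0$ there is a constant $C=C(\varepsilon,\Sigma)$ such that for all $\lambda>1$ and all eigenfunctions $e_\lambda$ of frequency $\lambda$ on $\mathbb T^3$, $$\|e_\lambda\|_{L^2(\Sigma)}\le C\,\lambda^{\frac14+\varepsilon}\,\|e_\lambda\|_{L^2(\mathbb T^3)}.$$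
   Context: $\mathbb T^3=\mathbb R^3/\mathbb Z^3$ is the standard flat torus. For $\lambda>1$, an eigenfunction $e_\lambda$ of frequency $\lambda$ is any trigonometric polynomial $e_\lambda(x)=\sum_{\xi\in\mathbb Z^3,\,|\xi|=\lambda}a_\xi e^{2\pi i\xi\cdot x}$ with $a_\xi\in\mathbb C$. $L^2(\mathbb T^3)$ is with respect to Lebesgue measure and $L^2(\Sigma)$ with respect to arclength. A curve segment is a compact regular curve, lifted to $\mathbb R^3$ with arclength parametrization $\gamma:I\to\mathbb R^3$, $|\gamma'|=1$, where $I$ is a compact interval. Geodesic curvature nowhere vanishing means $\gamma''(t)\neq0$ for all $t\in I$; torsion nowhere vanishing means $\det(\gamma'(t),\gamma''(t),\gamma'''(t))\ne0$ for all $t\in I$; planar means that the lift $\gamma(I)$ is contained in an affine 2-plane of $\mathbb R^3$. A geodesic segment is the image of a bounded straight line segment. *)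

(* Defs.v *)
From HB Require Import structures.
From mathcomp Require Import all_boot all_order all_algebra.
From mathcomp Require Import complex zify.
From mathcomp Require Import all_classical all_reals all_analysis.

Set Implicit Arguments.
Unset Strict Implicit.
Unset Printing Implicit Defensive.

Import Order.TTheory GRing.Theory Num.Theory.
Import numFieldNormedType.Exports.

Local Open Scope classical_set_scope.
Local Open Scope ring_scope.

Section Vectors.
Variable R : realType.
Implicit Types u v : 'rV[R]_3.

Definition dotv u v : R := \sum_i u 0 i * v 0 i.

(* The Euclidean norm; the norm `|v| that the library puts on row vectors is
   the sup norm. *)
Definition enorm v : R := Num.sqrt (dotv v v).

Definition intv (xi : 'rV[int]_3) : 'rV[R]_3 := map_mx intr xi.

End Vectors.

Section Eigenfunctions.
Variable R : realType.
Implicit Types (lambda : R) (e : 'rV[R]_3 -> R[i]).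

Definition lattice_sphere lambda : set 'rV[int]_3 :=
  [set xi | enorm (intv R xi) = lambda].

Definition expi (theta : R) : R[i] := (cos theta +i* sin theta)%C.

(* A function on the torus is given by its Z^3-periodic lift to R^3.  The
   \sum_(_ \in _) below is a genuine finite sum: see finite_lattice_sphere. *)
Definition eigenfunction lambda e : Prop :=
  exists a : 'rV[int]_3 -> R[i], forall x,
    e x = \sum_(xi \in lattice_sphere lambda)
            a xi * expi (2 * pi * dotv (intv R xi) x).

Lemma finite_lattice_sphere lambda : finite_set (lattice_sphere lambda).
Proof.
pose N := Num.truncn `|lambda|.
pose g (w : 'rV['I_(N + N).+1]_3) : 'rV[int]_3 :=
  map_mx (fun k : 'I_(N + N).+1 => (k : nat)%:Z - N%:Z) w.
apply: (@sub_finite_set _ _ (g @` setT)); last first.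
  exact: finite_image.
move=> xi /= xil.
have bnd (j : 'I_3) : (absz (xi ord0 j) <= N)%N.
  have : `|(xi 0 j)%:~R : R| <= `|lambda|.
    rewrite -xil /enorm (ger0_norm (sqrtr_ge0 _)) -sqrtr_sqr ler_wsqrtr//.
    rewrite /dotv (bigD1 j)//= mxE -expr2 lerDl sumr_ge0// => k _.
    by rewrite -expr2 sqr_ge0.
  rewrite -intr_norm -abszE => h.
  rewrite /N -ltnS -(ltr_nat R) (le_lt_trans h)//.
  exact: truncnS_gt.
exists (\row_j inord (absz (xi 0 j + N%:Z))) => //.
apply/rowP => j; rewrite !mxE.
have := bnd j.
case: (xi 0 j) => [m|m] /= hm.
  rewrite inordK; last by lia.
  lia.
rewrite inordK; last by lia.
lia.
Qed.

End Eigenfunctions.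

Section L2norms.
Variable R : realType.

Definition L2norm d (T : measurableType d) (mu : set T -> \bar R) (D : set T)
    (f : T -> R[i]) : \bar R :=
  ((\int[mu]_(x in D) (ComplexField.Normc.normc (f x) ^+ 2)%:E) `^ (2^-1))%E.

Definition lebesgue_measure3 : set (R * R * R) -> \bar R :=
  ((lebesgue_measure \x lebesgue_measure) \x lebesgue_measure)%E.

Definition unit_cube : set (R * R * R) := `[0, 1] `*` `[0, 1] `*` `[0, 1].

Definition vec3 (x : R * R * R) : 'rV[R]_3 :=
  \row_(i < 3) [:: x.1.1; x.1.2; x.2]`_i.

Definition L2norm_torus (e : 'rV[R]_3 -> R[i]) : \bar R :=
  L2norm lebesgue_measure3 unit_cube (e \o vec3).

Definition L2norm_curve (gamma : R -> 'rV[R]_3) (a b : R)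
    (e : 'rV[R]_3 -> R[i]) : \bar R :=
  L2norm lebesgue_measure `[a, b] (e \o gamma).

End L2norms.

Section Curves.
Variable R : realType.
Implicit Types (gamma : R -> 'rV[R]_3) (a b : R).

(* Smoothness and analyticity on the compact interval [a, b] are understood up
   to the endpoints, as smoothness and analyticity on a neighbourhood; nothing
   else is required of gamma outside [a, b]. *)
Definition smooth_on gamma a b : Prop :=
  exists U : set R, [/\ open U, `[a, b] `<=` U &
    forall n t, U t -> derivable (derive1n n gamma) t 1].

Definition analytic_at gamma (t0 : R) : Prop :=
  exists2 r : R, 0 < r & exists c : nat -> 'rV[R]_3,
    forall t, `|t - t0| < r ->
      series (fun n => (t - t0) ^+ n *: c n) @ \oo --> gamma t.

Definition analytic_on gamma a b : Prop :=
  forall t, t \in `[a, b] -> analytic_at gamma t.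

Definition arclength_param gamma a b : Prop :=
  forall t, t \in `[a, b] -> enorm (derive1n 1 gamma t) = 1.

Definition geodesic_segment gamma a b : Prop :=
  exists p v : 'rV[R]_3, enorm v = 1 /\
    forall t, t \in `[a, b] -> gamma t = p + t *: v.

Definition smooth_curve_segment gamma a b : Prop :=
  smooth_on gamma a b /\ arclength_param gamma a b.

Definition analytic_curve_segment gamma a b : Prop :=
  analytic_on gamma a b /\ arclength_param gamma a b.

Definition nonvanishing_curvature gamma a b : Prop :=
  forall t, t \in `[a, b] -> derive1n 2 gamma t != 0.

Definition nonvanishing_torsion gamma a b : Prop :=
  forall t, t \in `[a, b] ->
    \det (\matrix_(i < 3, j < 3) derive1n i.+1 gamma t 0 j) != 0.

Definition affine_plane (P : set 'rV[R]_3) : Prop :=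
  exists (p : 'rV[R]_3) (V : 'M[R]_(2, 3)),
    row_free V /\ P = [set p + w *m V | w in [set: 'rV[R]_2]].

Definition planar gamma a b : Prop :=
  exists P, affine_plane P /\ gamma @` `[a, b] `<=` P.

Definition restriction_bound gamma a b (s : R) : Prop :=
  forall eps : R, 0 < eps -> exists C : R,
    forall lambda : R, 1 < lambda ->
    forall e : 'rV[R]_3 -> R[i], eigenfunction lambda e ->
      (L2norm_curve gamma a b e
         <= (C * lambda `^ (s + eps))%:E * L2norm_torus e)%E.

End Curves.

(* Main.v *)
Require Import Defs.
From HB Require Import structures.
From mathcomp Require Import all_boot all_order all_algebra.
From mathcomp Require Import complex zify ring lra.
From mathcomp Require Import all_classical all_reals all_analysis.
From mathcomp Require Import measurable_realfun.

(* Schur's test, applied to |e|^2 = sum_(x, y) a_x conj(a_y) e^(2 pi i (x - y).gamma),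
   reduces the bound to the sum over y of |int e^(2 pi i (x - y).gamma)|, for x
   and y lattice points of the sphere of radius lambda.

   Near a point t0 with T = gamma'(t0) and N = gamma''(t0) <> 0, let rho be the
   larger of |(x - y).T| and |(x - y).N|.  Van der Corput's estimates bound the
   integral by rho^(-1/2) if gamma''' has no component along T x N, as for a
   planar curve, and by rho^(-1/3) <= C lambda^(1/6) rho^(-1/2) if that component
   is comparable to |t - t0|^m.  Nonvanishing torsion is the case m = 0; for an
   analytic curve the component either vanishes identically near t0 or has a
   zero of some order m.

   On the sphere the components along T and N determine the one along T x N up
   to sign.  So, given x and rho, the first coordinate of y takes
   O((lambda rho)^(1/2)) values, and by the divisor bound a rational plane
   contains O(lambda^eps) lattice points of the sphere.  Hence the sum over y of
   rho^(-1/2) is O(lambda^(1/2 + eps)).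

   For a segment of direction v the integral is O(1 / |(x - y).v|), and
   Dirichlet's approximation of v by rational directions with denominators at
   most lambda^(2/3) shows that O(lambda^(2/3 + eps) r) of the points y satisfy
   |(x - y).v| <= r. *)

Set Implicit Arguments.
Unset Strict Implicit.
Unset Printing Implicit Defensive.

Import Order.TTheory GRing.Theory Num.Theory.
Import numFieldNormedType.Exports.

Local Open Scope classical_set_scope.
Local Open Scope ring_scope.

(** * Lattice points in planes *)

(** The planes that occur vary with lambda, so lattice points on a plane section must be counted
    uniformly over all normals with entries O(lambda). Completing the square leads to X^2 + D Y^2 =
    M with D depending on the plane, and the number of solutions has to be bounded independently of
    D. This is done without quadratic fields: for a primitive solution X / Y is a square root of -D
    modulo M, and solutions are sorted by the modulus on which their roots agree. Oscillatory
    integrals are handled as increments of an antiderivative, so that every estimate rests on the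
    mean value theorem; measure theory is confined to producing antiderivatives and to the two L^2
    norms. The local estimates have constants depending on t0. Bounds on consecutive arcs add, so a
    supremum argument carries them to the whole segment. Schur's test controls the square of the
    norm: the sum lambda^(1/2) gives the exponent 1/4, and the loss lambda^(1/6) turns it into (1/2
    + 1/6) / 2 = 1/3, which is also half of the exponent 2/3 of a straight segment. *)

Lemma size_fibers (T : Type) (U : eqType) (f : T -> U) (vals : seq U)
    (s : seq T) (B : nat) :
  all (fun x => f x \in vals) s ->
  (forall v, (size [seq x <- s | f x == v] <= B)%N) ->
  (size s <= size vals * B)%N.
Proof.
move=> sv fB; elim: vals s sv fB => [|v vals IH] s sv fB.
  by case: s sv {fB}.
rewrite -(count_predC (fun x => f x == v)) mulSn leq_add//.
  by rewrite -size_filter fB.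
rewrite -size_filter; apply: IH.
  rewrite all_filter; apply: sub_all sv => x /=.
  by rewrite in_cons; case: (f x == v).
move=> u; apply: leq_trans (fB u).
rewrite -filter_predI !size_filter; apply: sub_count => x /=.
by case/andP.
Qed.

Lemma coprimez_of_gcd (d a b : int) : 0 < d -> gcdz (d * a) (d * b) = d ->
  coprimez a b.
Proof.
move=> d0; rewrite -mulz_gcdr gtz0_abs// -[RHS]mulr1 => /mulfI gab.
by rewrite /coprimez gab// gt_eqF.
Qed.

Section Representations.
Variables D M : int.
Hypotheses (D0 : 0 < D) (M0 : 0 < M).
Implicit Types p : int * int.

Let rep p := p.1 ^+ 2 + D * p.2 ^+ 2 = M.

Lemma coprime_rep p : rep p -> coprimez p.1 p.2 -> coprimez p.2 M.
Proof.
case: p => X Y; rewrite /rep /= => <- cXY.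
rewrite coprimez_sym addrC expr2 mulrA coprimez_sym.
rewrite /coprimez gcdzMDl -/(coprimez _ _) coprimezXr// coprimez_sym//.
Qed.

(** From (X Y0 - X0 Y)(X Y0 + X0 Y) = M (Y0^2 - Y^2), the ratio X / Y equals X0 / Y0 modulo d and
    its opposite modulo e = M / d. Hence p and q have the same ratio modulo d and modulo e, so both
    numbers divide their determinant, and d e = M divides it up to the factor h. Modulo h the two
    signs coincide, so h divides 2 X, and h^2 divides 4 M - (2 X)^2 = 4 D Y^2 with Y prime to h. *)
Lemma gcd_class (p q p0 : int * int) (d : int) (h := gcdz d (M %/ d)%Z) :
  rep p -> rep q -> rep p0 ->
  coprimez p.1 p.2 -> coprimez p0.1 p0.2 ->
  gcdz M (p.1 * p0.2 - p0.1 * p.2) = d ->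
  gcdz M (q.1 * p0.2 - p0.1 * q.2) = d ->
  [/\ 0 < h, (M %| h * (p.1 * q.2 - q.1 * p.2))%Z & h ^+ 2 <= 4 * D].
Proof.
move=> rp rq r0 cp c0 dp dq.
have cY := coprime_rep r0 c0.
have cYp := coprime_rep rp cp.
move: rp rq r0 cp c0 cY cYp dp dq; rewrite /rep.
case: p => X Y; case: q => X1 Y1; case: p0 => X0 Y0 /=.
move=> rp rq r0 cp c0 cY cYp dp dq.
have d0 : 0 < d by rewrite -dp lt_neqAle eq_sym gcdz_eq0 gt_eqF.
have dM : (d %| M)%Z by rewrite -dp dvdz_gcdl.
have [e Me] := dvdzP dM.
have Mde : (M %/ d)%Z = e by rewrite Me mulzK// gt_eqF.
have e0 : 0 < e by move: M0; rewrite Me pmulr_lgt0.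
have hE : h = gcdz d e by rewrite /h Mde.
have h0 : 0 < h by rewrite hE lt_neqAle eq_sym gcdz_eq0 gt_eqF.
have plus x y : x ^+ 2 + D * y ^+ 2 = M -> gcdz M (x * Y0 - X0 * y) = d ->
    (d %| x * Y0 - X0 * y)%Z /\ (e %| x * Y0 + X0 * y)%Z.
  move=> rxy gxy; have dA : (d %| x * Y0 - X0 * y)%Z by rewrite -gxy dvdz_gcdr.
  split=> //; have [A Ae] := dvdzP dA.
  have cAe : coprimez e A.
    by apply: (coprimez_of_gcd d0); rewrite !(mulrC d) -Me -Ae.
  have : (d * e %| d * (A * (x * Y0 + X0 * y)))%Z.
    rewrite (mulrC d e) -Me.
    have -> : d * (A * (x * Y0 + X0 * y)) = M * (Y0 ^+ 2 - y ^+ 2).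
      rewrite mulrA (mulrC d) -Ae.
      rewrite mulrBr -{1}rxy -{1}r0; ring.
    exact: dvdz_mulr.
  by rewrite dvdz_mul2l ?gt_eqF// Gauss_dvdzr.
have [dA eB] := plus _ _ rp dp.
have [dA1 eB1] := plus _ _ rq dq.
set W := X * Y1 - X1 * Y.
have cYd : coprimez d Y0.
  by rewrite coprimez_sym; move: cY; rewrite Me coprimezMr => /andP[].
have cYe : coprimez e Y0.
  by rewrite coprimez_sym; move: cY; rewrite Me coprimezMr => /andP[].
have dW : (d %| W)%Z.
  rewrite -(Gauss_dvdzr _ cYd).
  have -> : Y0 * W = Y1 * (X * Y0 - X0 * Y) - Y * (X1 * Y0 - X0 * Y1).
    by rewrite /W; ring.
  by rewrite rpredB// dvdz_mull.
have eW : (e %| W)%Z.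
  rewrite -(Gauss_dvdzr _ cYe).
  have -> : Y0 * W = Y1 * (X * Y0 + X0 * Y) - Y * (X1 * Y0 + X0 * Y1).
    by rewrite /W; ring.
  by rewrite rpredB// dvdz_mull.
split=> //.
  have [u [v uv]] := Bezoutz d e.
  rewrite hE -uv mulrDl Me.
  rewrite rpredD//.
    by rewrite -mulrA dvdz_mull// mulrC dvdz_mul.
  by rewrite -mulrA dvdz_mull// dvdz_mul.
have hd : (h %| d)%Z by rewrite hE dvdz_gcdl.
have he : (h %| e)%Z by rewrite hE dvdz_gcdr.
have hM : (h %| M)%Z by rewrite Me dvdz_mull.
have h2X : (h %| 2 * X)%Z.
  have ch : coprimez h Y0.
    have [l dl] := dvdzP hd.
    by move: cYd; rewrite dl coprimezMl => /andP[].
  rewrite -(Gauss_dvdzr _ ch).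
  have -> : Y0 * (2 * X) = (X * Y0 - X0 * Y) + (X * Y0 + X0 * Y) by ring.
  by apply: rpredD; [apply: dvdz_trans hd dA | apply: dvdz_trans he eB].
have hhM : (h ^+ 2 %| M)%Z by rewrite Me expr2 dvdz_mul.
have : (h ^+ 2 %| 4 * D)%Z.
  have ch : coprimez (h ^+ 2) (Y ^+ 2).
    rewrite coprimezXl// coprimezXr// coprimez_sym.
    have [l Ml] := dvdzP hM.
    by move: cYp; rewrite Ml coprimezMr => /andP[].
  rewrite -(Gauss_dvdzr _ ch).
  have -> : Y ^+ 2 * (4 * D) = 4 * M - (2 * X) ^+ 2 by rewrite -rp; ring.
  by apply: rpredB; [apply: dvdz_mull | apply: dvdz_exp2r].
have D4 : 0 < 4 * D by rewrite mulr_gt0.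
move=> /dvdzP[k Dk]; move: D4; rewrite Dk pmulr_lgt0 ?exprn_gt0// => k0.
by rewrite ler_peMl ?sqr_ge0// -gtz0_ge1.
Qed.

(* Composing with the representation q, V^2 + D W^2 = M^2: by gcd_class h W / M is
   an integer in [-2, 2], and it determines p up to the sign of V. *)
Lemma size_gcd_class (p0 : int * int) (d : int) (s : seq (int * int)) :
  uniq s -> rep p0 -> coprimez p0.1 p0.2 ->
  (forall p, p \in s -> [/\ rep p, coprimez p.1 p.2 &
     gcdz M (p.1 * p0.2 - p0.1 * p.2) = d]) ->
  (size s <= 10)%N.
Proof.
move=> us r0 c0; case: s us => [//|q s us] sP.
have [rq cq dq] := sP q (mem_head _ _).
set h := gcdz d (M %/ d)%Z.
pose W p := p.1 * q.2 - q.1 * p.2.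
pose V p := p.1 * q.1 + D * p.2 * q.2.
pose key p := ((h * W p %/ M)%Z, 0 <= V p).
have VW p : rep p -> V p ^+ 2 + D * W p ^+ 2 = M ^+ 2.
  move=> rp.
  have -> : M ^+ 2 = (p.1 ^+ 2 + D * p.2 ^+ 2) * (q.1 ^+ 2 + D * q.2 ^+ 2).
    by rewrite rp rq expr2.
  by rewrite /V /W; ring.
have keyW p : p \in q :: s -> h * W p = (h * W p %/ M)%Z * M /\ 0 < h.
  move=> /sP[rp cp dp].
  have [h0 MW _] := gcd_class rp rq r0 cp c0 dp dq.
  by rewrite divzK.
have sub : {subset map key (q :: s) <=
    [seq (i, b) | i <- [:: - 2%:Z; -1; 0; 1; 2%:Z], b <- [:: true; false]]}.
  move=> _ /mapP[p ps ->]; apply/allpairsP; exists (key p); split=> //=.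
    have [hW _] := keyW p ps.
    have [rp cp dp] := sP p ps.
    have [h0 MW hD] := gcd_class rp rq r0 cp c0 dp dq.
    set j := (_ %/ _)%Z in hW *.
    (* Here D W^2 <= M^2 and h^2 <= 4 D, so D cancels: this is where the count becomes independent
       of D. *)
    have : D * (h * W p) ^+ 2 <= D * 4 * M ^+ 2.
      rewrite -(VW p rp) -mulrA ler_pM2l// exprMn.
      apply: (le_trans (ler_wpM2r (sqr_ge0 _) hD)).
      by rewrite -mulrA ler_pM2l// lerDr sqr_ge0.
    rewrite hW exprMn -mulrA ler_pM2l// ler_pM2r ?exprn_gt0// => j4.
    have : -2 <= j <= 2 by nia.
    rewrite !inE; lia.
  by rewrite /key /=; case: (0 <= V p).
have inj : {in q :: s &, injective key}.
  move=> x y xs ys [kW kV].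
  have [hx h0] := keyW x xs; have [hy _] := keyW y ys.
  have WE : W x = W y.
    by apply: (mulfI (lt0r_neq0 h0)); rewrite hx hy kW.
  have [rx _ _] := sP x xs; have [ry _ _] := sP y ys.
  have VE : V x = V y.
    have : V x ^+ 2 = V y ^+ 2.
      have := VW _ rx; have := VW _ ry; rewrite WE => <-; exact: addIr.
    move/eqP; rewrite eqf_sqr => /orP[/eqP//|/eqP Vxy].
    move: kV; rewrite Vxy; lia.
  have Mx z : rep z -> M * z.1 = q.1 * V z + D * q.2 * W z /\
                       M * z.2 = q.2 * V z - q.1 * W z.
    by move=> rz; rewrite -{1 2}rq /V /W; split; ring.
  have [x1 x2] := Mx x rx; have [y1 y2] := Mx y ry.
  have M_neq0 := lt0r_neq0 M0.
  move: WE VE x1 x2 y1 y2; case: x {xs hx kW kV rx} => x1 x2; case: y {ys hy ry} => y1 y2 /=.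
  move=> -> -> e1 e2 e3 e4.
  by congr pair; apply: (mulfI M_neq0); rewrite ?e1 ?e2 -?e3 -?e4.
rewrite -(size_map key).
by apply: leq_trans (uniq_leq_size _ sub) _ => //; rewrite map_inj_in_uniq.
Qed.

(** With one solution [q] fixed, the gcd of M and the determinant of p and [q] is a divisor of M,
    and each divisor accounts for at most ten solutions. *)
Lemma size_primitive_reps (s : seq (int * int)) :
  uniq s -> (forall p, p \in s -> rep p /\ coprimez p.1 p.2) ->
  (size s <= size (divisors `|M|) * 10)%N.
Proof.
case: s => [//|q s] us sP.
have [rq cq] := sP q (mem_head _ _).
have M0' : (0 < `|M|)%N by rewrite absz_gt0 gt_eqF.
apply: (size_fibers (f := fun p => `|gcdz M (p.1 * q.2 - q.1 * p.2)|%N)).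
  apply/allP => p ps; rewrite -dvdn_divisors//.
  by rewrite /= dvdn_gcdl.
move=> d; apply: (@size_gcd_class q d%:Z) => //.
  exact: filter_uniq.
move=> p; rewrite mem_filter => /andP[/eqP <- /sP[rp cp]]; split => //.
Qed.

End Representations.

Lemma size_divisors_dvdn (m n : nat) : (0 < n)%N -> (m %| n)%N ->
  (size (divisors m) <= size (divisors n))%N.
Proof.
move=> n0 mn; apply: uniq_leq_size (divisors_uniq _) _ => d.
have m0 : (0 < m)%N by apply: dvdn_gt0 mn.
by rewrite -!dvdn_divisors// => /dvdn_trans; apply.
Qed.

(** If g is the gcd of X and Y, then g^2 divides M and (X / g, Y / g) is a primitive solution for M
    / g^2. There are at most as many values of g as divisors of M, which gives the second factor. *)
Lemma size_reps (D M : int) (s : seq (int * int)) : 0 < D -> 0 < M ->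
  uniq s -> (forall p, p \in s -> p.1 ^+ 2 + D * p.2 ^+ 2 = M) ->
  (size s <= size (divisors `|M|) * (size (divisors `|M|) * 10))%N.
Proof.
move=> D0 M0 us sP.
have M0' : (0 < `|M|)%N by rewrite absz_gt0 gt_eqF.
have gM p : p \in s -> (gcdz p.1 p.2 ^+ 2 %| M)%Z.
  move=> /sP <-.
  apply: rpredD; last apply: dvdz_mull; apply: dvdz_exp2r.
    exact: dvdz_gcdl.
  exact: dvdz_gcdr.
apply: (size_fibers (f := fun p => `|gcdz p.1 p.2|%N)).
  apply/allP => p ps; rewrite -dvdn_divisors//.
  by apply: dvdn_trans (gM p ps); rewrite abszX dvdn_exp.
move=> g; set t := [seq _ <- _ | _].
have tP p : p \in t -> p \in s /\ gcdz p.1 p.2 = g%:Z.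
  by rewrite mem_filter => /andP[/eqP <-].
case: (posnP (size t)) => [->//|t0].
have [q qt] : exists q, q \in t.
  by case: t t0 {tP} => [//|q ? _]; exists q; rewrite mem_head.
have [/gM gq qg] := tP q qt; rewrite qg in gq.
have [M' ME] := dvdzP gq.
have g0 : 0 < g%:Z.
  by case: g {t t0 tP qt qg gq} ME => // ME; move: M0; rewrite ME expr0n/= mulr0.
have M'0 : 0 < M' by move: M0; rewrite ME pmulr_lgt0 // exprn_gt0.
pose f (p : int * int) := ((p.1 %/ g)%Z, (p.2 %/ g)%Z).
have fE p : p \in t -> p.1 = (f p).1 * g /\ p.2 = (f p).2 * g.
  move=> /tP[_]; rewrite /f /= => <-.
  by rewrite !divzK ?dvdz_gcdl ?dvdz_gcdr.
rewrite -(size_map f).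
apply: leq_trans (leq_mul (size_divisors_dvdn M0' _) (leqnn 10)).
  apply: (size_primitive_reps (D := D) (M := M')) => //.
    rewrite map_inj_in_uniq ?filter_uniq// => x y /fE[x1 x2] /fE[y1 y2] fxy.
    by rewrite (surjective_pairing x) x1 x2 fxy -y1 -y2 -surjective_pairing.
  move=> _ /mapP[p pt ->].
  have [p1 p2] := fE p pt; have [/sP rp gp] := tP p pt.
  split.
    apply: (mulIf (lt0r_neq0 (exprn_gt0 2 g0))).
    by rewrite -ME -rp p1 p2; ring.
  by apply: (coprimez_of_gcd g0); rewrite !(mulrC g%:Z) -p1 -p2.
by rewrite ME abszM dvdn_mulr.
Qed.

Lemma size_divisors_part (n p : nat) : (0 < n)%N ->
  (size (divisors n) <= (logn p n).+1 * size (divisors (partn n (negn p))))%N.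
Proof.
move=> n0; set L := logn p n.
pose l := [seq (p ^ i * d)%N | i <- iota 0 L.+1, d <- divisors (partn n (negn p))].
have -> : (L.+1 * size (divisors (partn n (negn p))) = size l)%N.
  by rewrite size_allpairs size_iota.
apply: uniq_leq_size (divisors_uniq n) _ => d.
rewrite -dvdn_divisors// => dn; have d0 := dvdn_gt0 n0 dn.
apply/allpairsP; exists (logn p d, partn d (negn p))%N; split.
- by rewrite mem_iota /= add0n ltnS dvdn_leq_log.
- by rewrite /= -dvdn_divisors ?part_gt0// partn_dvd.
- by rewrite /= -p_part partnC.
Qed.

(** The induction step of the divisor bound. The last clause, used for the predicate that p is
    small, lets each small prime of n be charged once. *)
Lemma extract_prime_power (n : nat) : (1 < n)%N ->
  exists p e m, [/\ prime p, n = (p ^ e * m)%N, (0 < m < n)%N,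
    (size (divisors n) <= e.+1 * size (divisors m))%N &
    forall a : pred nat,
      (count a (primes m) + a p <= count a (primes n))%N].
Proof.
move=> n1; have n0 := ltnW n1; pose p := pdiv n.
have pp : prime p by exact: pdiv_prime.
exists p, (logn p n), (partn n (negn p)); set e := logn p n; set m := (partn n (negn p)).
have nE : n = (p ^ e * m)%N by rewrite -p_part partnC.
have pn : p \in primes n by rewrite mem_primes pp n0 pdiv_dvd.
split=> //; last 2 first.
- exact: size_divisors_part.
- move=> a; rewrite /m primes_part.
  have /permP <- := permEl (perm_filterC [in negn p] (primes n)).
  rewrite count_cat leq_add2l; case: (boolP (a p)) => //= ap.
  rewrite -has_count; apply/hasP; exists p => //.
  by rewrite mem_filter pn !inE eqxx.
have m0 : (0 < m)%N by exact: part_gt0.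
rewrite m0 [ltnRHS]nE -[ltnLHS]mul1n ltn_pmul2r//.
by rewrite -(expn0 p) ltn_exp2l ?prime_gt1// logn_gt0.
Qed.

(* Completing the square in q1 x1 + q2 x2 + q3 x3 = m, |x|^2 = n. *)
Lemma size_sphere_plane_triple (q1 q2 q3 m n : int)
    (nq := q1 ^+ 2 + q2 ^+ 2 + q3 ^+ 2) (s : seq (int * int * int)) :
  q3 != 0 -> uniq s ->
  (forall p, p \in s -> q1 * p.1.1 + q2 * p.1.2 + q3 * p.2 = m /\
                        p.1.1 ^+ 2 + p.1.2 ^+ 2 + p.2 ^+ 2 = n) ->
  exists N : nat, [/\ (0 < N)%N, N%:Z <= 1 + nq ^+ 4 * `|n| &
    (size s <= size (divisors N) * (size (divisors N) * 10))%N].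
Proof.
move=> q30 us sP.
have q3s : 0 < q3 ^+ 2 by rewrite lt_neqAle sqr_ge0 eq_sym sqrf_eq0 q30.
set A := q3 ^+ 2 + q1 ^+ 2.
have A0 : 0 < A by rewrite ltr_wpDr ?sqr_ge0.
have nq0 : 0 < nq by rewrite /nq ltr_wpDl// addr_ge0 ?sqr_ge0.
have Anq : A <= nq by rewrite /A /nq; have := sqr_ge0 q2; lia.
have q3nq : q3 ^+ 2 <= nq by rewrite /nq lerDr addr_ge0 ?sqr_ge0.
(* [A] is the coefficient of x1^2 once x3 is eliminated by the plane equation; completing the square
   in x1 and then in x2, with denominators cleared, gives [f], [D] and [M]. *)
pose f (p : int * int * int) :=
  (nq * (A * p.1.1 + q1 * q2 * p.1.2 - m * q1), nq * p.1.2 - m * q2).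
pose D := nq * q3 ^+ 2; pose M := nq * A * q3 ^+ 2 * (nq * n - m ^+ 2).
have D0 : 0 < D by rewrite mulr_gt0.
have fM p : p \in s -> (f p).1 ^+ 2 + D * (f p).2 ^+ 2 = M.
  case: p => [[x1 x2] x3] /sP /=; rewrite /D /M /A /nq => -[<- <-].
  ring.
have inj : {in s &, injective f}.
  move=> [[x1 x2] x3] [[y1 y2] y3] /sP/=[ex _] /sP/=[ey _] [e1 e2].
  have E2 : x2 = y2 by apply: (mulfI (lt0r_neq0 nq0)); apply: addIr e2.
  rewrite -{}E2 in ey e1 *.
  have E1 : x1 = y1.
    apply: (mulfI (lt0r_neq0 A0)).
    by move/(mulfI (lt0r_neq0 nq0)): e1 => /addIr/addIr.
  rewrite -{}E1 in ey *.
  by congr (_, _, _); apply: (mulfI q30); move: ex; rewrite -ey => /addrI.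
have fu : uniq (map f s) by rewrite map_inj_in_uniq.
(* If M <= 0 the only possible value of [f] is (0, 0), and N = 1 will do. *)
case: (ltrP 0 M) => [M0|M0]; last first.
  exists 1%N; split=> //.
    by rewrite lerDl mulr_ge0// exprn_ge0// ltW.
  apply: (@leq_trans 1) => //; rewrite -(size_map f).
  apply: (@uniq_leq_size _ _ [:: (0, 0)]) => // _ /mapP[p ps ->].
  have := fM p ps; rewrite inE; case: (f p) => X Y /= XY.
  have DY0 : 0 <= D * Y ^+ 2 by rewrite mulr_ge0 ?sqr_ge0// ltW.
  have : X ^+ 2 + D * Y ^+ 2 == 0.
    by rewrite eq_le {1}XY M0 addr_ge0 ?sqr_ge0.
  rewrite paddr_eq0 ?sqr_ge0// [D * _ == 0]mulf_eq0 (gt_eqF D0) /= !sqrf_eq0.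
  by case/andP => /eqP -> /eqP ->.
exists `|M|%N; split.
- by rewrite absz_gt0 gt_eqF.
- rewrite gtz0_abs//.
  have -> : nq ^+ 4 * `|n| = nq * nq * nq * (nq * `|n|) by ring.
  apply: ler_wpDl => //.
  have M1 : 0 < nq * A * q3 ^+ 2 by apply: mulr_gt0 => //; apply: mulr_gt0.
  apply: (@le_trans _ _ (nq * A * q3 ^+ 2 * (nq * `|n|))).
    rewrite ler_pM2l// lerBlDr ler_wpDr ?sqr_ge0// ler_pM2l// ler_norm//.
  apply: ler_wpM2r; first by rewrite mulr_ge0// ltW.
  apply: ler_pM; rewrite ?ler_pM2l ?(ltW q3s)// ltW ?mulr_gt0//.
- rewrite -(size_map f); apply: size_reps D0 M0 fu _ => _ /mapP[p ps ->].
  exact: fM.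
Qed.

Lemma size_sphere_plane (q : 'rV[int]_3) (i : 'I_3) (m n : int)
    (nq := \sum_j q 0 j ^+ 2) (s : seq 'rV[int]_3) :
  q 0 i != 0 -> uniq s ->
  (forall x, x \in s -> \sum_j q 0 j * x 0 j = m /\ \sum_j x 0 j ^+ 2 = n) ->
  exists N : nat, [/\ (0 < N)%N, N%:Z <= 1 + nq ^+ 4 * `|n| &
    (size s <= size (divisors N) * (size (divisors N) * 10))%N].
Proof.
move=> qi us sP.
pose a := lift i (0 : 'I_2); pose b := lift i (1 : 'I_2).
have sumE (F : 'I_3 -> int) : \sum_j F j = F a + F b + F i.
  by rewrite (bigD1_ord i)//= !big_ord_recl big_ord0 addr0 addrC; congr (_ + F _ + _); rewrite /b; congr (lift i _); apply: val_inj.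
pose f (x : 'rV[int]_3) := (x 0 a, x 0 b, x 0 i).
have nqE : nq = q 0 a ^+ 2 + q 0 b ^+ 2 + q 0 i ^+ 2 by rewrite /nq sumE.
rewrite nqE -(size_map f).
apply: (@size_sphere_plane_triple _ _ _ m) => //.
  rewrite map_inj_in_uniq// => x y _ _ [ea eb ei].
  apply/rowP => j; case: (unliftP i j) => [k ->|->//].
  case: k => [[|[|//]] k2].
    by move: ea; rewrite /a; congr (x 0 (lift i _) = y 0 (lift i _)); apply: val_inj.
  by move: eb; rewrite /b; congr (x 0 (lift i _) = y 0 (lift i _)); apply: val_inj.
by move=> _ /mapP[x /sP[] + + ->]; rewrite !sumE.
Qed.

(** * The divisor bound *)

Section DivisorBound.
Variables (R : realType) (eps : R).
Hypothesis eps0 : 0 < eps.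

(** Both constants come from 1 + y <= exp y at y = e * eps * ln p. For p >= P0 one has eps * ln p >=
    1 and p^(e eps) >= e + 1 outright; for a smaller prime ln p >= ln 2, and the factor C0 makes up
    the deficit. *)
Let C0 : R := Num.max 1 (eps * ln 2)^-1.
Let P0 : nat := (Num.truncn (expR eps^-1)).+1.

Lemma exponent_bound (p e : nat) : prime p ->
  e.+1%:R <= (if (p < P0)%N then C0 else 1) * (p ^ e)%:R `^ eps.
Proof.
move=> pp; have p2 : 2 <= p%:R :> R by rewrite ler_nat prime_gt1.
have p0 : 0 < p%:R :> R by rewrite ltr0n prime_gt0.
have ln2 : 0 < ln 2 :> R by rewrite ln_gt0// ltr1n.
have l2p : ln 2 <= ln (p%:R : R) by rewrite ler_ln ?posrE.
have -> : (p ^ e)%:R `^ eps = expR (e%:R * (eps * ln p%:R)).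
  rewrite natrX /powR gt_eqF ?exprn_gt0// lnXn// -mulr_natl; congr expR; ring.
have := expR_ge1Dx (e%:R * (eps * ln (p%:R : R))).
set E := expR _ => hE.
have e0 : 0 <= e%:R :> R by [].
have el2 : 0 < eps * ln (2 : R) by rewrite mulr_gt0.
have C1 : 1 <= C0 by rewrite /C0 le_max lexx.
have C2 : 1 <= C0 * (eps * ln 2).
  by rewrite -ler_pdivrMr// mul1r /C0 le_max lexx orbT.
rewrite -natr1; case: ifPn => [_|].
  apply: (@le_trans _ _ (C0 * (1 + e%:R * (eps * ln p%:R)))); last first.
    by rewrite ler_pM2l// (lt_le_trans ltr01).
  rewrite mulrDr mulr1 addrC lerD// mulrCA -{1}(mulr1 e%:R) ler_wpM2l//.
  by rewrite (le_trans C2)// ler_pM2l ?ler_pM2l// (lt_le_trans ltr01).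
rewrite -leqNgt mul1r => pP.
apply: le_trans hE; rewrite addrC lerD// -{1}(mulr1 e%:R) ler_wpM2l//.
rewrite -ler_pdivrMl// mulr1 -(expRK eps^-1) ler_ln ?posrE ?expR_gt0//.
apply/ltW/(lt_le_trans (truncnS_gt _)); rewrite ler_nat//.
Qed.

(** Splitting off one prime power at a time, only the primes below P0 cost a factor C0, and n has at
    most P0 of those. *)
Lemma divisor_bound : exists2 C : R, 0 < C & forall n : nat, (0 < n)%N ->
  (size (divisors n))%:R <= C * n%:R `^ eps.
Proof.
have C1 : 1 <= C0 by rewrite /C0 le_max lexx.
have C00 : 0 < C0 by apply: lt_le_trans C1.
exists (C0 ^+ P0); first exact: exprn_gt0.
pose c n := count (fun p => p < P0)%N (primes n).
suff main n : (0 < n)%N -> (size (divisors n))%:R <= C0 ^+ c n * n%:R `^ eps.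
  move=> n n0; apply: (le_trans (main n n0)).
  rewrite ler_wpM2r ?powR_ge0// ler_weXn2l//.
  rewrite /c -size_filter -[leqRHS](size_iota 0).
  apply: uniq_leq_size; first by rewrite filter_uniq ?primes_uniq.
  by move=> p; rewrite mem_filter mem_iota => /andP[].
elim/ltn_ind: n => n IH n0.
have [n1|n1] := leqP n 1.
  have -> : n = 1%N by apply/eqP; rewrite eqn_leq n1.
  by rewrite powR1 mulr1 exprn_ege1.
have [p [e [m [pp nE /andP[m0 mn] dn cn]]]] := extract_prime_power n1.
apply: le_trans (_ : (e.+1 * size (divisors m))%:R <= _).
  by rewrite ler_nat.
rewrite natrM (le_trans (ler_pM _ _ (exponent_bound e pp) (IH m mn m0)))//.
rewrite mulrACA -powRM// -natrM -nE ler_wpM2r ?powR_ge0//.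
apply: le_trans (_ : C0 ^+ (c m + (p < P0))%N <= _); last first.
  by rewrite ler_weXn2l ?cn.
by rewrite addnC exprD; case: (p < P0)%N; rewrite ?expr1 ?expr0.
Qed.
End DivisorBound.

(** * Plane sections of the sphere, and summation by parts *)

Section Counting.
Variable R : realType.
Implicit Types (lambda : R) (v w : 'rV[R]_3).

Lemma dotv_ge0 v : 0 <= dotv v v.
Proof. by rewrite sumr_ge0// => j _; rewrite -expr2 sqr_ge0. Qed.

Lemma enorm_sqr v : enorm v ^+ 2 = dotv v v.
Proof. by rewrite sqr_sqrtr// dotv_ge0. Qed.

Lemma lattice_sphereE lambda (x : 'rV[int]_3) : lattice_sphere lambda x ->
  (\sum_j x 0 j ^+ 2)%:~R = lambda ^+ 2.
Proof.
move=> xl; rewrite -xl enorm_sqr /dotv rmorph_sum; apply: eq_bigr => j _ /=.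
by rewrite rmorphXn /= mxE.
Qed.

(** The constant does not depend on [q] or [m]: the entries of [q] being O(lambda), the integer
    whose divisors are counted is polynomial in lambda. *)
Lemma sphere_plane_count (eps K : R) : 0 < eps -> 0 < K ->
  exists2 C : R, 0 < C & forall lambda, 1 < lambda ->
  forall (q : 'rV[int]_3) i, q 0 i != 0 ->
  (forall j, `|(q 0 j)%:~R| <= K * lambda) ->
  forall (m : int) (s : seq 'rV[int]_3), uniq s ->
  (forall x, x \in s -> lattice_sphere lambda x /\ \sum_j q 0 j * x 0 j = m) ->
  (size s)%:R <= C * lambda `^ eps.
Proof.
(* The integer N is at most K' lambda^10 and its divisor count enters squared: 2 * 10 * (eps / 20) =
   eps. *)
move=> eps0 K0; have e20 : 0 < eps / 20 by rewrite divr_gt0.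
have [C C0 dC] := divisor_bound e20.
pose K' := 1 + (3 * K ^+ 2) ^+ 4.
have K'0 : 0 < K' by rewrite ltr_pwDl// exprn_ge0// mulr_ge0// exprn_ge0// ltW.
exists (10 * (C * K' `^ (eps / 20)) ^+ 2).
  by rewrite mulr_gt0// exprn_gt0// mulr_gt0// powR_gt0.
move=> lambda l1 q i qi qK m s us sP.
have l0 : 0 < lambda by apply: lt_trans l1.
case: s us sP => [_ _|x s us sP].
  by rewrite !mulr_ge0// ?exprn_ge0 ?mulr_ge0 ?powR_ge0 ?ltW.
have [xl _] := sP x (mem_head _ _).
have nE := lattice_sphereE xl; set n := \sum_j _ in nE.
have [|N [N0 Nle sN]] := @size_sphere_plane q i m n _ qi us.
  move=> y /sP[yl ym]; split=> //; apply: (@intr_inj R).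
  by rewrite nE (lattice_sphereE yl).
have NK : N%:R <= K' * lambda ^+ 10.
  have -> : N%:R = N%:Z%:~R :> R by [].
  apply: (@le_trans _ _ (1 + (\sum_j q 0 j ^+ 2) ^+ 4 * `|n|)%:~R).
    by rewrite ler_int.
  rewrite rmorphD rmorphM rmorphXn /= intr_norm nE ger0_norm ?sqr_ge0//.
  rewrite mulrDl mul1r lerD//; first by rewrite exprn_ege1// ltW.
  have -> : (3 * K ^+ 2) ^+ 4 * lambda ^+ 10 =
    (3 * (K * lambda) ^+ 2) ^+ 4 * lambda ^+ 2 by ring.
  rewrite ler_wpM2r ?sqr_ge0// lerXn2r ?nnegrE//.
  - by rewrite ler0z sumr_ge0// => j _; rewrite sqr_ge0.
  - by rewrite mulr_ge0// sqr_ge0.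
  rewrite rmorph_sum /=.
  apply: (@le_trans _ _ (\sum_(j < 3) (K * lambda) ^+ 2)).
    apply: ler_sum => j _; rewrite rmorphXn /= -real_normK ?num_real//.
    by rewrite lerXn2r ?nnegrE// mulr_ge0 ?ltW.
  by rewrite sumr_const card_ord mulr_natl.
have dN : (size (divisors N))%:R <= C * K' `^ (eps / 20) * lambda `^ (eps / 2).
  apply: (le_trans (dC N N0)); rewrite -mulrA ler_pM2l//.
  apply: (@le_trans _ _ ((K' * lambda ^+ 10) `^ (eps / 20))).
    by rewrite ge0_ler_powR ?nnegrE ?mulr_ge0 ?exprn_ge0 // ltW.
  rewrite powRM ?exprn_ge0 ?(ltW l0) ?(ltW K'0)// -powR_mulrn ?(ltW l0)// -powRrM.
  by rewrite (_ : 10 * (eps / 20) = eps / 2)//; field.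
apply: (@le_trans _ _ (size (divisors N) * (size (divisors N) * 10))%:R).
  by rewrite ler_nat.
rewrite !natrM.
have -> : lambda `^ eps = (lambda `^ (eps / 2)) ^+ 2.
  by rewrite -powR_mulrn ?powR_ge0// -powRrM; congr powR; field.
rewrite mulrA mulrC -expr2 -mulrA -exprMn ler_pM2l//.
by rewrite lerXn2r// nnegrE// mulr_ge0 ?powR_ge0// mulr_ge0 ?powR_ge0 ?ltW.
Qed.

Lemma size_slices (T : Type) (g : T -> int) (c l : R) (B : R) (s : seq T) :
  0 <= l ->
  (forall v : int, (size [seq x <- s | g x == v])%:R <= B) ->
  all (fun x => `|(g x)%:~R - c| <= l) s ->
  (size s)%:R <= (2 * l + 1) * B.
Proof.
move=> l0 gB sl; pose z0 := Num.ceil (c - l).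
pose vals := [seq z0 + i%:Z | i <- iota 0 (Num.truncn (2 * l)).+1].
have B0 : 0 <= B by apply: le_trans (gB 0).
have gBn (u : int) : (size [seq x <- s | g x == u] <= Num.truncn B)%N.
  by rewrite truncn_ge_nat.
have sv : all (fun x => g x \in vals) s.
  apply: sub_all sl => x; rewrite ler_distl => /andP[h1 h2].
  have z0g : z0 <= g x by rewrite ceil_le_int.
  apply/mapP; exists `|g x - z0|%N; last by rewrite gez0_abs ?subr_ge0 // subrKC.
  rewrite mem_iota /= add0n ltnS truncn_ge_nat ?mulr_ge0//.
  have -> : (`|g x - z0|%N)%:R = (g x - z0)%:~R :> R.
    by rewrite -[LHS]/((`|g x - z0|%N : int)%:~R) gez0_abs ?subr_ge0.
  rewrite rmorphB /=; have := ceil_ge (c - l); rewrite -/z0; lra.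
have := size_fibers sv gBn; rewrite size_map size_iota => h.
apply: (@le_trans _ _ ((Num.truncn (2 * l)).+1 * Num.truncn B)%:R).
  by rewrite ler_nat.
rewrite natrM ler_pM//.
  by rewrite -natr1 lerD2r truncn_le ?mulr_ge0.
by rewrite truncn_le.
Qed.

Lemma harmonic_le (N : nat) : (0 < N)%N ->
  \sum_(1 <= j < N.+1) (j%:R : R)^-1 <= 1 + ln N%:R.
Proof.
elim: N => [//|[_ _|N IH _]].
  by rewrite big_nat1 invr1 ln1 addr0.
rewrite big_nat_recr//= (le_trans (lerD (IH _) (lexx _)))// -addrA lerD2l.
have N1 : 0 < N.+1%:R :> R by [].
have N2 : 0 < N.+2%:R :> R by [].
have : - ln (N.+1%:R / N.+2%:R : R) >= N.+2%:R^-1.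
  rewrite lerNr; have -> : N.+1%:R / N.+2%:R = 1 + (- N.+2%:R^-1) :> R.
    by rewrite -[N.+2%:R]natr1; field; apply: lt0r_neq0; rewrite -[N.+2%:R]natr1 in N2; lra.
  by apply: le_ln1Dx; rewrite ltrN2 invf_lt1// ltr1n.
by rewrite ln_div ?posrE// opprB lerBrDr addrC.
Qed.

(** The sum telescopes: if J is the least positive integer above x, the right-hand side is 2 / J,
    and J <= 2 max(1, x). Written this way, the summand depends on x only through the indicators of
    x < j. *)
Lemma inv_max_le (x : R) (N : nat) : x < N%:R ->
  (Num.max 1 x)^-1 <= 2 / N.+1%:R +
    2 * \sum_(1 <= j < N.+1) (x < j%:R)%R%:R / (j%:R * j.+1%:R).
Proof.
have m1 : 1 <= Num.max 1 x by rewrite le_max lexx.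
have m0 : 0 < Num.max 1 x by rewrite (lt_le_trans ltr01).
have mi : (Num.max 1 x)^-1 <= 1 by rewrite invf_le1.
elim: N => [_|N IH xN].
  by rewrite big_geq// mulr0 addr0 divr1 (le_trans mi)// ler1n.
have N1 : 0 < N.+1%:R :> R by [].
have N2 : 0 < N.+2%:R :> R by [].
rewrite big_nat_recr//= xN; set S := \sum_(_ <= _ < _) _ in IH *.
have -> : 2 / N.+2%:R = 2 / N.+1%:R - 2 / (N.+1%:R * N.+2%:R) :> R.
  rewrite -[N.+2%:R]natr1 in N2 *; field.
  by apply/andP; split; apply: lt0r_neq0; lra.
set a := 2 / N.+1%:R in IH *; set c := N.+1%:R * N.+2%:R.
have -> : a - 2 / c + 2 * (S + true%:R / c) = a + 2 * S.
  by rewrite (_ : true%:R = 1 :> R)//; ring.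
case: (ltrP x N%:R) => [/IH//|Nx].
apply: ler_wpDr.
  by apply: mulr_ge0 => //; apply: sumr_ge0 => j _; rewrite divr_ge0 ?mulr_ge0.
rewrite -[leLHS]mul1r ler_pdivrMr// mulrAC ler_pdivlMr// mul1r.
have : x <= Num.max 1 x by rewrite le_max lexx orbT.
rewrite -natr1; lra.
Qed.

(** Summation by parts: a count A j against the weight 1 / (j (j + 1)) leaves a harmonic sum, so
    linear growth of the counts costs only a logarithm. *)
Lemma sum_inv_le (T : eqType) (s : seq T) (x : T -> R) (A : R) (N : nat) :
  (0 < N)%N -> (forall t, t \in s -> x t < N%:R) ->
  (forall j : nat, (0 < j)%N -> (size [seq t <- s | x t < j%:R])%:R <= A * j%:R) ->
  \sum_(t <- s) (Num.max 1 (x t))^-1 <= 2 * A * (2 + ln N%:R).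
Proof.
move=> N0 xN cA.
have A0 : 0 <= A by have := cA 1%N isT; rewrite mulr1; apply: le_trans.
apply: (@le_trans _ _ (\sum_(t <- s) (2 / N.+1%:R +
    2 * \sum_(1 <= j < N.+1) (x t < j%:R)%R%:R / (j%:R * j.+1%:R)))).
  by rewrite !big_seq; apply: ler_sum => t /xN; exact: inv_max_le.
rewrite big_split /= -!mulr_sumr -mulrDr -mulrA.
rewrite [X in _ + X]exchange_big /=.
rewrite ler_pM2l// [_ + ln _](_ : _ = 1 + (1 + ln N%:R)); last by lra.
rewrite mulrDr lerD//.
  rewrite big_const_seq count_predT iter_addr_0 -(mulr_natl _ (size s)).
  rewrite ler_pdivrMr// mulr1.
  have := cA N N0; rewrite (_ : [seq _ <- _ | _] = s).
    by move/le_trans; apply; rewrite ler_wpM2l// ler_nat.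
  by apply/all_filterP/allP.
apply: le_trans (_ : A * \sum_(1 <= j < N.+1) (j%:R)^-1 <= _); last first.
  by rewrite ler_wpM2l// harmonic_le.
rewrite mulr_sumr !big_nat; apply: ler_sum => j /andP[j1 _].
have j0 : 0 < j%:R :> R by rewrite ltr0n.
rewrite -mulr_suml ler_pdivrMr ?mulr_gt0//.
have -> : A / j%:R * (j%:R * j.+1%:R) = A * j.+1%:R by field; rewrite gt_eqF.
apply: (@le_trans _ _ (A * j%:R)); last by rewrite ler_wpM2l// ler_nat.
apply: le_trans (cA j j1).
rewrite le_eqVlt; apply/orP; left; apply/eqP.
elim: (s) => [|t s' IH]; first by rewrite big_nil.
by rewrite big_cons IH /=; case: (x t < _); rewrite ?add0r// -[RHS]natr1 addrC.
Qed.
End Counting.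

(** * Van der Corput estimates *)

Section Derivatives.
Variable R : realType.
Implicit Types (f g F G H A : R -> R) (s t : R).

(** The derivative is two-sided at the endpoints as well. For continuous g, the increment of f is
    the integral of g, and comparing integrals means comparing increments. *)
Definition derives s s' f g := forall t, s <= t <= s' -> is_derive t 1 f (g t).

Lemma derives_sub s s' p p' f g : s <= p -> p' <= s' ->
  derives s s' f g -> derives p p' f g.
Proof.
move=> sp ps fg t /andP[pt tp]; apply: fg.
by rewrite (le_trans sp pt) (le_trans tp ps).
Qed.

Lemma derives_continuous s s' f g : derives s s' f g ->
  {within `[s, s'], continuous f}.
Proof.
move=> fg; apply: derivable_within_continuous => t; rewrite in_itv /= => ts.
by have [] := fg t ts.
Qed.

Lemma derives_eq s s' f g h : (forall t, s <= t <= s' -> g t = h t) ->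
  derives s s' f g -> derives s s' f h.
Proof. by move=> gh fg t ts; rewrite -gh//; apply: fg. Qed.

Lemma derivesD s s' f g F G : derives s s' F f -> derives s s' G g ->
  derives s s' (fun t => F t + G t) (fun t => f t + g t).
Proof. by move=> h h' t ts; apply: is_deriveD; [apply: h | apply: h']. Qed.

Lemma derivesN s s' f F : derives s s' F f ->
  derives s s' (fun t => - F t) (fun t => - f t).
Proof. by move=> h t ts; apply: is_deriveN; apply: h. Qed.

Lemma derivesZ s s' k f F : derives s s' F f ->
  derives s s' (fun t => k * F t) (fun t => k * f t).
Proof.
move=> h t ts; have := h t ts => ?.
by apply: (@is_deriveZ R R R F k t 1).
Qed.

Lemma derives_cst s s' (k : R) : derives s s' (fun=> k) (fun=> 0).
Proof. by move=> t _; apply: is_derive_cst. Qed.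

Lemma derives_id s s' : derives s s' id (fun=> 1).
Proof. by move=> t _; apply: is_derive_id. Qed.

Lemma derivesM s s' f g F G : derives s s' F f -> derives s s' G g ->
  derives s s' (fun t => F t * G t) (fun t => F t * g t + G t * f t).
Proof.
move=> h h' t ts; have := h t ts => ?; have := h' t ts => ?.
exact: is_deriveM.
Qed.

Lemma derivesV s s' f F : (forall t, s <= t <= s' -> F t != 0) ->
  derives s s' F f ->
  derives s s' (fun t => (F t)^-1) (fun t => - (F t) ^- 2 * f t).
Proof.
move=> F0 h t ts; have := h t ts => ?.
exact: (@is_deriveV _ _ _ _ _ (F0 t ts)).
Qed.

Lemma derives_comp s s' f F G g : derives s s' F f ->
  (forall t, is_derive t 1 G (g t)) ->
  derives s s' (fun t => G (F t)) (fun t => g (F t) * f t).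
Proof.
move=> h h' t ts; have := h t ts => ?; have := h' (F t) => ?.
exact: is_derive1_comp.
Qed.

Lemma derives_le s s' F G f g : s <= s' -> derives s s' F f ->
  derives s s' G g -> (forall t, s <= t <= s' -> f t <= g t) ->
  F s' - F s <= G s' - G s.
Proof.
move=> ss' dF dG fg.
have dH := derivesD dG (derivesN dF).
have [|c /[!in_itv]/= cs] := @MVT_segment R (fun t => G t + - F t)
    (fun t => g t + - f t) s s' ss' _ (derives_continuous dH).
  by move=> t /[!in_itv]/= /andP[st ts']; apply: dH; rewrite !ltW.
have : 0 <= (g c - f c) * (s' - s) by rewrite mulr_ge0// subr_ge0// fg.
by move=> + e; rewrite -e; lra.
Qed.

Lemma derives_norm_le s s' F f M : s <= s' -> derives s s' F f ->
  (forall t, s <= t <= s' -> `|f t| <= M) ->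
  `|F s' - F s| <= M * (s' - s).
Proof.
move=> ss' dF fM; rewrite ler_norml.
have dM k := derivesZ k (@derives_id s s').
have fM' t : s <= t <= s' -> - M <= f t <= M by move/fM; rewrite ler_norml.
have h1 := derives_le ss' (dM (- M)) dF.
have h2 := derives_le ss' dF (dM M).
have : - M * s' - - M * s <= F s' - F s by apply: h1 => t /fM'; lra.
have : F s' - F s <= M * s' - M * s by apply: h2 => t /fM'; lra.
lra.
Qed.

(* A piece may degenerate to a point, where nothing is claimed. *)
Lemma monotone_split s s' f y : s <= s' -> {within `[s, s'], continuous f} ->
  (forall t u, s <= t -> t <= u -> u <= s' -> f t <= f u) ->
  exists p, [/\ s <= p <= s', p = s \/ (forall t, s <= t <= p -> f t <= y) &
                p = s' \/ (forall t, p <= t <= s' -> y <= f t)].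
Proof.
move=> ss' cf mf; have [ys|sy] := leP y (f s).
  exists s; split; [by rewrite lexx | by left | right].
  by move=> t /andP[st ts]; apply: le_trans ys _; apply: mf.
have [ys|sy'] := leP (f s') y.
  exists s'; split; [by rewrite ss' lexx | right | by left].
  by move=> t /andP[st ts]; apply: le_trans ys; apply: mf.
have fss := mf s s' (lexx _) ss' (lexx _).
have [|p /[!in_itv]/= /andP[sp ps] fp] := IVT (v := y) ss' cf.
  by rewrite (min_idPl fss) (max_idPr fss) !ltW.
exists p; split; [by rewrite sp ps | right | right] => t /andP[h1 h2].
  by rewrite -fp; apply: mf.
by rewrite -fp; apply: mf.
Qed.

Lemma derives_homo s s' F f : derives s s' F f ->
  (forall t, s <= t <= s' -> 0 <= f t) ->
  forall t u, s <= t -> t <= u -> u <= s' -> F t <= F u.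
Proof.
move=> dF f0 t u st tu us; rewrite -subr_ge0.
have := derives_le tu (@derives_cst t u 0) (derives_sub st us dF).
rewrite subrr; apply => v /andP[tv vu].
by apply: f0; rewrite (le_trans st tv) (le_trans vu us).
Qed.

(** Integration by parts with G = sin(phi) / phi', whose derivative is cos(phi) - sin(phi) phi'' /
    phi'^2: the boundary terms give 2 / d, and H absorbs the error. Leaving h free covers both a
    monotone phi', with H = -1 / phi', and a bounded phi'', with H linear. *)
Lemma nonstationary_bound (phi phi1 phi2 A : R -> R) s s' (H h : R -> R) (d : R) :
  0 < d -> s <= s' ->
  derives s s' phi phi1 -> derives s s' phi1 phi2 ->
  derives s s' A (fun t => cos (phi t)) -> derives s s' H h ->
  (forall t, s <= t <= s' -> d <= `|phi1 t|) ->
  (forall t, s <= t <= s' -> `|phi2 t| <= h t * phi1 t ^+ 2) ->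
  `|A s' - A s| <= 2 / d + (H s' - H s).
Proof.
move=> d0 ss' dphi dphi1 dA dH dle hle.
have n0 t : s <= t <= s' -> phi1 t != 0.
  by move=> ts; rewrite -normr_gt0 (lt_le_trans d0)// dle.
have dG := derivesM (derives_comp dphi (@is_derive_sin R)) (derivesV n0 dphi1).
set G := (fun t => sin _ * _) in dG.
have {}dG : derives s s' G
    (fun t => cos (phi t) - sin (phi t) * (phi2 t / phi1 t ^+ 2)).
  apply: derives_eq dG => t ts; field; exact: n0.
have Gd t : s <= t <= s' -> `|G t| <= d^-1.
  move=> ts; rewrite /G normrM normfV -[leRHS]mul1r ler_pM ?invr_ge0//.
    by rewrite ler_norml sin_geN1 sin_le1.
  by rewrite lef_pV2 ?posrE ?dle// normr_gt0 n0.
have err t : s <= t <= s' -> `|sin (phi t) * (phi2 t / phi1 t ^+ 2)| <= h t.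
  move=> ts; rewrite normrM -[leRHS]mul1r ler_pM//.
    by rewrite ler_norml sin_geN1 sin_le1.
  rewrite normrM normfV normrX real_normK ?num_real//.
  by rewrite ler_pdivrMr ?hle// exprn_even_gt0//= n0.
have ss1 : s <= s <= s' by rewrite lexx.
have ss2 : s <= s' <= s' by rewrite lexx ss'.
have h1 : A s' - A s <= G s' + H s' - (G s + H s).
  apply: (derives_le ss' dA (derivesD dG dH)) => t ts.
  by have := err t ts; rewrite ler_norml; lra.
have h2 : G s' + - H s' - (G s + - H s) <= A s' - A s.
  apply: (derives_le ss' (derivesD dG (derivesN dH)) dA) => t ts.
  by have := err t ts; rewrite ler_norml; lra.
have := Gd s ss1; have := Gd s' ss2; move: h1 h2.
have -> : 2 / d = d^-1 + d^-1 by lra.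
rewrite !ler_norml; lra.
Qed.

Lemma constant_sign s s' f m : 0 < m -> s <= s' ->
  {within `[s, s'], continuous f} ->
  (forall t, s <= t <= s' -> m <= `|f t|) ->
  (forall t, s <= t <= s' -> m <= f t) \/
  (forall t, s <= t <= s' -> m <= - f t).
Proof.
move=> m0 ss' cf mf.
have key u v : s <= u -> u <= v -> v <= s' -> (0 < f u) = (0 < f v).
  move=> su uv vs; apply/idP/idP => fu; rewrite ltNge; apply/negP => fv.
    have cuv : {within `[u, v], continuous f}.
      by apply: continuous_subspaceW cf; apply: subset_itv; rewrite bnd_simp.
    have [|c /[!in_itv]/= /andP[uc cv] fc] := IVT (v := 0) uv cuv.
      by rewrite ge_min fv orbT le_max ltW.
    have := mf c; rewrite (le_trans su uc) (le_trans cv vs) fc normr0 => /(_ isT).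
    by rewrite leNgt m0.
  have cuv : {within `[u, v], continuous f}.
    by apply: continuous_subspaceW cf; apply: subset_itv; rewrite bnd_simp.
  have [|c /[!in_itv]/= /andP[uc cv] fc] := IVT (v := 0) uv cuv.
    by rewrite ge_min fv le_max (ltW fu) orbT.
  have := mf c; rewrite (le_trans su uc) (le_trans cv vs) fc normr0 => /(_ isT).
  by rewrite leNgt m0.
have [fs|fs] := ltP 0 (f s); [left|right] => t /andP[st ts];
  have := mf t; rewrite st ts => /(_ isT).
  by rewrite gtr0_norm// -(key s t).
by rewrite ler0_norm// leNgt -(key s t)// -leNgt.
Qed.

Section VanDerCorput.

Let ends s s' : s <= s' -> s <= s <= s' /\ s <= s' <= s'.
Proof. by move=> ss'; rewrite !lexx ss'. Qed.

(** Take H = -1 / phi' in the integration by parts: its derivative is exactly phi'' / phi'^2, and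
    its increment is at most 2 / d. *)
Lemma van_der_corput1 (phi phi1 phi2 A : R -> R) s s' (d : R) :
  0 < d -> s <= s' ->
  derives s s' phi phi1 -> derives s s' phi1 phi2 ->
  derives s s' A (fun t => cos (phi t)) ->
  (forall t, s <= t <= s' -> d <= `|phi1 t|) ->
  (forall t, s <= t <= s' -> 0 <= phi2 t) ->
  `|A s' - A s| <= 4 / d.
Proof.
move=> d0 ss' dphi dphi1 dA dle phi20.
have [ss1 ss2] := ends ss'.
have n0 t : s <= t <= s' -> phi1 t != 0.
  by move=> ts; rewrite -normr_gt0 (lt_le_trans d0)// dle.
have dH := derivesN (derivesV n0 dphi1).
have iv t : s <= t <= s' -> `|(phi1 t)^-1| <= d^-1.
  by move=> ts; rewrite normfV lef_pV2 ?posrE ?dle// normr_gt0 n0.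
apply: le_trans (nonstationary_bound d0 ss' dphi dphi1 dA dH dle _) _.
  move=> t ts; rewrite ger0_norm ?phi20// le_eqVlt; apply/orP; left; apply/eqP.
  by field; exact: n0.
move: (iv s ss1) (iv s' ss2); rewrite !ler_norml.
move: (phi1 s)^-1 (phi1 s')^-1 d^-1 => x y z.
by clear; lra.
Qed.

Lemma cos_antideriv_le (phi A : R -> R) s s' : s <= s' ->
  derives s s' A (fun t => cos (phi t)) -> `|A s' - A s| <= s' - s.
Proof.
move=> ss' dA; rewrite -[leRHS]mul1r; apply: derives_norm_le dA _ => // t _.
by rewrite ler_norml cos_geN1 cos_le1.
Qed.

Lemma dist_chain A s p q s' (a b c d : R) :
  `|A p - A s| <= a -> `|A q - A p| <= b -> `|A s' - A q| <= c ->
  a + b + c = d -> `|A s' - A s| <= d.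
Proof. by rewrite !ler_norml; lra. Qed.

(** The increasing function phi' is cut at -mu and mu. Outside, the first-derivative bound gives 4 /
    mu on each side; in between, phi' varies by at most 2 mu with slope at least mu^2, so the length
    is at most 2 / mu. Stating the lower bound as a power of mu avoids roots. *)
Let van_der_corput2_pos (phi phi1 phi2 A : R -> R) s s' (mu : R) :
  0 < mu -> s <= s' ->
  derives s s' phi phi1 -> derives s s' phi1 phi2 ->
  derives s s' A (fun t => cos (phi t)) ->
  (forall t, s <= t <= s' -> mu ^+ 2 <= phi2 t) ->
  `|A s' - A s| <= 10 / mu.
Proof.
move=> mu0 ss' d0 d1 dA m2.
have p20 t : s <= t <= s' -> 0 <= phi2 t.
  by move=> /m2; apply: le_trans; exact: sqr_ge0.
have mono := derives_homo d1 p20.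
have [p [/andP[sp ps'] hsp hps]] :=
  monotone_split (- mu) ss' (derives_continuous d1) mono.
have d1p := derives_sub sp (lexx s') d1.
have [q [/andP[pq qs'] hpq hqs]] := monotone_split mu ps' (derives_continuous d1p)
   (fun t u pt tu us => mono t u (le_trans sp pt) tu us).
have sq := le_trans sp pq.
have pos x : 0 <= x / mu = (0 <= x) by rewrite pmulr_lge0 ?invr_gt0.
apply: (@dist_chain A s p q s' (4 / mu) (2 / mu) (4 / mu)); last by field; lra.
- case: hsp => [->|hsp]; first by rewrite subrr normr0 pos.
  apply: (van_der_corput1 mu0 sp (derives_sub (lexx s) ps' d0)
    (derives_sub (lexx s) ps' d1) (derives_sub (lexx s) ps' dA)).
    by move=> t /hsp h; rewrite ler0_norm; lra.
  by move=> t /andP[st tp]; apply: p20; rewrite st (le_trans tp).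
- have [pq'|pq'] := eqVneq p q; first by rewrite -pq' subrr normr0 pos.
  apply: (le_trans (cos_antideriv_le pq (derives_sub sp qs' dA))).
  have := derives_le pq (derivesZ (mu ^+ 2) (@derives_id p q))
    (derives_sub sp qs' d1).
  have q0 : phi1 q <= mu.
    by case: hpq => [e|->//]; [rewrite e eqxx in pq' | rewrite pq lexx].
  have p0 : - mu <= phi1 p.
    case: hps => [e|->//]; last by rewrite lexx.
    by case/eqP: pq'; apply/eqP; rewrite eq_le pq e qs'.
  have H t : p <= t <= q -> mu ^+ 2 * 1 <= phi2 t.
    move=> /andP[pt tq]; rewrite mulr1 m2//.
    by rewrite (le_trans sp pt) (le_trans tq qs').
  move=> /(_ H) hh; rewrite ler_pdivlMr//.
  have := le_trans hh (lerB q0 p0); rewrite -mulrBr (_ : mu - - mu = mu * 2); last by ring.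
  by rewrite expr2 -mulrA ler_pM2l// mulrC.
- case: hqs => [->|hqs]; first by rewrite subrr normr0 pos.
  apply: (van_der_corput1 mu0 qs' (derives_sub sq (lexx s') d0)
    (derives_sub sq (lexx s') d1) (derives_sub sq (lexx s') dA)).
    by move=> t /hqs h; rewrite ger0_norm; lra.
  by move=> t /andP[qt ts]; apply: p20; rewrite (le_trans sq qt).
Qed.

Lemma cos_derivesN (phi A : R -> R) s s' : derives s s' A (fun t => cos (phi t)) ->
  derives s s' A (fun t => cos (- phi t)).
Proof. by apply: derives_eq => t _; rewrite cosN. Qed.

Lemma van_der_corput2 (phi phi1 phi2 A : R -> R) s s' (mu : R) :
  0 < mu -> s <= s' ->
  derives s s' phi phi1 -> derives s s' phi1 phi2 ->
  {within `[s, s'], continuous phi2} ->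
  derives s s' A (fun t => cos (phi t)) ->
  (forall t, s <= t <= s' -> mu ^+ 2 <= `|phi2 t|) ->
  `|A s' - A s| <= 10 / mu.
Proof.
move=> mu0 ss' d0 d1 c2 dA m2.
have [h|h] := constant_sign (exprn_gt0 2 mu0) ss' c2 m2.
  exact: van_der_corput2_pos d0 d1 dA h.
exact: van_der_corput2_pos (derivesN d0) (derivesN d1) (cos_derivesN dA) h.
Qed.

(** The same cut one order higher: phi'' is cut at -mu^2 and mu^2, which gives 10 + 2 + 10 = 22. *)
Let van_der_corput3_pos (phi phi1 phi2 phi3 A : R -> R) s s' (mu : R) :
  0 < mu -> s <= s' ->
  derives s s' phi phi1 -> derives s s' phi1 phi2 -> derives s s' phi2 phi3 ->
  derives s s' A (fun t => cos (phi t)) ->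
  (forall t, s <= t <= s' -> mu ^+ 3 <= phi3 t) ->
  `|A s' - A s| <= 22 / mu.
Proof.
move=> mu0 ss' d0 d1 d2 dA m3.
have mu30 := exprn_gt0 3 mu0; have mu20 := exprn_gt0 2 mu0.
have p30 t : s <= t <= s' -> 0 <= phi3 t.
  by move=> /m3; apply: le_trans; exact: ltW.
have mono := derives_homo d2 p30.
have [p [/andP[sp ps'] hsp hps]] :=
  monotone_split (- mu ^+ 2) ss' (derives_continuous d2) mono.
have d2p := derives_sub sp (lexx s') d2.
have [q [/andP[pq qs'] hpq hqs]] := monotone_split (mu ^+ 2) ps'
   (derives_continuous d2p)
   (fun t u pt tu us => mono t u (le_trans sp pt) tu us).
have sq := le_trans sp pq.
have pos x : 0 <= x / mu = (0 <= x) by rewrite pmulr_lge0 ?invr_gt0.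
apply: (@dist_chain A s p q s' (10 / mu) (2 / mu) (10 / mu)); last by field; lra.
- case: hsp => [->|hsp]; first by rewrite subrr normr0 pos.
  apply: (van_der_corput2 mu0 sp (derives_sub (lexx s) ps' d0)
    (derives_sub (lexx s) ps' d1)
    (derives_continuous (derives_sub (lexx s) ps' d2))
    (derives_sub (lexx s) ps' dA)).
  by move=> t /hsp h; rewrite ler0_norm; lra.
- have [pq'|pq'] := eqVneq p q; first by rewrite -pq' subrr normr0 pos.
  apply: (le_trans (cos_antideriv_le pq (derives_sub sp qs' dA))).
  have := derives_le pq (derivesZ (mu ^+ 3) (@derives_id p q))
    (derives_sub sp qs' d2).
  have q0 : phi2 q <= mu ^+ 2.
    by case: hpq => [e|->//]; [rewrite e eqxx in pq' | rewrite pq lexx].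
  have p0 : - mu ^+ 2 <= phi2 p.
    case: hps => [e|->//]; last by rewrite lexx.
    by case/eqP: pq'; apply/eqP; rewrite eq_le pq e qs'.
  have H t : p <= t <= q -> mu ^+ 3 * 1 <= phi3 t.
    move=> /andP[pt tq]; rewrite mulr1 m3//.
    by rewrite (le_trans sp pt) (le_trans tq qs').
  move=> /(_ H) hh; rewrite ler_pdivlMr//.
  have := le_trans hh (lerB q0 p0); rewrite -mulrBr.
  rewrite (_ : mu ^+ 2 - - mu ^+ 2 = mu ^+ 2 * 2); last by ring.
  by rewrite exprSr -mulrA ler_pM2l// mulrC.
- case: hqs => [->|hqs]; first by rewrite subrr normr0 pos.
  apply: (van_der_corput2 mu0 qs' (derives_sub sq (lexx s') d0)
    (derives_sub sq (lexx s') d1)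
    (derives_continuous (derives_sub sq (lexx s') d2))
    (derives_sub sq (lexx s') dA)).
  by move=> t /hqs h; rewrite ger0_norm; lra.
Qed.

Lemma van_der_corput3 (phi phi1 phi2 phi3 A : R -> R) s s' (mu : R) :
  0 < mu -> s <= s' ->
  derives s s' phi phi1 -> derives s s' phi1 phi2 -> derives s s' phi2 phi3 ->
  {within `[s, s'], continuous phi3} ->
  derives s s' A (fun t => cos (phi t)) ->
  (forall t, s <= t <= s' -> mu ^+ 3 <= `|phi3 t|) ->
  `|A s' - A s| <= 22 / mu.
Proof.
move=> mu0 ss' d0 d1 d2 c3 dA m3.
have [h|h] := constant_sign (exprn_gt0 3 mu0) ss' c3 m3.
  exact: van_der_corput3_pos d0 d1 d2 dA h.
exact: van_der_corput3_pos (derivesN d0) (derivesN d1) (derivesN d2)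
  (cos_derivesN dA) h.
Qed.

End VanDerCorput.
End Derivatives.

(** * Phases along a curve *)

Section LocalPhase.
Variable R : realType.
Implicit Types (s t : R).

Lemma within_continuous_near (a b t0 e : R) (g : R -> R) :
  {within `[a, b], continuous g} -> a <= t0 <= b -> 0 < e ->
  exists2 d, 0 < d &
    forall t, a <= t <= b -> `|t - t0| <= d -> `|g t - g t0| <= e.
Proof.
move=> cg t0ab e0.
have /subspace_continuousP cg' := cg.
have := cg' t0; rewrite /= in_itv /= => /(_ t0ab).
move=> /cvgrPdist_le /(_ e e0); rewrite near_withinE => /nbhs_ballP[d /= d0 dP].
exists (d / 2); first by rewrite divr_gt0.
move=> t tab td; rewrite distrC; apply: dP; last by rewrite /= in_itv.
by rewrite /ball /= distrC (le_lt_trans td)// ltr_pdivrMr// ltr_pMr// ltr1n.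
Qed.

Lemma within_continuous_comb s s' (g1 g2 g3 : R -> R) (al be ka : R) :
  {within `[s, s'], continuous g1} -> {within `[s, s'], continuous g2} ->
  {within `[s, s'], continuous g3} ->
  {within `[s, s'], continuous (fun t => al * g1 t + be * g2 t + ka * g3 t)}.
Proof.
move=> c1 c2 c3 x; apply: cvgD; first apply: cvgD.
- by apply: cvgM; [exact: cvg_cst | exact: c1].
- by apply: cvgM; [exact: cvg_cst | exact: c2].
- by apply: cvgM; [exact: cvg_cst | exact: c3].
Qed.

Lemma normM_le (x y X Y : R) : `|x| <= X -> `|y| <= Y -> `|x * y| <= X * Y.
Proof. by move=> hx hy; rewrite normrM ler_pM. Qed.

Lemma ler_norm4 (x y z w : R) :
  `|x + y + z + w| <= `|x| + `|y| + `|z| + `|w|.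
Proof.
apply: (le_trans (ler_normD _ _)); rewrite lerD2r.
by apply: (le_trans (ler_normD _ _)); rewrite lerD2r ler_normD.
Qed.

(** These are the components of the curve along T, N / |N|^2 and T x N, each followed by its
    derivatives. Near t0 one has u' close to 1, v'' close to 1, and v' and u'' close to 0. *)
Variables (u u1 u2 u3 v v1 v2 v3 f f1 f2 f3 : R -> R).

(** If |be| dominates, the second derivative of the phase is be up to three errors of r^2 / 10, and
    the second-derivative test applies. If |al| dominates, the first derivative is al up to the same
    errors while the second is O(r^2), and integration by parts suffices. *)
Lemma flat_phase_bound s s' (L al be ka th r : R) (A : R -> R) :
  s <= s' -> s' - s <= L -> 1 <= r -> Num.max `|al| `|be| = r ^+ 2 ->
  derives s s' u u1 -> derives s s' u1 u2 ->
  derives s s' v v1 -> derives s s' v1 v2 ->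
  derives s s' f f1 -> derives s s' f1 f2 ->
  {within `[s, s'], continuous u2} -> {within `[s, s'], continuous v2} ->
  {within `[s, s'], continuous f2} ->
  (forall t, s <= t <= s' ->
    [/\ `|u1 t - 1| <= 10^-1, `|v1 t| <= 10^-1, `|u2 t| <= 10^-1,
        `|v2 t - 1| <= 10^-1 &
        `|ka * f1 t| <= 10^-1 * r ^+ 2 /\ `|ka * f2 t| <= 10^-1 * r ^+ 2]) ->
  derives s s' A (fun t => cos (al * u t + be * v t + ka * f t + th)) ->
  `|A s' - A s| <= (20 + 8 * L) / r.
Proof.
move=> ss' sL r1 rE du du1 dv dv1 df df1 cu2 cv2 cf2 H dA.
have r0 : 0 < r by lra.
have r20 : 0 < r ^+ 2 by rewrite exprn_gt0.
have L0 : 0 <= L by apply: le_trans sL; rewrite subr_ge0.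
have comb g1 g2 g3 h1 h2 h3 : derives s s' g1 h1 -> derives s s' g2 h2 ->
    derives s s' g3 h3 -> derives s s'
      (fun t => al * g1 t + be * g2 t + ka * g3 t)
      (fun t => al * h1 t + be * h2 t + ka * h3 t).
  by move=> *; apply: derivesD; [apply: derivesD|]; apply: derivesZ.
have d0 := derivesD (comb _ _ _ _ _ _ du dv df) (@derives_cst _ s s' th).
have d1 := comb _ _ _ _ _ _ du1 dv1 df1.
have {}d0 := derives_eq (fun t _ => addr0 _) d0.
have [ab|ba] := leP `|al| `|be|.
  have be_r : `|be| = r ^+ 2 by rewrite -rE; apply/esym/max_idPr.
  apply: (@le_trans _ _ (10 / (r / 2))); last first.
    rewrite (_ : 10 / (r / 2) = 20 / r); last by field; lra.
    by rewrite ler_pM2r ?invr_gt0// lerDl mulr_ge0.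
  apply: (van_der_corput2 (mu := r / 2) _ ss' d0 d1 _ dA).
  - lra.
  - exact: within_continuous_comb.
  - move=> t /H[_ _ h2 h3 [_ h5]].
    set X := al * u2 t + be * v2 t + ka * f2 t.
    have := ler_norm4 X (- (al * u2 t)) (- (be * (v2 t - 1))) (- (ka * f2 t)).
    have -> : X - al * u2 t - be * (v2 t - 1) - ka * f2 t = be.
      by rewrite /X; ring.
    have p1 := normM_le ab h2; have p2 := normM_le (lexx `|be|) h3.
    rewrite !normrN; move: p1 p2; rewrite be_r.
    by rewrite (_ : (r / 2) ^+ 2 = r ^+ 2 / 4); [lra|field].
have al_r : `|al| = r ^+ 2 by rewrite -rE; apply/esym/max_idPl/ltW.
have d0' : 0 < r ^+ 2 / 2 by rewrite divr_gt0 ?exprn_gt0.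
(* The second derivative is at most 2 r^2 and the square of the first at least (r^2 / 2)^2; the
   ratio is 8 / r^2. *)
have dH := derivesZ (8 / r ^+ 2) (@derives_id _ s s').
have r2 : r <= r ^+ 2 by rewrite expr2 ler_peMr// ltW.
have hb : `|be| <= r ^+ 2 by rewrite -al_r ltW.
apply: (le_trans (nonstationary_bound d0' ss' d0 d1 dA dH _ _)).
- move=> t /H[h0 h1 _ _ [h4 _]].
  set X := al * u1 t + be * v1 t + ka * f1 t.
  have := ler_norm4 X (- (al * (u1 t - 1))) (- (be * v1 t)) (- (ka * f1 t)).
  have -> : X - al * (u1 t - 1) - be * v1 t - ka * f1 t = al.
    by rewrite /X; ring.
  have p1 := normM_le hb h1; have p2 := normM_le (lexx `|al|) h0.
  rewrite !normrN; move: p1 p2; rewrite al_r; lra.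
- move=> t tss; have [h0 h1 h2 h3 [h4 h5]] := H t tss.
  set X := al * u1 t + be * v1 t + ka * f1 t.
  have X2 : r ^+ 2 / 2 <= `|X|.
    have := ler_norm4 X (- (al * (u1 t - 1))) (- (be * v1 t)) (- (ka * f1 t)).
    have -> : X - al * (u1 t - 1) - be * v1 t - ka * f1 t = al.
      by rewrite /X; ring.
    have p1 := normM_le hb h1; have p2 := normM_le (lexx `|al|) h0.
    rewrite !normrN; move: p1 p2; rewrite al_r; lra.
  apply: (@le_trans _ _ (2 * r ^+ 2)).
    have := ler_norm4 (al * u2 t) (be * (v2 t - 1)) be (ka * f2 t).
    have -> : al * u2 t + be * (v2 t - 1) + be + ka * f2 t =
       al * u2 t + be * v2 t + ka * f2 t by ring.
    have p1 := normM_le hb h3; have p2 := normM_le (lexx `|al|) h2.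
    move: p1 p2; rewrite al_r; lra.
  have : 8 / r ^+ 2 * (r ^+ 2 / 2) ^+ 2 = 2 * r ^+ 2 by field; lra.
  move=> <-; rewrite mulr1 ler_pM2l ?divr_gt0//.
  by rewrite -[leRHS]real_normK ?num_real// lerXn2r// nnegrE// ltW.
have -> : 2 / (r ^+ 2 / 2) + (8 / r ^+ 2 * s' - 8 / r ^+ 2 * s) =
   (4 + 8 * (s' - s)) / r ^+ 2 by field; lra.
apply: ler_pM.
- by have := subr_ge0 s s'; rewrite ss'; lra.
- by rewrite invr_ge0 sqr_ge0.
- lra.
- by rewrite lef_pV2 ?posrE ?exprn_gt0.
Qed.

(** Two regimes for the coefficient ka. If |ka| c w is at most (2 B + 1) mu^3, the smallness of z
    brings ka f' and ka f'' below mu^3 / 10, and the phase is flat with r = mu^(3/2). Otherwise ka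
    f''' outweighs the at most 2 B mu^3 contributed by u''' and v''', and the third-derivative test
    applies. *)
Lemma curved_phase_piece s s' (L al be ka th mu B c z : R) (w A : R -> R) :
  s <= s' -> s' - s <= L -> 1 <= mu -> Num.max `|al| `|be| = mu ^+ 3 ->
  0 <= B -> 0 < c -> 0 <= z -> z * (2 * B + 1) <= c / 10 ->
  derives s s' u u1 -> derives s s' u1 u2 -> derives s s' u2 u3 ->
  derives s s' v v1 -> derives s s' v1 v2 -> derives s s' v2 v3 ->
  derives s s' f f1 -> derives s s' f1 f2 -> derives s s' f2 f3 ->
  {within `[s, s'], continuous u3} -> {within `[s, s'], continuous v3} ->
  {within `[s, s'], continuous f3} ->
  (forall t, s <= t <= s' ->
    [/\ `|u1 t - 1| <= 10^-1, `|v1 t| <= 10^-1, `|u2 t| <= 10^-1 &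
        `|v2 t - 1| <= 10^-1]) ->
  (forall t, s <= t <= s' ->
    [/\ `|u3 t| <= B, `|v3 t| <= B, c * w t <= `|f3 t|,
        `|f1 t| <= z * w t & `|f2 t| <= z * w t]) ->
  derives s s' A (fun t => cos (al * u t + be * v t + ka * f t + th)) ->
  (forall t, s <= t <= s' -> `|ka| * c * w t <= (2 * B + 1) * mu ^+ 3) \/
  (forall t, s <= t <= s' -> (2 * B + 1) * mu ^+ 3 <= `|ka| * c * w t) ->
  `|A s' - A s| <= (42 + 8 * L) / mu.
Proof.
move=> ss' sL mu1 muE B0 c0 z0 zB du du1 du2 dv dv1 dv2 df df1 df2 cu cv cf.
move=> near0 near3 dA.
have mu0 : 0 < mu by lra.
have mu30 := exprn_gt0 3 mu0.
have L0 : 0 <= L by apply: le_trans sL; rewrite subr_ge0.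
have B1 : 0 < 2 * B + 1 by lra.
case=> [small|large].
  pose r := Num.sqrt (mu ^+ 3).
  have r2 : r ^+ 2 = mu ^+ 3 by rewrite sqr_sqrtr// ltW.
  have mur : mu <= r.
    rewrite -(ler_pXn2r (n := 2)) ?nnegrE ?sqrtr_ge0 ?(ltW mu0)// r2.
    by rewrite ler_weXn2l.
  have sm t : s <= t <= s' -> `|ka| * (z * w t) <= 10^-1 * r ^+ 2.
    move=> ts; rewrite -(ler_pM2l c0) r2.
    apply: (@le_trans _ _ (z * ((2 * B + 1) * mu ^+ 3))).
      rewrite (_ : c * _ = z * (`|ka| * c * w t)); last by ring.
      by rewrite ler_wpM2l// small.
    by rewrite mulrA [leRHS]mulrA ler_pM2r.
  apply: (@le_trans _ _ ((20 + 8 * L) / r)).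
    apply: (@flat_phase_bound s s' L al be ka th r A) => //.
    - by apply: le_trans mur.
    - by rewrite r2.
    - exact: derives_continuous du2.
    - exact: derives_continuous dv2.
    - exact: derives_continuous df2.
    - move=> t ts; have [h1 h2 h3 h4] := near0 t ts.
      have [_ _ _ h5 h6] := near3 t ts.
      split=> //; split; apply: le_trans (sm t ts).
        exact: normM_le h5.
      exact: normM_le h6.
  apply: ler_pM.
  - by rewrite addr_ge0// mulr_ge0.
  - by rewrite invr_ge0 sqrtr_ge0.
  - by rewrite lerD2r ler_nat.
  - by rewrite lef_pV2 ?posrE// (lt_le_trans mu0).
have comb g1 g2 g3 h1 h2 h3 : derives s s' g1 h1 -> derives s s' g2 h2 ->
    derives s s' g3 h3 -> derives s s'
      (fun t => al * g1 t + be * g2 t + ka * g3 t)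
      (fun t => al * h1 t + be * h2 t + ka * h3 t).
  by move=> *; apply: derivesD; [apply: derivesD|]; apply: derivesZ.
have d0 := derivesD (comb _ _ _ _ _ _ du dv df) (@derives_cst _ s s' th).
have {}d0 := derives_eq (fun t _ => addr0 _) d0.
have d1 := comb _ _ _ _ _ _ du1 dv1 df1.
have d2 := comb _ _ _ _ _ _ du2 dv2 df2.
apply: (@le_trans _ _ (22 / mu)); last first.
  by rewrite ler_pM2r ?invr_gt0// ler_wpDr ?mulr_ge0// ler_nat.
apply: (van_der_corput3 mu0 ss' d0 d1 d2 _ dA).
  exact: within_continuous_comb.
move=> t ts; have [h1 h2 h3 _ _] := near3 t ts.
have al3 : `|al| <= mu ^+ 3 by rewrite -muE le_max lexx.
have be3 : `|be| <= mu ^+ 3 by rewrite -muE le_max lexx orbT.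
have p1 := normM_le al3 h1; have p2 := normM_le be3 h2.
have p3 : (2 * B + 1) * mu ^+ 3 <= `|ka * f3 t|.
  rewrite normrM; apply: (le_trans (large t ts)).
  by rewrite -mulrA ler_wpM2l.
set X := al * u3 t + be * v3 t + ka * f3 t.
have := ler_norm4 X (- (al * u3 t)) (- (be * v3 t)) 0.
have -> : X - al * u3 t - be * v3 t + 0 = ka * f3 t by rewrite /X; ring.
rewrite !normrN normr0 addr0 => h.
have := le_trans p3 h; move: p1 p2.
rewrite (_ : (2 * B + 1) * mu ^+ 3 = mu ^+ 3 * B + mu ^+ 3 * B + mu ^+ 3); last by ring.
move: (`|X|) (`|al * _|) (`|be * _|) (mu ^+ 3 * B) (mu ^+ 3).
by move=> *; lra.
Qed.

(* On one side of t0 the weight is monotone, so the regime where the third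
   derivative of the normal component is small is an interval. *)
Lemma curved_phase_monotone s s' (L al be ka th mu B c z : R) (w A : R -> R) :
  s <= s' -> s' - s <= L -> 1 <= mu -> Num.max `|al| `|be| = mu ^+ 3 ->
  0 <= B -> 0 < c -> 0 <= z -> z * (2 * B + 1) <= c / 10 ->
  derives s s' u u1 -> derives s s' u1 u2 -> derives s s' u2 u3 ->
  derives s s' v v1 -> derives s s' v1 v2 -> derives s s' v2 v3 ->
  derives s s' f f1 -> derives s s' f1 f2 -> derives s s' f2 f3 ->
  {within `[s, s'], continuous u3} -> {within `[s, s'], continuous v3} ->
  {within `[s, s'], continuous f3} ->
  (forall t, s <= t <= s' ->
    [/\ `|u1 t - 1| <= 10^-1, `|v1 t| <= 10^-1, `|u2 t| <= 10^-1 &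
        `|v2 t - 1| <= 10^-1]) ->
  (forall t, s <= t <= s' ->
    [/\ `|u3 t| <= B, `|v3 t| <= B, c * w t <= `|f3 t|,
        `|f1 t| <= z * w t & `|f2 t| <= z * w t]) ->
  derives s s' A (fun t => cos (al * u t + be * v t + ka * f t + th)) ->
  {within `[s, s'], continuous w} ->
  (forall t t', s <= t -> t <= t' -> t' <= s' -> w t <= w t') \/
  (forall t t', s <= t -> t <= t' -> t' <= s' -> w t' <= w t) ->
  `|A s' - A s| <= 2 * ((42 + 8 * L) / mu).
Proof.
move=> ss' sL mu1 muE B0 c0 z0 zB du du1 du2 dv dv1 dv2 df df1 df2 cu cv cf.
move=> near0 near3 dA cw mw.
have mu0 : 0 < mu by lra.
have L0 : 0 <= L by apply: le_trans sL; rewrite subr_ge0.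
pose K := (42 + 8 * L) / mu.
have K0 : 0 <= K by rewrite divr_ge0 ?(ltW mu0)// addr_ge0// mulr_ge0.
have kc0 : 0 <= `|ka| * c by rewrite mulr_ge0// ltW.
have piece p q : s <= p -> p <= q -> q <= s' ->
  p = q \/ (forall t, p <= t <= q -> `|ka| * c * w t <= (2 * B + 1) * mu ^+ 3) \/
  (forall t, p <= t <= q -> (2 * B + 1) * mu ^+ 3 <= `|ka| * c * w t) ->
  `|A q - A p| <= K.
  move=> sp pq qs; case=> [->|reg]; first by rewrite subrr normr0.
  have sub t : p <= t <= q -> s <= t <= s'.
    by case/andP=> pt tq; rewrite (le_trans sp pt) (le_trans tq qs).
  have ds g h : derives s s' g h -> derives p q g h by exact: derives_sub.
  have cs (g : R -> R) : {within `[s, s'], continuous g} -> {within `[p, q], continuous g}.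
    by move=> cg; apply: continuous_subspaceW cg; apply: subset_itv; rewrite bnd_simp.
  apply: (@curved_phase_piece p q L al be ka th mu B c z w A) => //;
    try exact: ds; try exact: cs.
  - by apply: le_trans sL; rewrite lerB.
  - by move=> t /sub; exact: near0.
  - by move=> t /sub; exact: near3.
suff [p [/andP[sp ps] h1 h2]] : exists p, [/\ s <= p <= s',
    s = p \/ (forall t, s <= t <= p -> `|ka| * c * w t <= (2 * B + 1) * mu ^+ 3) \/
    (forall t, s <= t <= p -> (2 * B + 1) * mu ^+ 3 <= `|ka| * c * w t) &
    p = s' \/ (forall t, p <= t <= s' -> `|ka| * c * w t <= (2 * B + 1) * mu ^+ 3) \/
    (forall t, p <= t <= s' -> (2 * B + 1) * mu ^+ 3 <= `|ka| * c * w t)].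
  have := piece _ _ (lexx s) sp ps h1; have := piece _ _ sp ps (lexx s') h2.
  rewrite -/K !ler_norml; lra.
have cg k : {within `[s, s'], continuous (fun t => k * w t)}.
  by move=> x; apply: cvgM; [exact: cvg_cst | exact: cw].
case: mw => mw.
  have [|p [sp h1 h2]] := monotone_split ((2 * B + 1) * mu ^+ 3) ss'
    (cg (`|ka| * c)) _.
    by move=> *; rewrite ler_wpM2l// mw.
  exists p; split=> //; first by case: h1 => [->|]; [left | right; left].
  by case: h2 => [->|]; [left | right; right].
have [|p [sp h1 h2]] := monotone_split (- ((2 * B + 1) * mu ^+ 3)) ss'
  (cg (- (`|ka| * c))) _.
  by move=> *; rewrite !mulNr lerN2 ler_wpM2l// mw.
exists p; split=> //.
  case: h1 => [->|h1]; [by left | right; right] => t /h1.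
  by rewrite mulNr lerN2.
case: h2 => [->|h2]; [by left | right; left] => t /h2.
by rewrite mulNr lerN2.
Qed.
End LocalPhase.

Section LocalBounds.
Variable R : realType.
Variables (a b t0 : R) (u u1 u2 u3 v v1 v2 v3 f f1 f2 f3 : R -> R).
Hypotheses (t0ab : a <= t0 <= b).
Hypotheses (du : derives a b u u1) (du1 : derives a b u1 u2)
  (du2 : derives a b u2 u3) (dv : derives a b v v1) (dv1 : derives a b v1 v2)
  (dv2 : derives a b v2 v3) (df : derives a b f f1) (df1 : derives a b f1 f2)
  (df2 : derives a b f2 f3).
Hypotheses (cu3 : {within `[a, b], continuous u3})
  (cv3 : {within `[a, b], continuous v3})
  (cf3 : {within `[a, b], continuous f3}).
Hypotheses (u10 : u1 t0 = 1) (u20 : u2 t0 = 0) (v10 : v1 t0 = 0)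
  (v20 : v2 t0 = 1) (f10 : f1 t0 = 0) (f20 : f2 t0 = 0).

Lemma derives_from_zero (F g : R -> R) (M t : R) : derives a b F g ->
  F t0 = 0 -> a <= t <= b ->
  (forall x, a <= x <= b -> `|x - t0| <= `|t - t0| -> `|g x| <= M) ->
  `|F t| <= M * `|t - t0|.
Proof.
move=> dF F0 tab gM; case/andP: (t0ab) => at0 t0b; case/andP: tab => at_ tb.
have [tt|tt] := leP t0 t.
  have := derives_norm_le tt (derives_sub at0 tb dF).
  rewrite F0 subr0 (ger0_norm (_ : 0 <= t - t0)) ?subr_ge0//; apply.
  move=> x /andP[tx xt]; apply: gM; first by rewrite (le_trans at0 tx) (le_trans xt).
  by rewrite !ger0_norm ?subr_ge0// lerB.
have := derives_norm_le (ltW tt) (derives_sub at_ t0b dF).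
rewrite F0 sub0r normrN distrC (ger0_norm (_ : 0 <= t0 - t)) ?subr_ge0 ?(ltW tt)//.
apply => x /andP[tx xt]; apply: gM; first by rewrite (le_trans at_ tx) (le_trans xt).
by rewrite !ler0_norm ?subr_le0 ?(ltW tt)// lerN2 lerB.
Qed.

Lemma frame_near : exists2 d, 0 < d & forall t, a <= t <= b -> `|t - t0| <= d ->
    [/\ `|u1 t - 1| <= 10^-1, `|v1 t| <= 10^-1, `|u2 t| <= 10^-1,
        `|v2 t - 1| <= 10^-1 &
        `|u3 t| <= `|u3 t0| + `|v3 t0| + 1 /\
        `|v3 t| <= `|u3 t0| + `|v3 t0| + 1].
Proof.
have e0 : 0 < 10^-1 :> R by rewrite invr_gt0.
have [d1 d10 h1] := within_continuous_near (derives_continuous du1) t0ab e0.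
have [d2 d20 h2] := within_continuous_near (derives_continuous dv1) t0ab e0.
have [d3 d30 h3] := within_continuous_near (derives_continuous du2) t0ab e0.
have [d4 d40 h4] := within_continuous_near (derives_continuous dv2) t0ab e0.
have [d5 d50 h5] := within_continuous_near cu3 t0ab ltr01.
have [d6 d60 h6] := within_continuous_near cv3 t0ab ltr01.
exists (Num.min (Num.min (Num.min d1 d2) (Num.min d3 d4)) (Num.min d5 d6)).
  by rewrite !lt_min d10 d20 d30 d40 d50 d60.
move=> t tab; rewrite !le_min => /andP[/andP[/andP[t1 t2] /andP[t3 t4]] /andP[t5 t6]].
move: (h1 t tab t1) (h2 t tab t2) (h3 t tab t3) (h4 t tab t4) (h5 t tab t5) (h6 t tab t6).
rewrite u10 v10 u20 v20 !subr0 => ? ? ? ? k5 k6; split=> //; split.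
  have := ler_normD (u3 t - u3 t0) (u3 t0); rewrite subrK => h.
  by have := normr_ge0 (v3 t0); lra.
have := ler_normD (v3 t - v3 t0) (v3 t0); rewrite subrK => h.
by have := normr_ge0 (u3 t0); lra.
Qed.

Let phase al be ka th t := al * u t + be * v t + ka * f t + th.

(** Since f' and f'' vanish at t0 and f''' vanishes nearby, f is constant near t0, and the phase is
    flat however large ka is. *)
Lemma planar_local_bound (d0 : R) : 0 < d0 ->
  (forall t, a <= t <= b -> `|t - t0| <= d0 -> f3 t = 0) ->
  exists d C : R, [/\ 0 < d, 0 < C & forall s s', a <= s -> s <= s' -> s' <= b ->
    t0 - d <= s -> s' <= t0 + d -> forall al be ka th r A, 1 <= r ->
    Num.max `|al| `|be| = r ^+ 2 ->
    derives s s' A (fun t => cos (phase al be ka th t)) ->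
    `|A s' - A s| <= C / r].
Proof.
move=> d00 f30; have [d' d'0 H] := frame_near.
have ab : a <= b by case/andP: t0ab; exact: le_trans.
exists (Num.min d' d0), (20 + 8 * (b - a)); split.
- by rewrite lt_min d'0.
- by rewrite ltr_wpDr// mulr_ge0// subr_ge0.
move=> s s' as_ ss' sb ts st al be ka th r A r1 rE dA.
have near t : s <= t <= s' -> [/\ a <= t <= b, `|t - t0| <= d' & `|t - t0| <= d0].
  case/andP=> st' ts'; rewrite (le_trans as_ st') (le_trans ts' sb).
  have : `|t - t0| <= Num.min d' d0 by rewrite ler_distl; move: (Num.min _ _) ts st => m; lra.
  by rewrite le_min => /andP[].
have f2z t : a <= t <= b -> `|t - t0| <= d0 -> f2 t = 0.
  move=> tab td; apply/eqP; rewrite -normr_le0 -(mul0r `|t - t0|).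
  apply: (derives_from_zero df2) => // x xab xt.
  by rewrite f30 ?normr0// (le_trans xt).
have f1z t : a <= t <= b -> `|t - t0| <= d0 -> f1 t = 0.
  move=> tab td; apply/eqP; rewrite -normr_le0 -(mul0r `|t - t0|).
  apply: (derives_from_zero df1) => // x xab xt.
  by rewrite f2z ?normr0// (le_trans xt).
have ds g h : derives a b g h -> derives s s' g h by exact: derives_sub.
apply: (@flat_phase_bound R u u1 u2 v v1 v2 f f1 f2 s s' (b - a) al be ka th r A) => //;
  try exact: ds; try exact: derives_continuous (ds _ _ _).
- by rewrite lerB.
- exact: derives_continuous (ds _ _ du2).
- exact: derives_continuous (ds _ _ dv2).
- exact: derives_continuous (ds _ _ df2).
- move=> t /near[tab t1 t2]; have [? ? ? ? _] := H t tab t1.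
  split=> //; rewrite f1z// f2z// !mulr0 normr0.
  by rewrite mulr_ge0// sqr_ge0.
Qed.

(** Integrating f''' from t0 shows that f'' and f' are at most d C0 |t - t0|^m, a small multiple of
    the lower bound on f''' once d is small. The factor 4 comes from the two sides of t0 and the two
    regimes on each. *)
Lemma twisted_local_bound (d0 c0 C0 : R) (m : nat) : 0 < d0 -> 0 < c0 -> 0 < C0 ->
  (forall t, a <= t <= b -> `|t - t0| <= d0 ->
     c0 * `|t - t0| ^+ m <= `|f3 t| <= C0 * `|t - t0| ^+ m) ->
  exists d C : R, [/\ 0 < d, 0 < C & forall s s', a <= s -> s <= s' -> s' <= b ->
    t0 - d <= s -> s' <= t0 + d -> forall al be ka th mu A, 1 <= mu ->
    Num.max `|al| `|be| = mu ^+ 3 ->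
    derives s s' A (fun t => cos (phase al be ka th t)) ->
    `|A s' - A s| <= C / mu].
Proof.
move=> d00 c00 C00 f3w; have [d' d'0 H] := frame_near.
have ab : a <= b by case/andP: t0ab; exact: le_trans.
set B := `|u3 t0| + `|v3 t0| + 1 in H.
have B0 : 0 <= B by rewrite !addr_ge0.
have B1 : 0 < 2 * B + 1 by lra.
(* Chosen so that z = d C0 satisfies z (2 B + 1) <= c0 / 10, the smallness needed in the flat
   regime. *)
pose d1 := c0 / 10 / (C0 * (2 * B + 1)).
have d10 : 0 < d1 by rewrite !divr_gt0// mulr_gt0.
pose d := Num.min (Num.min d' d0) (Num.min 1 d1).
have dpos : 0 < d by rewrite !lt_min d'0 d00 d10 ltr01.
pose z := d * C0.
have z0 : 0 <= z by rewrite mulr_ge0// ltW.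
have zB : z * (2 * B + 1) <= c0 / 10.
  by rewrite /z -mulrA -ler_pdivlMr ?mulr_gt0// !ge_min lexx !orbT.
have L0 : 0 <= b - a by rewrite subr_ge0.
exists d, (4 * (42 + 8 * (b - a))); split=> //.
  by rewrite mulr_gt0// ltr_wpDr// mulr_ge0.
move=> s s' as_ ss' sb ts st al be ka th mu A mu1 muE dA.
have mu0 : 0 < mu by lra.
pose w t := `|t - t0| ^+ m.
have wmono x y : `|x - t0| <= `|y - t0| -> w x <= w y by move=> h; rewrite lerXn2r.
have near t : a <= t <= b -> `|t - t0| <= d ->
  [/\ `|t - t0| <= d', `|t - t0| <= d0 & `|t - t0| <= 1].
  by move=> tab; rewrite !le_min => /andP[/andP[-> ->] /andP[->]].
have f2w t : a <= t <= b -> `|t - t0| <= d -> `|f2 t| <= z * w t.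
  move=> tab td; have [_ t2 _] := near t tab td.
  have := derives_from_zero (M := C0 * w t) df2 f20 tab.
  move=> /(_ _)/le_trans; apply.
    move=> x xab xt; have /andP[_] := f3w x xab (le_trans xt t2).
    by move/le_trans; apply; rewrite ler_pM2l// wmono.
  by rewrite mulrC /z -mulrA ler_wpM2r// mulr_ge0 ?exprn_ge0// ltW.
have f1w t : a <= t <= b -> `|t - t0| <= d -> `|f1 t| <= z * w t.
  move=> tab td; have [_ _ t3] := near t tab td.
  have := derives_from_zero (M := z * w t) df1 f10 tab.
  move=> /(_ _)/le_trans; apply.
    move=> x xab xt; have := f2w x xab (le_trans xt td).
    by move/le_trans; apply; rewrite ler_wpM2l// wmono.
  by rewrite ler_piMr// mulr_ge0 ?exprn_ge0.
have cw p q : {within `[p, q], continuous w}.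
  apply: continuous_subspaceT => x.
  apply: (@continuous_comp _ _ _ (fun t : R => `|t - t0|) (fun y => y ^+ m)).
    apply: (@continuous_comp _ _ _ (fun t : R => t - t0) Num.norm).
      by apply: cvgB; [exact: cvg_id | exact: cvg_cst].
    exact: norm_continuous.
  exact: exprn_continuous.
have side p q : s <= p -> p <= q -> q <= s' -> t0 <= p \/ q <= t0 ->
    `|A q - A p| <= 2 * ((42 + 8 * (b - a)) / mu).
  move=> sp pq qs sd.
  have ap := le_trans as_ sp; have qb := le_trans qs sb.
  have ds g h : derives a b g h -> derives p q g h by exact: derives_sub.
  have cs (g : R -> R) : {within `[a, b], continuous g} -> {within `[p, q], continuous g}.
    by move=> cg; apply: continuous_subspaceW cg; apply: subset_itv; rewrite bnd_simp.
  have near' t : p <= t <= q -> a <= t <= b /\ `|t - t0| <= d.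
    case/andP=> pt tq; rewrite (le_trans ap pt) (le_trans tq qb); split=> //.
    by rewrite ler_distl; move: d ts st {dpos z z0 zB near f2w f1w} => ?; lra.
  apply: (@curved_phase_monotone R u u1 u2 u3 v v1 v2 v3 f f1 f2 f3 p q (b - a) al be ka th mu B c0 z w A) => //;
  try exact: ds; try exact: cs.
  - by rewrite lerB.
  - move=> t /near'[tab td]; have [t1 _ _] := near t tab td.
    by have [] := H t tab t1.
  - move=> t /near'[tab td]; have [t1 t2 _] := near t tab td.
    have [_ _ _ _ [? ?]] := H t tab t1.
    by split=> //; [by have /andP[] := f3w t tab t2 | exact: f1w | exact: f2w].
  - exact: derives_sub dA.
  - case: sd => sd; [left|right] => t t' h1 h2 h3; apply: wmono.
      by rewrite !ger0_norm ?subr_ge0 ?(le_trans sd h1) ?lerB// (le_trans (le_trans sd h1)).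
    by rewrite !ler0_norm ?subr_le0 ?(le_trans h3 sd) ?lerN2 ?lerB// (le_trans h2 (le_trans h3 sd)).
have K2 : 4 * (42 + 8 * (b - a)) / mu = 2 * ((42 + 8 * (b - a)) / mu) + 2 * ((42 + 8 * (b - a)) / mu).
  by field; lra.
have K0 : 0 <= 2 * ((42 + 8 * (b - a)) / mu).
  by rewrite mulr_ge0// divr_ge0 ?(ltW mu0)// addr_ge0// mulr_ge0.
rewrite K2; move: K0 side; move: (2 * ((42 + 8 * (b - a)) / mu)) => K K0 side.
have [t0s|t0s] := leP t0 s.
  by apply: (le_trans (side s s' _ _ _ _)) => //; [left | rewrite lerDl].
have [t0s'|t0s'] := leP s' t0.
  by apply: (le_trans (side s s' _ _ _ _)) => //; [right | rewrite lerDl].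
have := side s t0 (lexx _) (ltW t0s) (ltW t0s') (or_intror (lexx _)).
have := side t0 s' (ltW t0s) (ltW t0s') (lexx _) (or_introl (lexx _)).
by rewrite !ler_norml; lra.
Qed.

End LocalBounds.

(** * Lattice points near a plane or a line *)

Section Vectors3.
Variable R : realType.
Implicit Types (k g v w T N : 'rV[R]_3).

Let i1 : 'I_3 := lift ord0 ord0.
Let i2 : 'I_3 := lift ord0 (lift ord0 ord0).

Lemma dotvE v w :
  dotv v w = v 0 ord0 * w 0 ord0 + v 0 i1 * w 0 i1 + v 0 i2 * w 0 i2.
Proof. by rewrite /dotv !big_ord_recl big_ord0 addr0 addrA. Qed.

Definition cross v w : 'rV[R]_3 := \row_(i < 3)
  [:: v 0 i1 * w 0 i2 - v 0 i2 * w 0 i1;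
      v 0 i2 * w 0 ord0 - v 0 ord0 * w 0 i2;
      v 0 ord0 * w 0 i1 - v 0 i1 * w 0 ord0]`_i.

Lemma crossE v w : [/\ cross v w 0 ord0 = v 0 i1 * w 0 i2 - v 0 i2 * w 0 i1,
  cross v w 0 i1 = v 0 i2 * w 0 ord0 - v 0 ord0 * w 0 i2 &
  cross v w 0 i2 = v 0 ord0 * w 0 i1 - v 0 i1 * w 0 ord0].
Proof. by rewrite !mxE. Qed.

Lemma dotv_crossl v w : dotv (cross v w) v = 0.
Proof. by rewrite dotvE; have [-> -> ->] := crossE v w; ring. Qed.

Lemma dotv_crossr v w : dotv (cross v w) w = 0.
Proof. by rewrite dotvE; have [-> -> ->] := crossE v w; ring. Qed.

Lemma dotvC v w : dotv v w = dotv w v.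
Proof. by rewrite !dotvE; ring. Qed.

Lemma dotvBl k v w : dotv (v - w) k = dotv v k - dotv w k.
Proof. by rewrite !dotvE !mxE; ring. Qed.

(* N is not normalised, hence the factors dotv N N. *)
Lemma dotv_frame T N k g : dotv T T = 1 -> dotv T N = 0 ->
  dotv N N * dotv k g =
  dotv N N * (dotv k T * dotv T g) + dotv k N * dotv N g
    + dotv k (cross T N) * dotv (cross T N) g.
Proof.
move=> TT TN.
have : dotv k g * (dotv T T * dotv N N - dotv T N ^+ 2) =
   dotv N N * (dotv k T * dotv T g) + dotv T T * (dotv k N * dotv N g)
   - dotv T N * (dotv k T * dotv N g + dotv k N * dotv T g)
   + dotv k (cross T N) * dotv (cross T N) g.
  rewrite !dotvE; have [-> -> ->] := crossE T N; ring.
rewrite TT TN => h; rewrite mulrC; move: h.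
by rewrite !mul1r mul0r subr0 expr0n /= subr0.
Qed.

Lemma cross_sqr T N : dotv T T = 1 -> dotv T N = 0 ->
  dotv (cross T N) (cross T N) = dotv N N.
Proof.
move=> TT TN; have : dotv (cross T N) (cross T N) =
  dotv T T * dotv N N - dotv T N ^+ 2.
  by rewrite !dotvE; have [-> -> ->] := crossE T N; ring.
by rewrite TT TN mul1r expr0n subr0.
Qed.

Lemma coord_le_norm v (j : 'I_3) : `|v 0 j| <= enorm v.
Proof.
rewrite -sqrtr_sqr ler_wsqrtr// /dotv (bigD1 j)//= -expr2 lerDl.
by apply: sumr_ge0 => i _; rewrite -expr2 sqr_ge0.
Qed.

Definition delta0 : 'rV[int]_3 := \row_j (j == ord0)%:Z.

Lemma sum_delta0 (x : 'rV[int]_3) : \sum_j delta0 0 j * x 0 j = x 0 ord0.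
Proof.
rewrite (bigD1 ord0)//= mxE eqxx mul1r big1 ?addr0// => j j0.
by rewrite mxE (negbTE j0) mul0r.
Qed.

Lemma sphere_coord (lambda : R) (x : 'rV[int]_3) j :
  lattice_sphere lambda x -> `|(x 0 j)%:~R : R| <= lambda.
Proof. by move=> <-; have := coord_le_norm (intv R x) j; rewrite mxE. Qed.

Section FrameCounting.
Variables (T N : 'rV[R]_3).
Hypotheses (TT : dotv T T = 1) (TN : dotv T N = 0) (N0 : 0 < dotv N N).

Let nu := dotv N N.
Let b := cross T N.

Definition frame_size k := Num.max `|dotv k T| `|dotv k N|.

Lemma frame_normsq v : nu * dotv v v = nu * dotv v T ^+ 2 + dotv v N ^+ 2 + dotv v b ^+ 2.
Proof. by rewrite (dotv_frame v v TT TN) !(dotvC _ v) -!expr2. Qed.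

Lemma dotvT_le v : `|dotv v T| <= enorm v.
Proof.
rewrite -sqrtr_sqr ler_wsqrtr// -(ler_pM2l N0) frame_normsq -addrA lerDl.
by rewrite addr_ge0 ?sqr_ge0.
Qed.

(** The factor 1 + nu stands in for the square root of nu. *)
Lemma dotvN_le v : `|dotv v N| <= (1 + nu) * enorm v.
Proof.
have nu1 : 0 <= 1 + nu by rewrite addr_ge0// ltW.
rewrite -(ler_pXn2r (n := 2)) ?nnegrE ?mulr_ge0 ?sqrtr_ge0//.
rewrite real_normK ?num_real// exprMn enorm_sqr.
apply: (@le_trans _ _ (nu * dotv v v)).
  rewrite frame_normsq addrAC lerDr addr_ge0 ?sqr_ge0//.
  by rewrite mulr_ge0 ?sqr_ge0// ltW.
rewrite ler_wpM2r ?dotv_ge0//; have := sqr_ge0 nu; have : 0 < nu by []; nra.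
Qed.

Lemma frame_size_le v w lambda : enorm v = lambda -> enorm w = lambda ->
  frame_size (v - w) <= 2 * (1 + nu) * lambda.
Proof.
move=> vl wl; have l0 : 0 <= lambda by rewrite -vl sqrtr_ge0.
have nl : 0 <= nu * lambda by rewrite mulr_ge0// ltW.
rewrite ge_max !dotvBl; apply/andP; split; apply: (le_trans (ler_normB _ _)).
  by have := dotvT_le v; have := dotvT_le w; rewrite vl wl; lra.
by have := dotvN_le v; have := dotvN_le w; rewrite vl wl; lra.
Qed.

(** By Pythagoras in the frame and equality of the norms, (w.b)^2 - (v.b)^2 is a combination of
    differences of squares of the T and N components, each at most rho times O(lambda). A product of
    two factors that is at most X^2 has a factor at most X. *)
Lemma binormal_dichotomy v w lambda rho : enorm v = lambda -> enorm w = lambda ->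
  frame_size (v - w) <= rho ->
  let X := Num.sqrt ((1 + nu) * 4 * lambda * rho) in
  `|dotv w b - dotv v b| <= X \/ `|dotv w b + dotv v b| <= X.
Proof.
move=> vl wl vw X; have l0 : 0 <= lambda by rewrite -vl sqrtr_ge0.
have rho0 : 0 <= rho by apply: le_trans vw; rewrite le_max normr_ge0.
have nu1 : 0 <= 1 + nu by rewrite addr_ge0// ltW.
have X0 : 0 <= X by exact: sqrtr_ge0.
have X2 : X ^+ 2 = (1 + nu) * 4 * lambda * rho by rewrite sqr_sqrtr// !mulr_ge0.
move: vw; rewrite /frame_size ge_max !dotvBl => /andP[hT hN].
have [|h1] := leP `|dotv w b - dotv v b| X; first by left.
have [|h2] := leP `|dotv w b + dotv v b| X; first by right.
exfalso; have : X ^+ 2 < `|dotv w b ^+ 2 - dotv v b ^+ 2|.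
  by rewrite subr_sqr normrM expr2 ltr_pM.
rewrite ltNge => /negP; apply.
have -> : dotv w b ^+ 2 - dotv v b ^+ 2 =
   nu * ((dotv v T - dotv w T) * (dotv v T + dotv w T))
   + (dotv v N - dotv w N) * (dotv v N + dotv w N).
  have := frame_normsq v; have := frame_normsq w.
  by rewrite -!enorm_sqr vl wl => -> e; move: e; lra.
apply: (le_trans (ler_normD _ _)); rewrite normrM (ger0_norm (ltW N0)).
have bT : `|dotv v T + dotv w T| <= 2 * lambda.
  apply: (le_trans (ler_normD _ _)).
  by have := dotvT_le v; have := dotvT_le w; rewrite vl wl; lra.
have bN : `|dotv v N + dotv w N| <= 2 * (1 + nu) * lambda.
  apply: (le_trans (ler_normD _ _)).
  by have := dotvN_le v; have := dotvN_le w; rewrite vl wl; lra.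
have p1 : `|(dotv v T - dotv w T) * (dotv v T + dotv w T)| <= rho * (2 * lambda).
  by rewrite normrM ler_pM.
have p2 : `|(dotv v N - dotv w N) * (dotv v N + dotv w N)| <= rho * (2 * (1 + nu) * lambda).
  by rewrite normrM ler_pM.
apply: (le_trans (lerD (ler_wpM2l (ltW N0) p1) p2)).
rewrite X2 -subr_ge0 (_ : _ - _ = 2 * (lambda * rho)) ?mulr_ge0//.
rewrite /nu; ring.
Qed.

End FrameCounting.
End Vectors3.

Section SphereCounting.
Variable R : realType.
Implicit Types (lambda : R).

(** The slices of constant first coordinate are plane sections with normal [delta0], and at most 2 l
    + 1 of them meet the given range. *)
Lemma sphere_slice_count (eps : R) : 0 < eps -> exists2 C : R, 0 < C &
  forall lambda, 1 < lambda -> forall (c l : R) (s : seq 'rV[int]_3), 0 <= l ->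
  uniq s -> (forall x, x \in s -> lattice_sphere lambda x /\
    `|(x 0 ord0)%:~R - c| <= l) ->
  (size s)%:R <= (2 * l + 1) * (C * lambda `^ eps).
Proof.
move=> eps0; have [C C0 HC] := sphere_plane_count eps0 ltr01.
exists C => // lambda l1 c l s l0 us sP.
apply: (size_slices (g := fun x : 'rV[int]_3 => x 0 ord0) (c := c)) => //.
  move=> m; apply: (HC lambda l1 delta0 ord0 _ _ m).
  - by rewrite mxE.
  - move=> j; rewrite mxE mul1r; case: (j == ord0); rewrite ?normr0 ?normr1; lra.
  - exact: filter_uniq.
  - move=> x; rewrite mem_filter => /andP[/eqP <- /sP[xl _]].
    by rewrite sum_delta0.
by apply/allP => x /sP[].
Qed.

Lemma size_filter_or (T : eqType) (s : seq T) (P Q : pred T) :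
  (forall x, x \in s -> P x \/ Q x) ->
  (size s <= size [seq x <- s | P x] + size [seq x <- s | Q x])%N.
Proof.
move=> sPQ; rewrite !size_filter -(count_predC P) leq_add2l.
rewrite -!size_filter; elim: s sPQ => [//|x s IH] sPQ /=.
have {}IH : (size [seq x <- s | predC P x] <= size [seq x <- s | Q x])%N.
  by apply: IH => y ys; apply: sPQ; rewrite in_cons ys orbT.
have [Px|Qx] := sPQ x (mem_head _ _).
  by rewrite Px /=; case: (Q x) => //=; apply: leqW.
by rewrite Qx /=; case: (P x) => //=; apply: leqW.
Qed.

(** The first coordinate of y is a linear combination of its three frame components. Those along T
    and N are within r^2 of those of x, and the one along T x N is within O(sqrt(lambda) r) of one
    of two values. *)
Lemma frame_ball_count (T N : 'rV[R]_3) (eps : R) :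
  dotv T T = 1 -> dotv T N = 0 -> 0 < dotv N N -> 0 < eps ->
  exists2 C : R, 0 < C & forall lambda, 1 < lambda ->
  forall (x : 'rV[int]_3), lattice_sphere lambda x ->
  forall (r : R) (s : seq 'rV[int]_3), 1 <= r -> uniq s ->
  (forall y, y \in s -> lattice_sphere lambda y /\
     frame_size T N (intv R x - intv R y) <= r ^+ 2) ->
  (size s)%:R <= C * (Num.sqrt lambda * lambda `^ eps) * r.
Proof.
move=> TT TN N0 eps0; have [C C0 HC] := sphere_slice_count eps0.
set nu := dotv N N in N0; pose b := cross T N.
pose K := `|T 0 ord0| + `|N 0 ord0| / nu + Num.sqrt ((1 + nu) * 4) * `|b 0 ord0| / nu + 1.
have nu1 : 0 <= (1 + nu) * 4 by rewrite mulr_ge0// addr_ge0// ltW.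
have K1 : 1 <= K by rewrite /K lerDr !addr_ge0 ?divr_ge0 ?mulr_ge0 ?sqrtr_ge0 ?(ltW N0).
have K0 : 0 < K by lra.
exists (6 * K * C); first by rewrite !mulr_gt0.
move=> lambda l1 x xl r s r1 us sP.
have l0 : 0 < lambda by lra.
set q := Num.sqrt lambda.
have q0 : 0 <= q by exact: sqrtr_ge0.
have q2 : q ^+ 2 = lambda by rewrite sqr_sqrtr ?ltW.
have q1 : 1 <= q by rewrite -sqrtr1 ler_wsqrtr// ltW.
have qr1 : 1 <= q * r by nra.
set F := C * lambda `^ eps; have F0 : 0 <= F by rewrite mulr_ge0 ?powR_ge0 ?ltW.
have -> : 6 * K * C * (q * lambda `^ eps) * r = 6 * K * (q * r) * F by rewrite /F; ring.
(* If sqrt(lambda) <= r the whole sphere may be counted, as it has O(lambda^(1 + eps)) points and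
   lambda <= sqrt(lambda) r. Otherwise r^2 <= sqrt(lambda) r, and the T and N errors are no larger
   than the binormal one. *)
have [rl|lr] := leP q r.
  apply: (@le_trans _ _ ((2 * lambda + 1) * F)).
    apply: (HC lambda l1 0) => // [|y /sP[yl _]]; first exact: ltW.
    by split=> //; rewrite subr0; exact: sphere_coord.
  rewrite ler_wpM2r//; have : lambda <= q * r by rewrite -q2 expr2 ler_wpM2l.
  have : q * r <= K * (q * r) by rewrite ler_peMl//; lra.
  rewrite -mulrA; lra.
pose X := Num.sqrt ((1 + nu) * 4 * lambda * r ^+ 2).
have XE : X = Num.sqrt ((1 + nu) * 4) * (q * r).
  rewrite /X -mulrA (sqrtrM _ nu1) (sqrtrM _ (ltW l0)) sqrtr_sqr ger0_norm//; lra.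
pose l := K * (q * r).
have l_0 : 0 <= l by rewrite mulr_ge0 ?(ltW K0)//; lra.
have lqr : q * r <= l by rewrite /l ler_peMl//; lra.
have half (sg : R) s' : sg ^+ 2 = 1 -> uniq s' -> (forall y, y \in s' ->
   [/\ lattice_sphere lambda y, frame_size T N (intv R x - intv R y) <= r ^+ 2 &
     `|dotv (intv R y) b - sg * dotv (intv R x) b| <= X]) ->
   (size s')%:R <= 3 * K * (q * r) * F.
  move=> sg1 us' s'P.
  apply: (@le_trans _ _ ((2 * l + 1) * F)); last first.
    by rewrite ler_wpM2r// -mulrA -/l; lra.
  (* The first coordinate of the point with the same T and N components as x and [sg] times its
     binormal component. *)
  pose c := dotv (intv R x) T * T 0 ord0 + dotv (intv R x) N * N 0 ord0 / nu +
     sg * dotv (intv R x) b * b 0 ord0 / nu.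
  apply: (HC lambda l1 c) => // y /s'P[yl fy yb]; split=> //.
  have e0E v : dotv v (intv R delta0) = v 0 ord0.
    rewrite /dotv (bigD1 ord0)//= !mxE eqxx mulr1 big1 ?addr0// => j j0.
    by rewrite !mxE (negbTE j0) mulr0.
  have := dotv_frame (intv R y) (intv R delta0) TT TN.
  rewrite !e0E -/nu -/b [intv R y 0 ord0]mxE => yE.
  have -> : (y 0 ord0)%:~R - c =
     - ((dotv (intv R x) T - dotv (intv R y) T) * T 0 ord0)
     + - ((dotv (intv R x) N - dotv (intv R y) N) * (N 0 ord0 / nu))
     + (dotv (intv R y) b - sg * dotv (intv R x) b) * (b 0 ord0 / nu).
    apply: (mulfI (lt0r_neq0 N0)); rewrite mulrBr yE /c; field.
    exact: lt0r_neq0.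
  have r2qr : r ^+ 2 <= q * r by rewrite expr2 ler_wpM2r//; lra.
  move: fy; rewrite /frame_size ge_max !dotvBl => /andP[hT hN].
  apply: (le_trans (ler_normD _ _)).
  have nrm (t : R) : `|t / nu| = `|t| / nu by rewrite normrM normfV (gtr0_norm N0).
  have t1 : `|- ((dotv (intv R x) T - dotv (intv R y) T) * T 0 ord0)| <=
     q * r * `|T 0 ord0|.
    by rewrite normrN normrM ler_wpM2r// (le_trans hT).
  have t2 : `|- ((dotv (intv R x) N - dotv (intv R y) N) * (N 0 ord0 / nu))| <=
     q * r * (`|N 0 ord0| / nu).
    by rewrite normrN normrM nrm ler_wpM2r ?divr_ge0 ?(ltW N0)// (le_trans hN).
  have t3 : `|(dotv (intv R y) b - sg * dotv (intv R x) b) * (b 0 ord0 / nu)| <=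
     q * r * (Num.sqrt ((1 + nu) * 4) * (`|b 0 ord0| / nu)).
    rewrite normrM nrm mulrA (mulrC (q * r)) -XE.
    by rewrite ler_wpM2r ?divr_ge0 ?(ltW N0).
  apply: (le_trans (lerD (ler_normD _ _) t3)).
  apply: (le_trans (lerD (lerD t1 t2) (lexx _))).
  rewrite -!mulrDr /l mulrC ler_wpM2r//; first by lra.
  by rewrite /K !mulrA; lra.
pose P y := `|dotv (intv R y) b - dotv (intv R x) b| <= X.
pose Q y := `|dotv (intv R y) b + dotv (intv R x) b| <= X.
have sPQ y : y \in s -> P y \/ Q y.
  move=> /sP[yl fy].
  exact: (binormal_dichotomy TT TN N0 xl yl fy).
have := size_filter_or sPQ; rewrite -(ler_nat R) natrD => /le_trans; apply.
have -> : 6 * K * (q * r) * F = 3 * K * (q * r) * F + 3 * K * (q * r) * F by ring.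
apply: lerD.
  apply: (half 1) => [||y]; rewrite ?expr1n ?filter_uniq//.
  by rewrite mem_filter mul1r => /andP[Py /sP[]].
apply: (half (-1)) => [||y]; rewrite ?sqrrN ?expr1n ?filter_uniq//.
by rewrite mem_filter mulN1r opprK => /andP[Qy /sP[]].
Qed.

End SphereCounting.

Section SlabCounting.
Variable R : realType.
Implicit Types (lambda : R).

(** Pigeonhole: M^2 + 1 multiples of [al] modulo 1 fall into M^2 boxes. *)
Lemma dirichlet2 (al : 'I_2 -> R) (M : nat) : (0 < M)%N ->
  exists n (p : 'I_2 -> int), [/\ (0 < n)%N, (n <= M ^ 2)%N &
    forall j, `|n%:R * al j - (p j)%:~R| <= M%:R^-1].
Proof.
move=> M0; have M0' : 0 < M%:R :> R by rewrite ltr0n.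
pose fr (x : R) := x - (Num.floor x)%:~R.
have fr01 x : 0 <= fr x < 1.
  have := floor_le_tmp x; have := floorD1_gt x; rewrite /fr rmorphD /=.
  by move=> ? ?; apply/andP; split; lra.
have frM (x : R) : (Num.truncn (M%:R * fr x) < M)%N.
  have /andP[f0 f1] := fr01 x.
  rewrite truncn_lt_nat ?mulr_ge0//; nra.
pose f (n : 'I_(M ^ 2).+1) : {ffun 'I_2 -> 'I_M} :=
  [ffun j => Ordinal (frM (n%:R * al j))].
have : ~~ injectiveb f.
  apply/negP => /injectiveP /leq_card.
  by rewrite card_ffun !card_ord ltnn.
case/injectivePn => n1 [n2 n12 fE].
wlog lt12 : n1 n2 n12 fE / (n1 < n2)%N.
  move=> W; have [h|h|h] := ltngtP n1 n2; first exact: (W n1 n2).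
    by apply: (W n2 n1); rewrite // eq_sym.
  by move: n12; rewrite -val_eqE /= h eqxx.
exists (n2 - n1)%N.
exists (fun j => Num.floor (n2%:R * al j) - Num.floor (n1%:R * al j)).
split; [by rewrite subn_gt0 | |].
  by rewrite (leq_trans (leq_subr _ _))// -ltnS ltn_ord.
move=> j.
have : val (f n1 j) = val (f n2 j) by rewrite fE.
rewrite !ffunE /= => tE.
have t1 := truncn_itv (_ : 0 <= M%:R * fr (n1%:R * al j)).
have t2 := truncn_itv (_ : 0 <= M%:R * fr (n2%:R * al j)).
have /andP[a1 _] := fr01 (n1%:R * al j); have /andP[a2 _] := fr01 (n2%:R * al j).
have {}t1 := t1 (mulr_ge0 (ltW M0') a1); have {}t2 := t2 (mulr_ge0 (ltW M0') a2).
rewrite natrB ?(ltnW lt12)// rmorphB /=.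
have -> : (n2%:R - n1%:R) * al j -
   ((Num.floor (n2%:R * al j))%:~R - (Num.floor (n1%:R * al j))%:~R) =
   fr (n2%:R * al j) - fr (n1%:R * al j) by rewrite /fr; ring.
rewrite -(ler_pM2l M0') mulfV ?gt_eqF// -{1}(ger0_norm (ltW M0')) -normrM mulrBr.
move: t1 t2; rewrite tE -natr1 ler_norml => /andP[? ?] /andP[? ?].
by apply/andP; split; lra.
Qed.

(** Let n <= M^2 and let q be an integer vector within 1 / M of n v / v_i. Then q.(x - y) is O(n r)
    + O(lambda / M), so the slab is covered by that many planes with normal q. The choice M about
    lambda^(1/3) makes both M^2 and lambda / M comparable to lambda^(2/3). *)
Lemma slab_count (v : 'rV[R]_3) (eps : R) : dotv v v = 1 -> 0 < eps ->
  exists2 C : R, 0 < C & forall lambda, 1 < lambda ->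
  forall (x : 'rV[int]_3), lattice_sphere lambda x ->
  forall (r : R) (s : seq 'rV[int]_3), 1 <= r -> uniq s ->
  (forall y, y \in s -> lattice_sphere lambda y /\
     `|dotv (intv R x - intv R y) v| <= r) ->
  (size s)%:R <= C * (lambda `^ (2 / 3) * lambda `^ eps) * r.
Proof.
move=> vv eps0.
have [i vi] : exists i, v 0 i != 0.
  apply/existsP; apply: contraT; rewrite negb_exists => /forallP v0.
  have vz j : v 0 j = 0 by apply/eqP; rewrite -[_ == _]negbK v0.
  have : dotv v v = 0 by apply: big1 => j _; rewrite vz mul0r.
  by move=> e; have := oner_neq0 R; rewrite -vv e eqxx.
pose al j := v 0 (lift i j) / v 0 i.
pose K := 4 * (`|al 0| + `|al 1| + 1) + 4 / `|v 0 i|.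
have vi0 : 0 < `|v 0 i| by rewrite normr_gt0.
have K4 : 4 <= K.
  have : 0 <= 4 / `|v 0 i| by rewrite divr_ge0.
  by rewrite /K; have := normr_ge0 (al 0); have := normr_ge0 (al 1); lra.
have K0 : 0 < K by lra.
have [C C0 HC] := sphere_plane_count eps0 K0.
exists (2 * (K + 4) * C + C); first by rewrite addr_gt0// !mulr_gt0//; lra.
move=> lambda l1 x xl r s r1 us sP.
have l0 : 0 < lambda by lra.
set h := lambda `^ (1 / 3).
have h1 : 1 <= h by rewrite -(powRr0 lambda) ler_powR ?ltW// divr_gt0.
have h0 : 0 < h by lra.
have hh : lambda `^ (2 / 3) = h ^+ 2.
  by rewrite -powR_mulrn ?powR_ge0// -powRrM; congr powR; field.
have hhh : lambda = h ^+ 3.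
  rewrite -powR_mulrn ?powR_ge0// -powRrM (_ : 1 / 3 * 3 = 1); last by field.
  by rewrite powRr1// ltW.
rewrite hh.
pose M := (Num.truncn h).+1.
have hM : h <= M%:R by rewrite ltW// truncnS_gt.
have Mh : M%:R <= 2 * h.
  have : (Num.truncn h)%:R <= h by rewrite truncn_le// ltW.
  by rewrite /M -natr1; lra.
have M0 : 0 < M%:R :> R by [].
have [n [p [n0 nM pn]]] := dirichlet2 al (ltn0Sn (Num.truncn h)).
rewrite -/M in nM pn.
(* The common denominator n sits at coordinate i, where the approximation is exact; n > 0 makes q
   nonzero there. *)
pose q : 'rV[int]_3 := \row_k (if unlift i k is Some j then p j else n%:Z).
have qi : q 0 i = n by rewrite mxE unlift_none.
have qj j : q 0 (lift i j) = p j by rewrite mxE liftK.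
have nh : n%:R <= 4 * h ^+ 2.
  apply: (@le_trans _ _ (M%:R ^+ 2)); first by rewrite -natrX ler_nat.
  by rewrite (_ : 4 * h ^+ 2 = (2 * h) ^+ 2); [rewrite lerXn2r// nnegrE; lra | ring].
have Mi1 : M%:R^-1 <= 1 :> R by rewrite invf_le1// ler1n.
have hl : h ^+ 2 <= lambda by rewrite hhh ler_weXn2l.
have h21 : 1 <= h ^+ 2 by rewrite exprn_ege1.
have alK j : `|al j| <= `|al 0| + `|al 1|.
  case: j => [[|[|//]] k2].
    rewrite [X in `|al X|](_ : _ = 0); first by rewrite lerDl.
    exact: val_inj.
  rewrite [X in `|al X|](_ : _ = 1); first by rewrite lerDr.
  exact: val_inj.
have K4' : 4 * (`|al 0| + `|al 1| + 1) <= K by rewrite /K lerDl divr_ge0.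
have K4'' : 4 / `|v 0 i| <= K by rewrite /K lerDr mulr_ge0// !addr_ge0.
have qK k : `|(q 0 k)%:~R| <= K * lambda.
  apply: (@le_trans _ _ (K * h ^+ 2)); last by rewrite ler_pM2l.
  have [j ->|->] := unliftP i k; last first.
    rewrite qi ger0_norm//; apply: (le_trans nh).
    by rewrite ler_pM2r// exprn_gt0.
  rewrite qj; apply: (@le_trans _ _ (n%:R * `|al j| + 1)).
    have := ler_normD (n%:R * al j) (- (n%:R * al j - (p j)%:~R)).
    rewrite opprB subrKC normrM (@ger0_norm _ n%:R)// distrC => H1.
    have := le_trans H1 (lerD (lexx _) (pn j)).
    by move/le_trans; apply; rewrite lerD2l.
  apply: (@le_trans _ _ (4 * (`|al 0| + `|al 1| + 1) * h ^+ 2)); last first.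
    by rewrite ler_pM2r// exprn_gt0.
  have := ler_pM (ler0n _ n) (normr_ge0 _) nh (alK j).
  move: (`|al 0| + `|al 1|) => a H2; rewrite mulrDr mulr1 mulrDl; lra.
pose g (y : 'rV[int]_3) : int := \sum_k q 0 k * y 0 k.
pose F := C * lambda `^ eps.
have F0 : 0 <= F by rewrite mulr_ge0 ?powR_ge0 ?ltW.
pose l := (K + 4) * h ^+ 2 * r.
have l_0 : 0 <= l by rewrite /l !mulr_ge0 ?exprn_ge0 ?(ltW h0) ?(le_trans ler01 r1)// addr_ge0// ltW.
apply: (@le_trans _ _ ((2 * l + 1) * F)); last first.
  rewrite (_ : (2 * (K + 4) * C + C) * (h ^+ 2 * lambda `^ eps) * r =
     (2 * l + h ^+ 2 * r) * F); last by rewrite /l /F; ring.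
  by rewrite ler_wpM2r// lerD2l; nra.
apply: (size_slices (g := g) (c := (g x)%:~R)) => //.
  move=> m; apply: (HC lambda l1 q i _ qK m).
  - by rewrite qi; case: (n) n0.
  - exact: filter_uniq.
  - by move=> y; rewrite mem_filter => /andP[/eqP <- /sP[yl _]].
apply/allP => y /sP[yl yr] /=.
have gE z : (g z)%:~R = \sum_k (q 0 k)%:~R * (z 0 k)%:~R :> R.
  by rewrite rmorph_sum; apply: eq_bigr => k _; rewrite rmorphM.
rewrite !gE -sumrB.
have dE : dotv (intv R x - intv R y) v = \sum_k ((x 0 k)%:~R - (y 0 k)%:~R) * v 0 k.
  by apply: eq_bigr => k _; rewrite !mxE.
(* q is split into (n / v_i) v and the approximation error; the error vanishes at coordinate i,
   leaving two terms of at most 2 lambda / M. *)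
have -> : \sum_k ((q 0 k)%:~R * (y 0 k)%:~R - (q 0 k)%:~R * (x 0 k)%:~R) =
   - (n%:R / v 0 i) * dotv (intv R x - intv R y) v +
   \sum_k ((q 0 k)%:~R - n%:R / v 0 i * v 0 k) * ((y 0 k)%:~R - (x 0 k)%:~R) :> R.
  rewrite dE mulr_sumr -big_split /=; apply: eq_bigr => k _.
  by field; exact: vi.
apply: (le_trans (ler_normD _ _)).
have e1 : `|- (n%:R / v 0 i) * dotv (intv R x - intv R y) v| <= K * h ^+ 2 * r.
  rewrite normrM; apply: ler_pM => //.
  rewrite normrN normrM normfV ger0_norm//.
  apply: (@le_trans _ _ (4 / `|v 0 i| * h ^+ 2)).
    by rewrite mulrAC ler_pM2r ?invr_gt0.
  by rewrite ler_pM2r// exprn_gt0.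
have e2 : `|\sum_k ((q 0 k)%:~R - n%:R / v 0 i * v 0 k) *
     ((y 0 k)%:~R - (x 0 k)%:~R)| <= 4 * h ^+ 2.
  apply: (le_trans (ler_norm_sum _ _ _)).
  rewrite (bigD1_ord i)//= qi divfK// subrr mul0r normr0 add0r.
  apply: (@le_trans _ _ (\sum_(j < 2) 2 * h ^+ 2)); last first.
    by rewrite sumr_const card_ord -mulr_natl; lra.
  apply: ler_sum => j _; rewrite qj normrM.
  apply: (@le_trans _ _ (M%:R^-1 * (2 * lambda))).
    apply: ler_pM => //.
      by rewrite mulrAC -mulrA distrC; exact: pn.
    apply: (le_trans (ler_normB _ _)).
    by have := sphere_coord (lift i j) xl; have := sphere_coord (lift i j) yl; lra.
  rewrite mulrC ler_pdivrMr// hhh -mulrA exprSr ler_pM2l//.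
  by rewrite ler_wpM2l// exprn_ge0// ltW.
apply: (le_trans (lerD e1 e2)); rewrite /l.
rewrite (_ : (K + 4) * h ^+ 2 * r = K * h ^+ 2 * r + 4 * h ^+ 2 * r); last by ring.
rewrite lerD2l.
by rewrite ler_peMr// mulr_ge0// exprn_ge0// ltW.
Qed.

(* A logarithm is lost to the power lambda^eps. *)
Lemma sum_inv_powR_le (eps K : R) : 0 < eps -> 1 <= K ->
  exists2 C : R, 0 < C & forall lambda, 1 < lambda ->
  forall (T : eqType) (s : seq T) (x : T -> R) (A : R),
  (forall t, t \in s -> x t <= K * lambda) ->
  (forall j : nat, (0 < j)%N ->
     (size [seq t <- s | x t < j%:R])%:R <= A * j%:R) ->
  \sum_(t <- s) (Num.max 1 (x t))^-1 <= C * A * lambda `^ eps.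
Proof.
move=> eps0 K1; exists (2 * (2 + (2 * K) `^ eps / eps)).
  by rewrite mulr_gt0// addr_gt0// divr_gt0// powR_gt0//; lra.
move=> lambda l1 T s x A xK cA.
have A0 : 0 <= A by have := cA 1%N isT; rewrite mulr1; apply: le_trans.
have Kl1 : 1 <= K * lambda by nra.
pose N := (Num.truncn (K * lambda)).+1.
have xN t : t \in s -> x t < N%:R.
  by move=> /xK h; apply: (le_lt_trans h); exact: truncnS_gt.
apply: (le_trans (sum_inv_le (ltn0Sn _) xN cA)).
have le1 : 1 <= lambda `^ eps by rewrite -(powRr0 lambda) ler_powR// ltW.
have N1 : 0 < N%:R :> R by [].
have NK : N%:R <= 2 * K * lambda.
  have : (Num.truncn (K * lambda))%:R <= K * lambda by rewrite truncn_le//; lra.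
  by rewrite /N -natr1; lra.
have lnN : ln N%:R <= (2 * K) `^ eps / eps * lambda `^ eps.
  rewrite mulrAC -powRM; [|lra..]; rewrite ler_pdivlMr// mulrC -ln_powR.
  apply: (le_trans (ltW (ln_sublinear (powR_gt0 _ N1)))).
  by rewrite ge0_ler_powR// ?nnegrE ?ltW//; lra.
rewrite (_ : 2 * (2 + _) * A * _ = 2 * A * (2 * lambda `^ eps + (2 * K) `^ eps / eps * lambda `^ eps)); last by ring.
rewrite ler_wpM2l ?mulr_ge0// lerD//; lra.
Qed.
End SlabCounting.

(** * Schur's test *)

Section Antiderivatives.
Variable R : realType.
Implicit Types (f g A E : R -> R) (s t : R).

Let clamp s s' t : R := Num.max s (Num.min t s').

Let clamp_itv s s' t : s <= s' -> s <= clamp s s' t <= s'.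
Proof. by move=> ss'; rewrite le_max lexx ge_max ss' ge_min lexx orbT. Qed.

Let clamp_id s s' t : s <= t <= s' -> clamp s s' t = t.
Proof. by move=> /andP[st ts]; rewrite /clamp (min_idPl ts) (max_idPr st). Qed.

Let clamp_lipschitz s s' t u : s <= s' -> `|clamp s s' t - clamp s s' u| <= `|t - u|.
Proof.
move=> ss'; have cE x : clamp s s' x = if x <= s then s else
    if x <= s' then x else s'.
  rewrite /clamp; have [xs|xs] := leP x s.
    by rewrite (min_idPl (le_trans xs ss')) (max_idPl xs).
  have [xs'|xs'] := leP x s'; first by rewrite (max_idPr (ltW xs)).
  by rewrite (max_idPr ss').
wlog tu : t u / u <= t.
  by move=> W; have [/ltW h|h] := ltP t u; [rewrite distrC [leRHS]distrC|]; apply: W.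
rewrite !cE ler_norml ger0_norm ?subr_ge0//.
by case: (leP t s) => ?; case: (leP u s) => ?; case: (leP t s') => ?;
   case: (leP u s') => ?; apply/andP; split; lra.
Qed.

(** Outside the segment g is extended by its endpoint values, and the extension is integrated from s
    - 1. Both endpoints thereby become interior, as two-sided differentiability requires. *)
Lemma antiderivative_exists s s' g : s <= s' ->
  {within `[s, s'], continuous g} -> exists A, derives s s' A g.
Proof.
move=> ss' cg; pose G t := g (clamp s s' t).
have cG : continuous G.
  move=> x; apply/cvgrPdist_lt => e e0.
  have /subspace_continuousP /(_ (clamp s s' x)) := cg.
  rewrite /= in_itv /= clamp_itv// => /(_ isT) /cvgrPdist_lt /(_ e e0).
  rewrite near_withinE => /nbhs_ballP[d /= d0 dP].
  apply/nbhs_ballP; exists d => //= y xy; apply: dP; last by rewrite /= in_itv /= clamp_itv.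
  by apply: le_lt_trans xy; exact: clamp_lipschitz.
pose mu := @lebesgue_measure R.
have iG : mu.-integrable `[s - 1, s' + 1] (EFin \o G).
  apply: continuous_compact_integrable; first exact: segment_compact.
  exact: continuous_subspaceT.
exists (fun x => \int[mu]_(t in `[s - 1, x]) G t)%R => t tss.
have [] := @continuous_FTC1_closed R G (s - 1) t (s' + 1) _ iG _ (cG t).
- by case/andP: tss => _ h; lra.
- by case/andP: tss => h _; lra.
rewrite derive1E => dF F'; apply: DeriveDef => //.
by rewrite F' /G clamp_id.
Qed.

Lemma derives_unique s s' f A E : s <= s' -> derives s s' A f ->
  derives s s' E f -> E s' - E s = A s' - A s.
Proof.
move=> ss' dA dE; apply/eqP; rewrite eq_le.
by rewrite (derives_le ss' dE dA) ?(derives_le ss' dA dE).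
Qed.

(** The integral of f is at most K in absolute value. Bundling the existence of an antiderivative
    lets such bounds be added and scaled without a word on integrability. *)
Definition integral_bound s s' f (K : R) :=
  exists2 A, derives s s' A f & `|A s' - A s| <= K.

Lemma integral_boundD s s' f g K L : integral_bound s s' f K ->
  integral_bound s s' g L -> integral_bound s s' (fun t => f t + g t) (K + L).
Proof.
move=> [A dA hA] [E dE hE]; exists (fun t => A t + E t); first exact: derivesD.
rewrite (_ : _ - _ = (A s' - A s) + (E s' - E s)); last by ring.
by rewrite (le_trans (ler_normD _ _))// lerD.
Qed.

Lemma integral_boundZ s s' k f K : integral_bound s s' f K ->
  integral_bound s s' (fun t => k * f t) (`|k| * K).
Proof.
move=> [A dA hA]; exists (fun t => k * A t); first exact: derivesZ.
by rewrite -mulrBr normrM ler_wpM2l.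
Qed.

Lemma integral_bound_sum s s' (I : eqType) (r : seq I) (f : I -> R -> R) (K : I -> R) :
  (forall i, i \in r -> integral_bound s s' (f i) (K i)) ->
  integral_bound s s' (fun t => \sum_(i <- r) f i t) (\sum_(i <- r) K i).
Proof.
elim: r => [_|i r IH H].
  rewrite big_nil; exists (fun=> 0); last by rewrite subrr normr0.
  by apply: derives_eq (@derives_cst _ s s' 0) => t _; rewrite big_nil.
rewrite big_cons.
have [A dA hA] := integral_boundD (H i (mem_head _ _))
  (IH (fun j jr => H j (@mem_behead _ (i :: r) j jr))).
by exists A => //; apply: derives_eq dA => t _; rewrite big_cons.
Qed.

(** The supremum of the x with P a x is reached and cannot lie before b, since the local hypothesis
    at that point extends P beyond it. This replaces a finite subcover when local bounds are
    glued. *)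
Lemma segment_induction (P : R -> R -> Prop) (a b : R) : a <= b ->
  (forall s m s', a <= s -> s <= m -> m <= s' -> s' <= b ->
     P s m -> P m s' -> P s s') ->
  (forall t0, a <= t0 <= b -> exists2 d, 0 < d & forall s s', a <= s ->
     s <= s' -> s' <= b -> t0 - d <= s -> s' <= t0 + d -> P s s') ->
  P a b.
Proof.
move=> ab Padd Ploc; pose S := [set x | a <= x <= b /\ P a x].
have Sa : S a.
  split; first by rewrite lexx.
  have [|d d0 dP] := Ploc a; first by rewrite lexx.
  by apply: dP => //; lra.
have Sb : ubound S b by move=> x [/andP[]].
have supS : has_sup S by split; [exists a | exists b].
have ac : a <= sup S by apply: ub_le_sup => //; exists b.
have cb : sup S <= b by apply: ge_sup => //; exists a.
have [|d d0 dP] := Ploc (sup S); first by rewrite ac cb.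
have [x [/andP[ax xb] Px] xd] := sup_adherent d0 supS.
have xc : x <= sup S by apply: ub_le_sup; [exists b | split=> //; rewrite ax xb].
have [cdb|bcd] := leP (sup S + d) b.
  have : S (sup S + d).
    split; first by rewrite cdb andbT; lra.
    apply: (Padd a x) => //; first by lra.
    by apply: dP => //; lra.
  by move=> /(ub_le_sup (ex_intro _ b Sb)); lra.
by apply: (Padd a x) => //; apply: dP => //; lra.
Qed.

End Antiderivatives.

Section Schur.
Variable R : realType.
Implicit Types (S : seq 'rV[int]_3) (a : 'rV[int]_3 -> R[i]).
Local Notation normc := ComplexField.Normc.normc.

Lemma normc_sqr (z : R[i]) : normc z ^+ 2 = complex.Re z ^+ 2 + complex.Im z ^+ 2.
Proof. by case: z => x y /=; rewrite sqr_sqrtr// addr_ge0 ?sqr_ge0. Qed.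

(** The real part of z * conj(w) * e^(i d). *)
Definition trig_pair (z w : R[i]) (d : R) : R :=
  (complex.Re z * complex.Re w + complex.Im z * complex.Im w) * cos d +
  (complex.Re z * complex.Im w - complex.Im z * complex.Re w) * sin d.

Lemma normc_trig_sum (I : Type) (r : seq I) (a : I -> R[i]) (th : I -> R) :
  normc (\sum_(i <- r) a i * expi (th i)) ^+ 2 =
  \sum_(i <- r) \sum_(j <- r) trig_pair (a i) (a j) (th i - th j).
Proof.
pose X i := complex.Re (a i) * cos (th i) - complex.Im (a i) * sin (th i).
pose Y i := complex.Re (a i) * sin (th i) + complex.Im (a i) * cos (th i).
have -> : \sum_(i <- r) a i * expi (th i) =
    ((\sum_(i <- r) X i) +i* (\sum_(i <- r) Y i))%C.
  elim: r => [|i r IH]; first by rewrite !big_nil.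
  rewrite !big_cons IH /X /Y; case: (a i) => p q /=.
  by rewrite /expi; simpc.
rewrite normc_sqr /= !expr2 !big_distrlr /= -big_split /=.
apply: eq_bigr => i _; rewrite -big_split /=; apply: eq_bigr => j _.
by rewrite /X /Y /trig_pair cosB sinB; ring.
Qed.

(** The free shift [th] covers the sine as a cosine shifted by pi / 2; both coefficients are at most
    (|z|^2 + |w|^2) / 2 in absolute value. *)
Lemma trig_pair_bound s s' (z w : R[i]) (d : R -> R) (K : R) :
  (forall th, integral_bound s s' (fun t => cos (d t + th)) K) ->
  integral_bound s s' (fun t => trig_pair z w (d t))
     ((normc z ^+ 2 + normc w ^+ 2) * K).
Proof.
move=> H; have K0 : 0 <= K by have [A _ +] := H 0; apply: le_trans.
have [A dA hA] := integral_boundD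
  (integral_boundZ (complex.Re z * complex.Re w + complex.Im z * complex.Im w) (H 0))
  (integral_boundZ (complex.Re z * complex.Im w - complex.Im z * complex.Re w) (H (- (pi / 2)))).
exists A.
  apply: derives_eq dA => t _; rewrite addr0 /trig_pair; congr (_ + _ * _).
  by rewrite cosB cos_pihalf sin_pihalf mulr0 mulr1 add0r.
apply: (le_trans hA); rewrite -mulrDl ler_wpM2r// !normc_sqr.
move: (complex.Re z) (complex.Im z) (complex.Re w) (complex.Im w) => x y x' y'.
have h1 := sqr_ge0 (x - x'); have h2 := sqr_ge0 (x + x').
have h3 := sqr_ge0 (y - y'); have h4 := sqr_ge0 (y + y').
have h5 := sqr_ge0 (x - y'); have h6 := sqr_ge0 (x + y').
have h7 := sqr_ge0 (y - x'); have h8 := sqr_ge0 (y + x').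
have e1 : `|x * x' + y * y'| <= (x ^+ 2 + y ^+ 2 + (x' ^+ 2 + y' ^+ 2)) / 2.
  by rewrite ler_norml; apply/andP; split; nra.
have e2 : `|x * y' - y * x'| <= (x ^+ 2 + y ^+ 2 + (x' ^+ 2 + y' ^+ 2)) / 2.
  by rewrite ler_norml; apply/andP; split; nra.
by lra.
Qed.

(** Each pair contributes at most (|a_i|^2 + |a_j|^2) ka(i, j). By symmetry of ka the two resulting
    double sums are equal, and each is bounded through the row sums. *)
Lemma schur_bound s s' (I : eqType) (r : seq I) (a : I -> R[i]) (th : I -> R -> R)
    (ka : I -> I -> R) (B : R) (E : R -> R) : s <= s' ->
  (forall i j, i \in r -> j \in r -> forall c,
     integral_bound s s' (fun t => cos (th i t - th j t + c)) (ka i j)) ->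
  (forall i j, ka i j = ka j i) ->
  (forall i, i \in r -> \sum_(j <- r) ka i j <= B) ->
  derives s s' E (fun t => normc (\sum_(i <- r) a i * expi (th i t)) ^+ 2) ->
  E s' - E s <= 2 * B * \sum_(i <- r) normc (a i) ^+ 2.
Proof.
move=> ss' H sym Bka dE.
have [A dA hA] := integral_bound_sum (fun i ir => integral_bound_sum
  (fun j jr => trig_pair_bound (a i) (a j) (H i j ir jr))).
rewrite (@derives_unique _ s s' _ A E ss' _ dE); last first.
  by apply: derives_eq dA => t _; rewrite normc_trig_sum.
apply: (le_trans (ler_norm _)); apply: (le_trans hA).
under eq_bigr do under eq_bigr do rewrite mulrDl.
under eq_bigr do rewrite big_split /=.
rewrite big_split /= [X in _ + X]exchange_big /=.
have half : \sum_(i <- r) \sum_(j <- r) normc (a i) ^+ 2 * ka i j <=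
   B * \sum_(i <- r) normc (a i) ^+ 2.
  rewrite mulr_sumr !big_seq; apply: ler_sum => i ir.
  by rewrite -mulr_sumr mulrC ler_wpM2r ?sqr_ge0// Bka.
rewrite (_ : 2 * B * _ = B * (\sum_(i <- r) normc (a i) ^+ 2) +
   B * (\sum_(i <- r) normc (a i) ^+ 2)); last by ring.
apply: lerD => //; apply: le_trans half.
rewrite le_eqVlt; apply/orP; left; apply/eqP.
by apply: eq_bigr => i _; apply: eq_bigr => j _; rewrite sym.
Qed.
End Schur.

(** * From row sums of the kernel to bounds on arcs *)

Section ArcBounds.
Variable R : realType.
Implicit Types (gamma : R -> 'rV[R]_3) (lambda : R).
Local Notation normc := ComplexField.Normc.normc.

Definition sphere_seq lambda : seq 'rV[int]_3 :=
  finmap.enum_fset (fset_set (lattice_sphere lambda)).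

Lemma mem_sphere_seq lambda x : x \in sphere_seq lambda <-> lattice_sphere lambda x.
Proof.
rewrite /sphere_seq in_fset_set; last exact: finite_lattice_sphere.
by rewrite inE.
Qed.

Lemma sphere_seq_uniq lambda : uniq (sphere_seq lambda).
Proof. exact: finmap.fset_uniq. Qed.

Definition wave lambda (a : 'rV[int]_3 -> R[i]) (x : 'rV[R]_3) : R[i] :=
  \sum_(xi <- sphere_seq lambda) a xi * expi (2 * pi * dotv (intv R xi) x).

Definition coeff_sqnorm lambda (a : 'rV[int]_3 -> R[i]) : R :=
  \sum_(xi <- sphere_seq lambda) normc (a xi) ^+ 2.

Lemma coeff_sqnorm_ge0 lambda a : 0 <= coeff_sqnorm lambda a.
Proof. by apply: sumr_ge0 => xi _; rewrite sqr_ge0. Qed.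

(* This bounds the square of the norm: sigma is twice the exponent of
   restriction_bound. *)
Definition arc_bound gamma s s' (sigma : R) : Prop :=
  forall eps, 0 < eps -> exists2 C : R, 0 <= C & forall lambda, 1 < lambda ->
  forall a E, derives s s' E (fun t => normc (wave lambda a (gamma t)) ^+ 2) ->
  E s' - E s <= C * lambda `^ (sigma + eps) * coeff_sqnorm lambda a.

Lemma arc_boundD gamma s m s' sigma : s <= m -> m <= s' ->
  arc_bound gamma s m sigma -> arc_bound gamma m s' sigma ->
  arc_bound gamma s s' sigma.
Proof.
move=> sm ms' h h' eps eps0.
have [C C0 HC] := h eps eps0; have [C' C'0 HC'] := h' eps eps0.
exists (C + C'); first exact: addr_ge0.
move=> lambda l1 a E dE.
have := HC lambda l1 a E (derives_sub (lexx s) ms' dE).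
have := HC' lambda l1 a E (derives_sub sm (lexx s') dE).
by rewrite !mulrDl; lra.
Qed.

Lemma arc_bound_schur gamma s s' sigma : s <= s' ->
  (forall eps, 0 < eps -> exists2 C : R, 0 <= C & forall lambda, 1 < lambda ->
   exists ka : 'rV[int]_3 -> 'rV[int]_3 -> R,
   [/\ (forall x y, lattice_sphere lambda x -> lattice_sphere lambda y -> forall c,
         integral_bound s s' (fun t => cos (2 * pi * dotv (intv R x) (gamma t)
           - 2 * pi * dotv (intv R y) (gamma t) + c)) (ka x y)),
       (forall x y, ka x y = ka y x) &
       (forall x, lattice_sphere lambda x ->
         \sum_(y <- sphere_seq lambda) ka x y <= C * lambda `^ (sigma + eps))]) ->
  arc_bound gamma s s' sigma.
Proof.
move=> ss' H eps eps0; have [C C0 HC] := H eps eps0.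
exists (2 * C); first by rewrite mulr_ge0.
move=> lambda l1 a E dE; have [ka [kb ks kB]] := HC lambda l1.
rewrite -(mulrA 2).
apply: (@schur_bound R s s' _ _ _
  (fun xi t => 2 * pi * dotv (intv R xi) (gamma t)) ka _ _ ss' _ ks _ dE).
  by move=> x y /mem_sphere_seq xl /mem_sphere_seq yl; exact: kb.
by move=> x /mem_sphere_seq; exact: kB.
Qed.

Lemma cos_integral_bound s s' (g : R -> R) (K : R) : s <= s' ->
  {within `[s, s'], continuous g} ->
  (forall A, derives s s' A (fun t => cos (g t)) -> `|A s' - A s| <= K) ->
  integral_bound s s' (fun t => cos (g t)) K.
Proof.
move=> ss' cg H.
have [A dA] : exists A, derives s s' A (fun t => cos (g t)).
  apply: antiderivative_exists => // x.
  exact: (@continuous_comp (subspace `[s, s']) _ _ g cos x (cg x)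
    (@continuous_cos R _)).
by exists A => //; exact: H.
Qed.

Lemma sqrt_frame_size_le (T N : 'rV[R]_3) lambda x y :
  dotv T T = 1 -> dotv T N = 0 -> 0 < dotv N N -> 1 < lambda ->
  lattice_sphere lambda x -> lattice_sphere lambda y ->
  Num.sqrt (frame_size T N (intv R x - intv R y)) <= (3 + 2 * dotv N N) * lambda.
Proof.
move=> TT TN N0 l1 xl yl; have := frame_size_le TT TN N0 xl yl.
set rho := frame_size _ _ _ => h.
have rho0 : 0 <= rho by rewrite /rho le_max normr_ge0.
have := sqr_sqrtr rho0; set q := Num.sqrt rho => q2.
have q0 : 0 <= q by exact: sqrtr_ge0.
have : q <= 1 + rho by rewrite -q2; have := sqr_ge0 (q - 1); nra.
by move: N0 h l1; move: (dotv N N) => n; nra.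
Qed.

Lemma frame_sum (T N : 'rV[R]_3) (eps : R) :
  dotv T T = 1 -> dotv T N = 0 -> 0 < dotv N N -> 0 < eps ->
  exists2 C : R, 0 < C & forall lambda, 1 < lambda ->
  forall x, lattice_sphere lambda x ->
  \sum_(y <- sphere_seq lambda)
    (Num.max 1 (Num.sqrt (frame_size T N (intv R x - intv R y))))^-1 <=
  C * lambda `^ (1 / 2 + eps).
Proof.
move=> TT TN N0 eps0; have e2 : 0 < eps / 2 by rewrite divr_gt0.
have [C C0 HC] := frame_ball_count TT TN N0 e2.
have [D D0 HD] := @sum_inv_powR_le R (eps / 2) (3 + 2 * dotv N N) e2 ltac:(lra).
exists (D * C); first exact: mulr_gt0.
move=> lambda l1 x xl.
have l0 : 0 < lambda by lra.
apply: (le_trans (HD lambda l1 _ _ _ (C * (Num.sqrt lambda * lambda `^ (eps / 2))) _ _)).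
- by move=> y /mem_sphere_seq yl; exact: sqrt_frame_size_le.
- move=> j j0; apply: (HC lambda l1 x xl).
  + by rewrite ler1n.
  + by rewrite filter_uniq// sphere_seq_uniq.
  + move=> y; rewrite mem_filter => /andP[yj /mem_sphere_seq yl]; split=> //.
    set rho := frame_size _ _ _ in yj *.
    have rho0 : 0 <= rho by rewrite /rho le_max normr_ge0.
    by rewrite -(sqr_sqrtr rho0) lerXn2r ?nnegrE ?sqrtr_ge0// ltW.
- have -> : lambda `^ (1 / 2 + eps) = Num.sqrt lambda * lambda `^ (eps / 2) * lambda `^ (eps / 2).
    rewrite -(powR12_sqrt (ltW l0)) -!powRD ?(gt_eqF l0) ?implybT//.
    by congr powR; field.
  by rewrite le_eqVlt; apply/orP; left; apply/eqP; ring.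
Qed.

(** [theta] is the power of lambda lost in comparing the oscillatory integral with rho^(-1/2): it is
    0 for a phase that is flat near the point and 1/6 in the twisted case. *)
Lemma frame_arc_bound gamma s s' (T N : 'rV[R]_3) (theta K : R) : s <= s' ->
  dotv T T = 1 -> dotv T N = 0 -> 0 < dotv N N -> 0 <= K ->
  (forall w, {within `[s, s'], continuous (fun t => dotv w (gamma t))}) ->
  (forall lambda, 1 < lambda -> forall x y, lattice_sphere lambda x ->
     lattice_sphere lambda y -> forall c A,
     derives s s' A (fun t => cos (2 * pi * dotv (intv R x - intv R y) (gamma t) + c)) ->
     `|A s' - A s| <= K * lambda `^ theta /
        Num.max 1 (Num.sqrt (frame_size T N (intv R x - intv R y)))) ->
  arc_bound gamma s s' (1 / 2 + theta).
Proof.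
move=> ss' TT TN N0 K0 cg H; apply: arc_bound_schur => // eps eps0.
have [C C0 HC] := frame_sum TT TN N0 eps0.
exists (K * C); first by rewrite mulr_ge0// ltW.
move=> lambda l1; have l0 : 0 < lambda by lra.
exists (fun x y => K * lambda `^ theta /
  Num.max 1 (Num.sqrt (frame_size T N (intv R x - intv R y)))); split.
- move=> x y xl yl c.
  have e t : 2 * pi * dotv (intv R x) (gamma t) - 2 * pi * dotv (intv R y) (gamma t) + c
      = 2 * pi * dotv (intv R x - intv R y) (gamma t) + c.
    by rewrite -mulrBr dotvC [dotv (intv R y) _]dotvC !(dotvC (gamma t)) -dotvBl.
  rewrite (_ : (fun t => _) = (fun t =>
     cos (2 * pi * dotv (intv R x - intv R y) (gamma t) + c))); last first.
    by apply/funext => t; rewrite e.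
  apply: cos_integral_bound => //; last by move=> A; exact: H.
  move=> t; apply: cvgD; last exact: cvg_cst.
  by apply: cvgM; [exact: cvg_cst | exact: cg].
- move=> x y; congr (_ / Num.max 1 (Num.sqrt _)).
  by rewrite /frame_size !dotvBl; congr Num.max; rewrite distrC.
- move=> x xl; rewrite -mulr_sumr.
  apply: (@le_trans _ _ (K * lambda `^ theta * (C * lambda `^ (1 / 2 + eps)))).
    by rewrite ler_wpM2l ?mulr_ge0 ?powR_ge0// HC.
  rewrite mulrACA -powRD ?(gt_eqF l0) ?implybT//.
  by rewrite addrCA addrA.
Qed.

End ArcBounds.

(** * Arcs near a point of a curve with nonzero curvature *)

Section CurveBounds.
Variable R : realType.

Let pi1 : 1 <= 2 * pi :> R.
Proof. by have := pi_ge2 R; lra. Qed.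

Definition derives_vec a b (F G : R -> 'rV[R]_3) :=
  forall j, derives a b (fun t => F t 0 j) (fun t => G t 0 j).

Lemma derives_dotv a b F G w : derives_vec a b F G ->
  derives a b (fun t => dotv w (F t)) (fun t => dotv w (G t)).
Proof.
move=> FG; rewrite (_ : (fun t => dotv w (F t)) = (fun t => w 0 ord0 * F t 0 ord0 +
  w 0 (lift ord0 ord0) * F t 0 (lift ord0 ord0) +
  w 0 (lift ord0 (lift ord0 ord0)) * F t 0 (lift ord0 (lift ord0 ord0)))); last first.
  by apply/funext => t; rewrite dotvE.
apply: derives_eq (derivesD (derivesD (derivesZ _ (FG _)) (derivesZ _ (FG _)))
  (derivesZ _ (FG _))) => t _.
by rewrite dotvE.
Qed.

Lemma within_continuous_dotv a b (F : R -> 'rV[R]_3) (w : 'rV[R]_3) :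
  (forall j, {within `[a, b], continuous (fun t => F t 0 j)}) ->
  {within `[a, b], continuous (fun t => dotv w (F t))}.
Proof.
move=> cF; rewrite (_ : (fun t => _) = (fun t => w 0 ord0 * F t 0 ord0 +
  w 0 (lift ord0 ord0) * F t 0 (lift ord0 ord0) +
  w 0 (lift ord0 (lift ord0 ord0)) * F t 0 (lift ord0 (lift ord0 ord0)))).
  exact: within_continuous_comb.
by apply/funext => t; rewrite dotvE.
Qed.

Variables (a b : R) (gamma G1 G2 G3 : R -> 'rV[R]_3).
Hypotheses (dg : derives_vec a b gamma G1) (dg1 : derives_vec a b G1 G2)
  (dg2 : derives_vec a b G2 G3)
  (cg3 : forall j, {within `[a, b], continuous (fun t => G3 t 0 j)}).
Variable t0 : R.
Hypothesis t0ab : a <= t0 <= b.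
Let T := G1 t0.
Let N := G2 t0.
Let nu := dotv N N.
Let B := cross T N.
Hypotheses (TT : dotv T T = 1) (TN : dotv T N = 0) (N0 : 0 < dotv N N).

(** This brings the phase into the form al u + be v + ka f + c, with al and be proportional to the T
    and N components of k. Dividing the normal component by nu makes v'' equal to 1 at t0. *)
Lemma frame_phase k t c :
  2 * pi * dotv k (gamma t) + c =
  2 * pi * dotv k T * dotv T (gamma t) + 2 * pi * dotv k N * (nu^-1 * dotv N (gamma t))
  + 2 * pi * dotv k B / nu * dotv B (gamma t) + c.
Proof.
congr (_ + _); apply: (mulfI (lt0r_neq0 N0)).
have := dotv_frame k (gamma t) TT TN; rewrite -/B -/nu => h.
rewrite mulrCA h /nu; field; exact: lt0r_neq0.
Qed.

Lemma max_frame k : Num.max `|2 * pi * dotv k T| `|2 * pi * dotv k N| =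
  2 * pi * frame_size T N k.
Proof.
have p0 : 0 <= 2 * pi :> R by rewrite (le_trans ler01).
by rewrite /frame_size maxr_pMr// !normrM !(ger0_norm (pi_ge0 R)) !(ger0_norm (ler0n R 2)).
Qed.

Let ab : a <= b. Proof. by case/andP: t0ab; exact: le_trans. Qed.

Let small_frame_bound s s' (A g : R -> R) (K : R) : a <= s -> s <= s' -> s' <= b ->
  derives s s' A (fun t => cos (g t)) -> b - a <= K ->
  `|A s' - A s| <= K / 1.
Proof.
move=> as_ ss' sb dA Kab; rewrite divr1.
apply: (le_trans (cos_antideriv_le ss' dA)); apply: le_trans Kab.
by rewrite lerB.
Qed.

Let cgam s s' w : a <= s -> s' <= b ->
  {within `[s, s'], continuous (fun t => dotv w (gamma t))}.
Proof.
move=> as_ sb; apply: (@derives_continuous _ _ _ _ (fun t => dotv w (G1 t))).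
exact: (derives_sub as_ sb (derives_dotv w dg)).
Qed.

Let N' := nu^-1 *: N.

Let dotN' w : dotv N' w = nu^-1 * dotv N w.
Proof. by rewrite /N' !dotvE !mxE; ring. Qed.

Let frame_phase' k t c :
  2 * pi * dotv k (gamma t) + c =
  2 * pi * dotv k T * dotv T (gamma t) + 2 * pi * dotv k N * dotv N' (gamma t)
  + 2 * pi * dotv k B / nu * dotv B (gamma t) + c.
Proof. by rewrite dotN' -frame_phase. Qed.

Let N'T : dotv N' (G1 t0) = 0. Proof. by rewrite dotN' dotvC TN mulr0. Qed.

Let N'N : dotv N' (G2 t0) = 1.
Proof. by rewrite dotN' mulVf// lt0r_neq0. Qed.

Lemma planar_arc_bound (d0 : R) : 0 < d0 ->
  (forall t, a <= t <= b -> `|t - t0| <= d0 -> dotv B (G3 t) = 0) ->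
  exists2 d, 0 < d & forall s s', a <= s -> s <= s' -> s' <= b ->
    t0 - d <= s -> s' <= t0 + d -> arc_bound gamma s s' (1 / 2).
Proof.
move=> d00 f30.
have [d [C [d_0 C0 H]]] := planar_local_bound t0ab
  (derives_dotv T dg) (derives_dotv T dg1) (derives_dotv T dg2)
  (derives_dotv N' dg) (derives_dotv N' dg1) (derives_dotv N' dg2)
  (derives_dotv B dg) (derives_dotv B dg1) (derives_dotv B dg2)
  (within_continuous_dotv (w := T) cg3) (within_continuous_dotv (w := N') cg3)
  TT TN N'T N'N (dotv_crossl T N) (dotv_crossr T N) d00 f30.
exists d => // s s' as_ ss' sb ts st.
have K0 : 0 <= b - a + C by rewrite addr_ge0 ?subr_ge0// ltW.
rewrite -[1 / 2]addr0.
apply: (frame_arc_bound (T := T) (N := N) (K := b - a + C)) => //.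
  by move=> w; exact: cgam.
move=> lambda l1 x y xl yl c A dA; rewrite powRr0 mulr1.
set rho := frame_size _ _ _.
have rho0 : 0 <= rho by rewrite /rho le_max normr_ge0.
have [r1|r1] := leP (Num.sqrt rho) 1.
  by apply: (small_frame_bound as_ ss' sb dA) => //; rewrite lerDl ltW.
have rho1 : 1 <= rho by rewrite -(sqr_sqrtr rho0) expr_ge1// ltW.
have rho' : rho <= 2 * pi * rho by rewrite ler_peMl ?pi1.
have q0 : 0 <= 2 * pi * rho by apply: le_trans rho'.
have := H s s' as_ ss' sb ts st (2 * pi * dotv (intv R x - intv R y) T)
  (2 * pi * dotv (intv R x - intv R y) N)
  (2 * pi * dotv (intv R x - intv R y) B / nu) c (Num.sqrt (2 * pi * rho)) A.
rewrite max_frame sqr_sqrtr// -[X in X <= _ -> _]sqrtr1 ler_wsqrtr ?(le_trans rho1)//.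
move=> /(_ isT erefl) HA.
apply: le_trans (HA _) _.
  by apply: derives_eq dA => t _; rewrite frame_phase'.
apply: ler_pM; rewrite ?invr_ge0 ?sqrtr_ge0 ?(ltW C0)//.
  by rewrite lerDr subr_ge0.
rewrite lef_pV2 ?posrE ?sqrtr_gt0 ?(lt_le_trans ltr01 rho1)//.
  by rewrite ler_wsqrtr.
by rewrite (lt_le_trans _ rho')// (lt_le_trans ltr01).
Qed.

(** The local estimate decays like rho^(-1/3) with mu^3 = 2 pi rho. Differences of points on the
    sphere have rho <= D lambda, which converts it into (D lambda)^(1/6) rho^(-1/2). For rho <= 1
    the length of the arc is bound enough. *)
Lemma twisted_arc_bound (d0 c0 C0 : R) m : 0 < d0 -> 0 < c0 -> 0 < C0 ->
  (forall t, a <= t <= b -> `|t - t0| <= d0 ->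
     c0 * `|t - t0| ^+ m <= `|dotv B (G3 t)| <= C0 * `|t - t0| ^+ m) ->
  exists2 d, 0 < d & forall s s', a <= s -> s <= s' -> s' <= b ->
    t0 - d <= s -> s' <= t0 + d -> arc_bound gamma s s' (2 / 3).
Proof.
move=> d00 c00 C00 f3w.
have [d [C [d_0 Cpos H]]] := twisted_local_bound t0ab
  (derives_dotv T dg) (derives_dotv T dg1) (derives_dotv T dg2)
  (derives_dotv N' dg) (derives_dotv N' dg1) (derives_dotv N' dg2)
  (derives_dotv B dg) (derives_dotv B dg1) (derives_dotv B dg2)
  (within_continuous_dotv (w := T) cg3) (within_continuous_dotv (w := N') cg3)
  (within_continuous_dotv (w := B) cg3)
  TT TN N'T N'N (dotv_crossl T N) (dotv_crossr T N) d00 c00 C00 f3w.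
exists d => // s s' as_ ss' sb ts st.
pose D := 2 * (1 + nu).
have D1 : 1 <= D by move: (ltW N0); rewrite /D -/nu; move: nu => n; lra.
have D0 : 0 < D by exact: lt_le_trans D1.
pose K := (b - a) + C * D `^ 6^-1.
have CD0 : 0 <= C * D `^ 6^-1 by rewrite mulr_ge0 ?powR_ge0 ?ltW.
have K0 : 0 <= K by rewrite addr_ge0 ?subr_ge0.
rewrite (_ : 2 / 3 = 1 / 2 + 6^-1); last by field.
apply: (frame_arc_bound (T := T) (N := N) (K := K)) => //.
  by move=> w; exact: cgam.
move=> lambda l1 x y xl yl c A dA.
have l0 : 0 < lambda by exact: lt_trans l1.
set rho := frame_size _ _ _.
have rho0 : 0 <= rho by rewrite /rho le_max normr_ge0.
have l61 : 1 <= lambda `^ 6^-1 by rewrite -[leLHS](powRr0 lambda) ler_powR ?(ltW l1) ?invr_ge0.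
have [r1|r1] := leP (Num.sqrt rho) 1.
  apply: (small_frame_bound as_ ss' sb dA) => //.
  apply: (@le_trans _ _ K); first by rewrite lerDl.
  by rewrite ler_peMr.
have rho1 : 1 <= rho by rewrite -(sqr_sqrtr rho0) expr_ge1// ltW.
have rhopos : 0 < rho by exact: lt_le_trans rho1.
have rho' : rho <= 2 * pi * rho by rewrite ler_peMl ?pi1.
have q0 : 0 <= 2 * pi * rho by apply: le_trans rho'.
pose mu := (2 * pi * rho) `^ 3^-1.
have mu3 : mu ^+ 3 = 2 * pi * rho.
  by rewrite -powR_mulrn ?powR_ge0// -powRrM mulVf// powRr1.
have mu1 : 1 <= mu by rewrite -[leLHS](powRr0 (2 * pi * rho)) ler_powR ?invr_ge0// (le_trans rho1).
have mu0 : 0 < mu by exact: lt_le_trans mu1.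
have HA := H s s' as_ ss' sb ts st (2 * pi * dotv (intv R x - intv R y) T)
  (2 * pi * dotv (intv R x - intv R y) N)
  (2 * pi * dotv (intv R x - intv R y) B / nu) c mu A mu1.
rewrite max_frame mu3 in HA.
apply: le_trans (HA erefl _) _.
  by apply: derives_eq dA => t _; rewrite frame_phase'.
rewrite ler_pdivrMr// mulrAC ler_pdivlMr; last by rewrite sqrtr_gt0.
(* rho^(1/2) = rho^(1/6) rho^(1/3), with rho <= D lambda in the first factor and rho <= mu^3 in the
   second. *)
have key : Num.sqrt rho <= D `^ 6^-1 * lambda `^ 6^-1 * mu.
  rewrite -powRM ?(ltW D0) ?(ltW l0)// -(powR12_sqrt rho0).
  rewrite (_ : 2^-1 = 6^-1 + 3^-1 :> R); last by field.
  rewrite powRD ?(gt_eqF rhopos) ?implybT//.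
  apply: ler_pM; rewrite ?powR_ge0//; apply: ge0_ler_powR; rewrite ?nnegrE ?invr_ge0//.
    by rewrite mulr_ge0 ?(ltW D0) ?(ltW l0).
  exact: (frame_size_le TT TN N0 xl yl).
apply: (@le_trans _ _ (C * (D `^ 6^-1 * lambda `^ 6^-1 * mu))).
  by rewrite ler_pM2l.
rewrite !mulrA ler_pM2r// ler_wpM2r ?powR_ge0// /K lerDr subr_ge0//.
Qed.

End CurveBounds.

(** * Geodesic segments *)

Section Geodesics.
Variable R : realType.

Lemma dotv_le_unit (w v : 'rV[R]_3) (M : R) : dotv v v = 1 ->
  (forall j, `|w 0 j| <= M) -> `|dotv w v| <= 3 * M.
Proof.
move=> vv wM; rewrite /dotv; apply: (le_trans (ler_norm_sum _ _ _)).
apply: (@le_trans _ _ (\sum_(j < 3) M)); last by rewrite sumr_const card_ord mulr_natl.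
apply: ler_sum => j _; rewrite normrM -[M]mulr1 ler_pM//.
by rewrite (le_trans (coord_le_norm v j))// /enorm vv sqrtr1.
Qed.

Lemma slab_sum (v : 'rV[R]_3) (eps : R) : dotv v v = 1 -> 0 < eps ->
  exists2 C : R, 0 < C & forall lambda, 1 < lambda ->
  forall x, lattice_sphere lambda x ->
  \sum_(y <- sphere_seq lambda)
    (Num.max 1 `|dotv (intv R x - intv R y) v|)^-1 <= C * lambda `^ (2 / 3 + eps).
Proof.
move=> vv eps0; have e2 : 0 < eps / 2 by rewrite divr_gt0.
have [C C0 HC] := slab_count vv e2.
have [D D0 HD] := @sum_inv_powR_le R (eps / 2) 6 e2 ltac:(lra).
exists (D * C); first exact: mulr_gt0.
move=> lambda l1 x xl.
have l0 : 0 < lambda by lra.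
apply: (le_trans (HD lambda l1 _ _ _ (C * (lambda `^ (2 / 3) * lambda `^ (eps / 2))) _ _)).
- move=> y /mem_sphere_seq yl.
  rewrite (_ : 6 * lambda = 3 * (2 * lambda)); last by ring.
  apply: dotv_le_unit => // j; rewrite !mxE; apply: (le_trans (ler_normB _ _)).
  by have := sphere_coord j xl; have := sphere_coord j yl; lra.
- move=> j j0; apply: (HC lambda l1 x xl).
  + by rewrite ler1n.
  + by rewrite filter_uniq// sphere_seq_uniq.
  + by move=> y; rewrite mem_filter => /andP[yj /mem_sphere_seq yl]; split=> //; exact: ltW.
- have -> : lambda `^ (2 / 3 + eps) = lambda `^ (2 / 3) * lambda `^ (eps / 2) * lambda `^ (eps / 2).
    rewrite -!powRD ?(gt_eqF l0) ?implybT//.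
    by congr powR; field.
  by rewrite le_eqVlt; apply/orP; left; apply/eqP; ring.
Qed.

(** The phase is affine in t with slope 2 pi k.v, so its second derivative is 0 and the
    first-derivative test applies. The constant K adds the length b - a, used for |k.v| <= 1, to the
    4 of that test. *)
Lemma geodesic_arc_bound (a b : R) (gamma : R -> 'rV[R]_3) : a < b ->
  geodesic_segment gamma a b -> arc_bound gamma a b (2 / 3).
Proof.
move=> ab [p [v [v1 gE]]].
have vv : dotv v v = 1 by rewrite -enorm_sqr v1 expr1n.
apply: arc_bound_schur; first exact: ltW.
move=> eps eps0; have [C C0 HC] := slab_sum vv eps0.
pose K := (b - a) + 4.
have K0 : 0 <= K by rewrite /K; lra.
exists (K * C); first by rewrite mulr_ge0// ltW.
move=> lambda l1.
exists (fun x y => K * (Num.max 1 `|dotv (intv R x - intv R y) v|)^-1); split.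
- move=> x y xl yl c; set k := intv R x - intv R y.
  set w := 2 * pi * dotv k v.
  have e t : a <= t <= b ->
      2 * pi * dotv (intv R x) (gamma t) - 2 * pi * dotv (intv R y) (gamma t) + c
      = w * t + (2 * pi * dotv k p + c).
    move=> tab; rewrite gE; last by rewrite in_itv.
    rewrite /w /k !dotvBl !dotvE !mxE; ring.
  have dphi : derives a b (fun t => w * t + (2 * pi * dotv k p + c)) (fun=> w).
    apply: derives_eq (derivesD (derivesZ w (@derives_id _ a b)) (derives_cst _)) => t _.
    by rewrite mulr1 addr0.
  have [A dA hA] : integral_bound a b (fun t => cos (w * t + (2 * pi * dotv k p + c)))
      (K * (Num.max 1 `|dotv k v|)^-1).
    apply: cos_integral_bound; [exact: ltW | exact: derives_continuous dphi |].
    move=> A dA; have [kv|kv] := leP `|dotv k v| 1.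
      rewrite invr1 mulr1; apply: (le_trans (cos_antideriv_le (ltW ab) dA)).
      by rewrite /K lerDl.
    have kv0 : 0 < `|dotv k v| by lra.
    have p2 := pi_ge2 R.
    have w0 : `|dotv k v| <= `|w|.
      rewrite /w normrM ger0_norm ?mulr_ge0 ?pi_ge0// ler_peMl//; lra.
    apply: (le_trans (van_der_corput1 kv0 (ltW ab) dphi (derives_cst w) dA _ _)) => //.
    by rewrite ler_pM2r ?invr_gt0// /K lerDr subr_ge0 ltW.
  by exists A => //; apply: derives_eq dA => t /e ->.
- move=> x y; congr (_ * (Num.max 1 _)^-1).
  by rewrite !dotvBl distrC.
- move=> x xl; rewrite -mulr_sumr -mulrA ler_wpM2l//; exact: HC.
Qed.

End Geodesics.

(** * Parseval's identity on the torus *)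

Lemma tonelli_setX d1 d2 (T1 : measurableType d1) (T2 : measurableType d2)
    (R : realType) (m1 : {sigma_finite_measure set T1 -> \bar R})
    (m2 : {sigma_finite_measure set T2 -> \bar R}) (A : set T1) (B : set T2)
    (f : T1 * T2 -> R) : measurable A -> measurable B ->
  measurable_fun setT f -> (forall z, 0 <= f z) ->
  (\int[m1 \x m2]_(z in A `*` B) (f z)%:E =
   \int[m1]_(x in A) \int[m2]_(y in B) (f (x, y))%:E)%E.
Proof.
move=> mA mB mf f0.
rewrite integral_mkcond fubini_tonelli1; last 2 first.
- have mAB : measurable (A `*` B) by exact: measurableX.
  apply/(measurable_restrictT _ mAB).
  by apply/measurable_EFinP; exact: measurable_funTS.
- by move=> z; rewrite patchE; case: ifP => // _; rewrite lee_fin.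
rewrite [RHS]integral_mkcond; apply: eq_integral => x _.
rewrite /fubini_F [RHS]patchE; case: ifPn => xA.
  rewrite [RHS]integral_mkcond; apply: eq_integral => y _ /=.
  rewrite !patchE; congr (if _ then _ else _).
  move: xA; rewrite inE => xA.
  by apply/idP/idP; rewrite !inE /=; [case | split].
apply: integral0_eq => y _; rewrite patchE; case: ifPn => //.
by rewrite inE /= => -[xA' _]; rewrite notin_setE in xA.
Qed.

Section CubeIntegral.
Variable R : realType.
Local Notation mu := (@lebesgue_measure R).
Local Notation RR := (measurableTypeR R).

Lemma measurable_from_lebesgue : @measurable_fun _ _ RR R setT id.
Proof. by move=> _ Y mY; rewrite setTI. Qed.

(** The identity between products formed with two measurable structures on the reals; the integral
    over the cube is transported along it as a push-forward. *)
Let phi : RR * RR * RR -> R * R * R := id.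

Lemma measurable_phi : measurable_fun setT phi.
Proof.
have m1 : @measurable_fun _ _ (RR * RR * RR)%type R setT (fun z => z.2).
  exact: (measurableT_comp measurable_from_lebesgue (measurable_snd)).
have m2 : @measurable_fun _ _ (RR * RR * RR)%type R setT (fun z => z.1.2).
  apply: (measurableT_comp measurable_from_lebesgue).
  exact: (measurableT_comp measurable_snd measurable_fst).
have m3 : @measurable_fun _ _ (RR * RR * RR)%type R setT (fun z => z.1.1).
  apply: (measurableT_comp measurable_from_lebesgue).
  exact: (measurableT_comp measurable_fst measurable_fst).
have -> : phi = (fun z => (z.1.1, z.1.2, z.2)) by apply/funext => -[[]].
by apply: measurable_fun_pair => //; apply: measurable_fun_pair.
Qed.

(* Measure.on only: for product measures the library's canonical sigma-finite
   structure is the one of subprobabilities. *)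
Definition plane_measure : set (RR * RR)%type -> \bar R := (mu \x mu)%E.

HB.instance Definition _ := Measure.on plane_measure.

Let plane_sigma_finite : sigma_finite setT plane_measure.
Proof.
have /sigma_finiteP[F [TF ndF Foo]] := sigma_finiteT mu.
exists (fun n => F n `*` F n).
  apply/seteqP; split=> // -[x y] _.
  have : setT x by []; have : setT y by [].
  rewrite TF => -[n _ Fy] [m _ Fx]; exists (maxn n m) => //; split.
    by move: Fx; apply/subsetPset/ndF/leq_maxr.
  by move: Fy; apply/subsetPset/ndF/leq_maxl.
move=> n; have [mF Fn] := Foo n; split; first exact: measurableX.
by rewrite /plane_measure product_measure1E// lte_mul_pinfty// ge0_fin_numE.
Qed.

HB.instance Definition _ := Measure_isSigmaFinite.Build _ _ _ plane_measure
  plane_sigma_finite.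

Lemma tonelli_cube (f3 : R * R * R -> R) (f2 : R * R -> R) (f1 : R -> R) :
  measurable_fun setT f3 -> @measurable_fun _ _ (RR * RR)%type R setT f2 ->
  (forall z, 0 <= f3 z) ->
  (forall z, \int[mu]_(y in `[0%R, 1%R]) (f3 (z, y))%:E = (f2 z)%:E)%E ->
  (forall x, \int[mu]_(y in `[0%R, 1%R]) (f2 (x, y))%:E = (f1 x)%:E)%E ->
  (\int[@lebesgue_measure3 R]_(z in @unit_cube R) (f3 z)%:E =
   \int[mu]_(x in `[0%R, 1%R]) (f1 x)%:E)%E.
Proof.
move=> mf mf2 f0 I3 I2.
have mI : measurable (`[0%R, 1%R] : set R) by [].
have mcube : measurable (@unit_cube R) by apply: measurableX => //; exact: measurableX.
have mg : measurable_fun setT (f3 \o phi) by apply: measurableT_comp => //; exact: measurable_phi.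
transitivity (\int[((mu \x mu) \x mu)%E]_(z in phi @^-1` @unit_cube R) ((EFin \o f3) \o phi) z)%E.
  have := @ge0_integral_pushforward _ _ _ _ R phi measurable_phi ((mu \x mu) \x mu)%E (@unit_cube R) (EFin \o f3) mcube.
  move=> <- //.
  + by apply/measurable_EFinP; exact: measurable_funTS.
  + by move=> z _; rewrite lee_fin.
have mIr : measurable (`[0%R, 1%R] : set RR) by [].
have T := @tonelli_setX _ _ (RR * RR)%type RR R plane_measure mu _ _ (f3 \o phi) (measurableX mIr mIr) mIr mg (fun z => f0 _).
etransitivity; first exact: T.
under eq_integral do rewrite I3.
have f20 z : 0 <= f2 z.
  by rewrite -lee_fin -I3; apply: integral_ge0 => y _; rewrite lee_fin.
have T2 := @tonelli_setX _ _ RR RR R mu mu _ _ f2 mIr mIr mf2 f20.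
etransitivity; first exact: T2.
by apply: eq_integral => x _; exact: I2.
Qed.
End CubeIntegral.

Section Parseval.
Variable R : realType.

Lemma derives_sum (s s' : R) (I : Type) (P : seq I) (pr : pred I)
    (F f : I -> R -> R) : (forall p, derives s s' (F p) (f p)) ->
  derives s s' (fun x => \sum_(p <- P | pr p) F p x)
    (fun x => \sum_(p <- P | pr p) f p x).
Proof.
move=> dF; elim: P => [|p P IH].
  have -> : (fun x => \sum_(p <- [::] | pr p) F p x) = (fun=> 0).
    by apply/funext => x; rewrite big_nil.
  by apply: derives_eq (derives_cst 0) => x _; rewrite big_nil.
have -> : (fun x => \sum_(i <- p :: P | pr i) F i x) =
    (fun x => (if pr p then F p x else 0) + \sum_(i <- P | pr i) F i x).
  by apply/funext => x; rewrite big_cons; case: (pr p); rewrite ?add0r.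
case prp: (pr p).
  by apply: derives_eq (derivesD (dF p) IH) => x _; rewrite big_cons prp.
apply: derives_eq (derivesD (derives_cst 0) IH) => x _.
by rewrite big_cons prp add0r.
Qed.

Local Notation normc := ComplexField.Normc.normc.
Local Notation mu := (@lebesgue_measure R).

Lemma integral_derives (s s' : R) (F f : R -> R) : s < s' ->
  derives s s' F f -> {within `[s, s'], continuous f} ->
  (\int[mu]_(x in `[s, s']) (f x)%:E = (F s' - F s)%:E)%E.
Proof.
move=> ss' dF cf; rewrite (@continuous_FTC2 R f F)// ?EFinB//.
- have cF x : s <= x <= s' -> {for x, continuous F}.
    by move=> /dF h; apply: differentiable_continuous; apply/derivable1_diffP; case: h.
  split.
  + by move=> x; rewrite in_itv /= => /andP[/ltW sx /ltW xs]; have [] := dF x; rewrite ?sx.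
  + by apply: cvg_at_right_filter; apply: cF; rewrite lexx ltW.
  + by apply: cvg_at_left_filter; apply: cF; rewrite lexx ltW.
- move=> x; rewrite in_itv /= => /andP[/ltW sx /ltW xs].
  by rewrite derive1E; have [|_ ->] := dF x; rewrite ?sx.
Qed.

Lemma trig_pair_continuous (u w : R[i]) : continuous (trig_pair u w).
Proof.
move=> x; apply: cvgD; apply: cvgM; try exact: cvg_cst.
  exact: continuous_cos.
exact: continuous_sin.
Qed.

Lemma is_derive_trig_pair (u w : R[i]) (t : R) :
  is_derive t 1 (fun d => (complex.Re u * complex.Re w + complex.Im u * complex.Im w) * sin d -
     (complex.Re u * complex.Im w - complex.Im u * complex.Re w) * cos d) (trig_pair u w t).
Proof.
set A := _ + _; set B := complex.Re u * _ - _.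
have ds : derives t t (@sin R) (@cos R) by move=> x _; exact: is_derive_sin.
have dc : derives t t (@cos R) (fun x => - sin x) by move=> x _; exact: is_derive_cos.
have := derivesD (derivesZ A ds) (derivesN (derivesZ B dc)).
move=> /(_ t); rewrite lexx => /(_ isT) H.
by apply: is_derive_eq H _; rewrite /trig_pair -/A -/B mulrN opprK.
Qed.

Lemma periodic_int (f : R -> R) (k : int) (x : R) : periodic f (pi *+ 2) ->
  f (2 * pi * k%:~R + x) = f x.
Proof.
move=> pf; have pn (n : nat) y : f (2 * pi * n%:R + y) = f y.
  rewrite -(periodicn pf n y) addrC; congr (f (_ + _)).
  by rewrite -mulr_natr -[RHS]mulr_natr -mulr_natr; ring.
case: k => n; first exact: pn.
rewrite NegzE rmorphN /= -(pn n.+1); congr f.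
by rewrite addrA mulrN -[n.+1%:~R]/(n.+1%:R) subrr add0r.
Qed.

(** Integration in one variable kills the terms of nonzero frequency by periodicity. The survivors
    are recorded as a stronger index predicate, so the lemma can be applied to its own output, once
    for each variable. *)
Lemma integral_trig_sum (I : eqType) (P : seq I) (pr : pred I) (u w : I -> R[i])
    (k : I -> int) (d : I -> R) :
  (\int[mu]_(x in `[0%R, 1%R])
     (\sum_(p <- P | pr p) trig_pair (u p) (w p) (2 * pi * (k p)%:~R * x + d p))%:E =
   (\sum_(p <- P | pr p && (k p == 0)) trig_pair (u p) (w p) (d p))%:E)%E.
Proof.
pose V p (y : R) :=
  (complex.Re (u p) * complex.Re (w p) + complex.Im (u p) * complex.Im (w p)) * sin y -
  (complex.Re (u p) * complex.Im (w p) - complex.Im (u p) * complex.Re (w p)) * cos y.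
(* A term of frequency zero is constant in x and has a linear antiderivative; the others have a
   periodic one. *)
pose F p (x : R) := if k p == 0 then trig_pair (u p) (w p) (d p) * x
  else (2 * pi * (k p)%:~R)^-1 * V p (2 * pi * (k p)%:~R * x + d p).
have dlin p : derives 0 1 (fun x => 2 * pi * (k p)%:~R * x + d p)
    (fun=> 2 * pi * (k p)%:~R).
  apply: derives_eq (derivesD (derivesZ _ (@derives_id _ 0 1)) (derives_cst (d p))) => t _.
  by rewrite mulr1 addr0.
have dF p : derives 0 1 (F p)
    (fun x => trig_pair (u p) (w p) (2 * pi * (k p)%:~R * x + d p)).
  rewrite /F; case: eqP => [k0|/eqP k0].
    apply: derives_eq (derivesZ _ (@derives_id _ 0 1)) => t _.
    by rewrite k0 mulr0 mul0r add0r mulr1.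
  have k1 : 2 * pi * (k p)%:~R != 0 :> R.
    by rewrite !mulf_neq0 ?intr_eq0// gt_eqF ?pi_gt0.
  apply: derives_eq (derivesZ _ (derives_comp (dlin p)
    (is_derive_trig_pair (u p) (w p)))) => t _.
  by rewrite mulrCA mulVf// mulr1.
have dS : derives 0 1 (fun x => \sum_(p <- P | pr p) F p x)
  (fun x => \sum_(p <- P | pr p) trig_pair (u p) (w p) (2 * pi * (k p)%:~R * x + d p)).
  exact: derives_sum dF.
rewrite (integral_derives ltr01 dS); last first.
  apply: continuous_subspaceT => x; apply: cvg_big => [|p _]; first exact: add_continuous.
  apply: (@continuous_comp _ _ _ (fun x => 2 * pi * (k p)%:~R * x + d p)
    (trig_pair (u p) (w p))); last exact: trig_pair_continuous.
  apply: cvgD; last exact: cvg_cst.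
  by apply: cvgM; [exact: cvg_cst | exact: cvg_id].
congr EFin; rewrite -sumrB big_mkcondr /=; apply: eq_bigr => p _.
rewrite /F; case: eqP => [_|/eqP k0]; first by rewrite mulr1 mulr0 subr0.
rewrite mulr1 mulr0 add0r /V !periodic_int ?subrr//; [exact: cosD2pi | exact: sinD2pi].
Qed.

Lemma dotv_vec3 (x : 'rV[R]_3) (z : R * R * R) : dotv x (vec3 z) =
  x 0 ord0 * z.1.1 + x 0 (lift ord0 ord0) * z.1.2 +
  x 0 (lift ord0 (lift ord0 ord0)) * z.2.
Proof. by rewrite dotvE !mxE. Qed.

Lemma measurable_trig_sum d (T : measurableType d) (I : eqType) (P : seq I)
    (pr : pred I) (u w : I -> R[i]) (h : I -> T -> R) :
  (forall p, measurable_fun setT (h p)) ->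
  measurable_fun setT (fun z => \sum_(p <- P | pr p) trig_pair (u p) (w p) (h p z)).
Proof.
move=> mh; rewrite (_ : (fun z => _) = (fun z => \sum_(p <- P)
  (if pr p then trig_pair (u p) (w p) (h p z) else 0))); last first.
  by apply/funext => z; rewrite big_mkcond.
apply: measurable_sum => p; case: (pr p); last exact: measurable_cst.
apply: measurableT_comp; last exact: mh.
by apply: continuous_measurable_fun; exact: trig_pair_continuous.
Qed.

Lemma measurable_lin d (T : measurableType d) (c : R) (g1 g2 : T -> R) :
  measurable_fun setT g1 -> measurable_fun setT g2 ->
  measurable_fun setT (fun z => c * g1 z + g2 z).
Proof.
by move=> mg1 mg2; apply: measurable_funD => //; apply: measurable_funM.
Qed.

Lemma integral_torus_wave lambda (a : 'rV[int]_3 -> R[i]) :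
  (\int[@lebesgue_measure3 R]_(z in @unit_cube R)
     (normc (wave lambda a (vec3 z)) ^+ 2)%:E = (coeff_sqnorm lambda a)%:E)%E.
Proof.
pose S := sphere_seq lambda.
pose P := [seq (x, y) | x <- S, y <- S].
pose u (p : 'rV[int]_3 * 'rV[int]_3) := a p.1.
pose w (p : 'rV[int]_3 * 'rV[int]_3) := a p.2.
pose k j (p : 'rV[int]_3 * 'rV[int]_3) := p.1 0 j - p.2 0 j.
pose j0 : 'I_3 := ord0; pose j1 : 'I_3 := lift ord0 ord0.
pose j2 : 'I_3 := lift ord0 (lift ord0 ord0).
pose h1 (x : R) p := 2 * pi * (k j0 p)%:~R * x + 0.
pose h2 (z : R * R) p := 2 * pi * (k j1 p)%:~R * z.2 + h1 z.1 p.
pose h3 (z : R * R * R) p := 2 * pi * (k j2 p)%:~R * z.2 + h2 z.1 p.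
pose f3 z := \sum_(p <- P | true) trig_pair (u p) (w p) (h3 z p).
pose f2 z := \sum_(p <- P | true && (k j2 p == 0)) trig_pair (u p) (w p) (h2 z p).
pose f1 x := \sum_(p <- P | (true && (k j2 p == 0)) && (k j1 p == 0))
  trig_pair (u p) (w p) (h1 x p).
have fE z : normc (wave lambda a (vec3 z)) ^+ 2 = f3 z.
  rewrite normc_trig_sum /f3 /P big_allpairs_dep /=; apply: eq_bigr => x _.
  apply: eq_bigr => y _; congr trig_pair.
  by rewrite !dotv_vec3 /h3 /h2 /h1 /k !mxE !rmorphB /=; ring.
have f3_ge0 z : 0 <= f3 z by rewrite -fE sqr_ge0.
have I3 z : (\int[mu]_(y in `[0%R, 1%R]) (f3 (z, y))%:E = (f2 z)%:E)%E.
  exact: (integral_trig_sum P xpredT u w (k j2) (h2 z)).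
have f2_ge0 z : 0 <= f2 z.
  by rewrite -lee_fin -I3; apply: integral_ge0 => y _; rewrite lee_fin.
have I2 x : (\int[mu]_(y in `[0%R, 1%R]) (f2 (x, y))%:E = (f1 x)%:E)%E.
  exact: (integral_trig_sum P (fun p => true && (k j2 p == 0)) u w (k j1) (h1 x)).
have I1 : (\int[mu]_(y in `[0%R, 1%R]) (f1 y)%:E =
  (\sum_(p <- P | ((true && (k j2 p == 0)) && (k j1 p == 0)) && (k j0 p == 0))
     trig_pair (u p) (w p) 0)%:E)%E.
  exact: (integral_trig_sum P (fun p => (true && (k j2 p == 0)) && (k j1 p == 0))
    u w (k j0) (fun=> 0)).
rewrite (_ : (fun z => _) = (fun z => (f3 z)%:E)); last first.
  by apply/funext => z; rewrite fE.
have mh3 p : measurable_fun setT (h3 ^~ p).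
  apply: (@measurable_lin _ (R * R * R)%type _ (fun z : R * R * R => z.2) (fun z => h2 z.1 p)).
    exact: measurable_snd.
  apply: (@measurable_lin _ (R * R * R)%type _ (fun z : R * R * R => z.1.2) (fun z => h1 z.1.1 p)).
    exact: (measurableT_comp measurable_snd measurable_fst).
  apply: (@measurable_lin _ (R * R * R)%type _ (fun z : R * R * R => z.1.1) (fun=> 0)).
    exact: (measurableT_comp measurable_fst measurable_fst).
  exact: measurable_cst.
have mh2 p : @measurable_fun _ _ (measurableTypeR R * measurableTypeR R)%type R setT (h2 ^~ p).
  apply: (@measurable_lin _ (measurableTypeR R * measurableTypeR R)%type _ (fun z => z.2) (fun z => h1 z.1 p)).
    exact: (measurableT_comp (@measurable_from_lebesgue R) measurable_snd).
  apply: (@measurable_lin _ (measurableTypeR R * measurableTypeR R)%type _ (fun z => z.1) (fun=> 0)).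
    exact: (measurableT_comp (@measurable_from_lebesgue R) measurable_fst).
  exact: measurable_cst.
rewrite (@tonelli_cube R f3 f2 f1) ?I1//; last 2 first.
- exact: measurable_trig_sum.
- exact: measurable_trig_sum.
congr EFin.
(* Only pairs with all three coordinate differences zero are left, that is, the diagonal. *)
rewrite big_mkcond /P big_allpairs_dep /=; apply: eq_big_seq => x xS.
rewrite (bigD1_seq x) ?sphere_seq_uniq//= [X in _ + X]big1 ?addr0.
  rewrite /k !subrr !eqxx /= /trig_pair cos0 sin0 mulr0 addr0 mulr1.
  by rewrite normc_sqr !expr2.
move=> y yx; case: ifP => // /andP[/andP[]].
rewrite /k /= !subr_eq0 => /eqP e2 /eqP e1 /eqP e0.
case/eqP: yx; apply/rowP => j.
have : j \in [:: j0; j1; j2] by case: j => [[|[|[|//]]] h]; rewrite !inE -!val_eqE.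
by rewrite !inE => /or3P[] /eqP ->.
Qed.

End Parseval.

(** * Power series *)

Section PowerSeries.
Variables (R : realType) (r : R).
Hypothesis r0 : 0 < r.
Implicit Types (f g : nat -> R) (x : R).

Definition psum f x : R := limn (pseries f x).

Definition pconv f := forall x, `|x| < r -> cvgn (pseries f x).

Lemma bernoulli_le (h : R) n : 0 <= h -> 1 + n%:R * h <= (1 + h) ^+ n.
Proof.
move=> h0; elim: n => [|n IH]; first by rewrite mul0r addr0.
rewrite exprS -natr1; have h1 : 0 <= 1 + h by lra.
apply: le_trans (ler_wpM2l h1 IH).
have : 0 <= n%:R * h ^+ 2 by rewrite mulr_ge0// sqr_ge0.
by move: (n%:R : R) => m; nra.
Qed.

(** At a point K with |x| < K < r the terms of the original series are bounded, so those of the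
    differentiated series are O((n + 1) (|x| / K)^n); Bernoulli's inequality absorbs n + 1 into a
    slightly larger ratio. *)
Lemma pconv_diffs f : pconv f -> pconv (pseries_diffs f).
Proof.
move=> cf x xr; pose K := (`|x| + r) / 2.
have x0 := normr_ge0 x.
have K0 : 0 < K by rewrite /K; lra.
have xK : `|x| < K by rewrite /K; lra.
have Kr : `|K| < r by rewrite gtr0_norm// /K; lra.
have [M [_ HM]] := cvg_series_bounded (cf K Kr).
pose M1 := `|M + 1|.
have fM n : `|f n| * K ^+ n <= M1.
  have -> : `|f n| * K ^+ n = `|f n * K ^+ n|.
    by rewrite normrM normrX (gtr0_norm K0).
  by apply: HM => //; rewrite (lt_le_trans _ (ler_norm _))// ltrDl.
pose q := `|x| / K.
have q0 : 0 <= q by rewrite divr_ge0// ltW.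
have q1 : q < 1 by rewrite ltr_pdivrMr// mul1r.
(* For this h the new ratio q (1 + h) is still below 1, since (1 - q)(2 - q) > 0. *)
pose h := (1 - q) / 2.
have h0 : 0 < h by rewrite /h; lra.
pose s := q * (1 + h).
have s0 : 0 <= s by rewrite /s mulr_ge0//; lra.
have s1 : s < 1 by rewrite /s /h; nra.
pose C := M1 / K * (1 + h^-1).
have C0 : 0 <= C.
  apply: mulr_ge0; first by rewrite /M1 divr_ge0// ltW.
  by rewrite addr_ge0// invr_ge0 ltW.
apply: normed_cvg.
apply: (@series_le_cvg _ _ (geometric C s)) => [n|n|n|] /=.
- exact: normr_ge0.
- by rewrite mulr_ge0// exprn_ge0.
- rewrite /pseries_diffs !normrM normrX (ger0_norm (ler0n _ _)).
  have xq : `|x| ^+ n = q ^+ n * K ^+ n by rewrite -exprMn divfK// gt_eqF.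
  have e1 : `|f n.+1| * K ^+ n <= M1 / K.
    by rewrite ler_pdivlMr// -mulrA -exprSr.
  have e2 : n.+1%:R <= (1 + h^-1) * (1 + h) ^+ n.
    apply: (@le_trans _ _ ((1 + h^-1) * (1 + n%:R * h))).
      rewrite -natr1 (_ : (1 + h^-1) * _ = 1 + n%:R * h + h^-1 + n%:R); last first.
        by field; rewrite gt_eqF.
      have : 0 <= n%:R * h by rewrite mulr_ge0// ltW.
      have : 0 < h^-1 by rewrite invr_gt0.
      by lra.
    by rewrite ler_wpM2l ?addr_ge0 ?invr_ge0 ?(ltW h0)// bernoulli_le// ltW.
  apply: (@le_trans _ _ ((`|f n.+1| * K ^+ n) * n.+1%:R * q ^+ n)).
    by rewrite xq le_eqVlt; apply/orP; left; apply/eqP; ring.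
  apply: (@le_trans _ _ (M1 / K * ((1 + h^-1) * (1 + h) ^+ n) * q ^+ n)); last first.
    by rewrite /C /s (exprMn n q (1 + h)) le_eqVlt; apply/orP; left; apply/eqP; ring.
  by rewrite ler_wpM2r ?exprn_ge0// ler_pM// mulr_ge0// exprn_ge0// ltW.
- by apply: is_cvg_geometric_series; rewrite ger0_norm.
Qed.

Lemma is_derive_psum f x : pconv f -> `|x| < r ->
  is_derive x 1 (psum f) (psum (pseries_diffs f) x).
Proof.
move=> cf xr; pose K := (`|x| + r) / 2.
have x0 := normr_ge0 x.
have K0 : 0 < K by rewrite /K; lra.
have Kr : `|K| < r by rewrite gtr0_norm// /K; lra.
apply: (@pseries_snd_diffs R f K x).
- exact: cf.
- by apply: pconv_diffs Kr.
- by do 2!apply: pconv_diffs => //.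
- by rewrite (gtr0_norm K0) /K; lra.
Qed.

Lemma pseriesS f x n :
  pseries f x n.+1 = f 0%N + x * pseries (fun k => f k.+1) x n.
Proof.
rewrite /pseries /series /= big_nat_recl//= expr0 mulr1 mulr_sumr.
by congr (_ + _); apply: eq_bigr => i _; rewrite exprS mulrCA.
Qed.

Lemma pconv_shift f : pconv f -> pconv (fun k => f k.+1).
Proof.
move=> cf; have main x : x != 0 -> `|x| < r -> cvgn (pseries (fun k => f k.+1) x).
  move=> x0 xr; have /cvg_ex[/= l fl] := cf x xr.
  apply/cvg_ex; exists (x^-1 * (l - f 0%N)).
  rewrite (_ : pseries _ x = (fun n => x^-1 * (pseries f x n.+1 - f 0%N))).
    apply: cvgM; first exact: cvg_cst.
    by apply: cvgB; [rewrite -cvg_shiftS in fl | exact: cvg_cst].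
  by apply/funext => n; rewrite pseriesS addrC addKr mulKf.
move=> x xr; have [x0|] := eqVneq x 0; last by move/main; apply.
have r2 : `|r / 2| < r by rewrite gtr0_norm; move: r0; lra.
apply: (is_cvg_pseries_inside (main (r / 2) _ r2)).
  by rewrite gt_eqF// divr_gt0.
by rewrite x0 normr0 normr_gt0 gt_eqF// divr_gt0.
Qed.

Lemma psumS f x : pconv f -> `|x| < r ->
  psum f x = f 0%N + x * psum (fun k => f k.+1) x.
Proof.
move=> cf xr; apply/cvg_lim => //.
rewrite -cvg_shiftS /= (_ : (fun n => _) = (fun n => f 0%N + x * pseries (fun k => f k.+1) x n)).
  apply: cvgD; first exact: cvg_cst.
  apply: cvgM; first exact: cvg_cst.
  exact: pconv_shift cf x xr.
by apply/funext => n; rewrite pseriesS.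
Qed.

(** Factoring out x shifts the coefficients and lowers the order by one. At order 0 the constant
    term is nonzero, and continuity at 0 gives both bounds. *)
Lemma psum_order f (m : nat) : pconv f -> f m != 0 ->
  (forall i, (i < m)%N -> f i = 0) ->
  exists d c C, [/\ 0 < d, 0 < c, 0 < C & forall x, `|x| <= d ->
    c * `|x| ^+ m <= `|psum f x| <= C * `|x| ^+ m].
Proof.
elim: m f => [|m IH] f cf fm lt_m.
  have ps0 : psum f 0 = f 0%N by rewrite psumS ?normr0// mul0r addr0.
  have f00 : 0 < `|f 0%N| by rewrite normr_gt0.
  have cont : {for 0, continuous (psum f)}.
    apply: differentiable_continuous; apply/derivable1_diffP.
    by have [] := is_derive_psum cf (_ : `|0| < r); rewrite ?normr0.
  have e0 : 0 < `|f 0%N| / 2 by rewrite divr_gt0.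
  move/cvgrPdist_le : cont => /(_ _ e0); rewrite ps0 => /nbhs_ballP[d /= d0 dP].
  exists (d / 2), (`|f 0%N| / 2), (2 * `|f 0%N|); split=> //.
  - by rewrite divr_gt0.
  - by rewrite mulr_gt0.
  move=> x xd; rewrite expr0 !mulr1.
  have : `|f 0%N - psum f x| <= `|f 0%N| / 2.
    by apply: dP; rewrite /ball /= sub0r normrN; lra.
  have := ler_normD (f 0%N - psum f x) (psum f x); rewrite subrK.
  have := ler_normB (f 0%N) (f 0%N - psum f x); rewrite opprB subrKC.
  by move=> ? ? ?; apply/andP; split; lra.
have [d [c [C [d0 c0 C0 H]]]] := IH _ (pconv_shift cf) fm (fun i im => lt_m i.+1 im).
exists (Num.min d (r / 2)), c, C; split=> //; first by rewrite lt_min d0 divr_gt0.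
move=> x; rewrite le_min => /andP[xd xr].
rewrite psumS//; last by move: r0 xr; lra.
rewrite lt_m// add0r normrM exprS.
have /andP[h1 h2] := H x xd.
rewrite mulrCA ler_wpM2l//= mulrCA ler_wpM2l//.
Qed.

Lemma psum_zero f x : (forall i, f i = 0) -> psum f x = 0.
Proof.
move=> f0; apply/cvg_lim => //.
rewrite (_ : pseries f x = (fun=> 0)); first exact: cvg_cst.
by apply/funext => n; rewrite /pseries /series /= big1// => i _; rewrite f0 mul0r.
Qed.

Lemma cvg_pseries_comb f g (k : nat -> R) (al be ka : R) x :
  pconv f -> pconv g -> pconv k -> `|x| < r ->
  pseries (fun n => al * f n + be * g n + ka * k n) x @ \oo -->
  al * psum f x + be * psum g x + ka * psum k x.
Proof.
move=> cf cg ck xr.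
rewrite (_ : pseries _ x = (fun n => al * pseries f x n + be * pseries g x n +
   ka * pseries k x n)); last first.
  apply/funext => n; rewrite /pseries /series /= !mulr_sumr -!big_split /=.
  by apply: eq_bigr => i _; ring.
apply: cvgD; first apply: cvgD.
- by apply: cvgM; [exact: cvg_cst | exact: cf].
- by apply: cvgM; [exact: cvg_cst | exact: cg].
- by apply: cvgM; [exact: cvg_cst | exact: ck].
Qed.

End PowerSeries.

(** * Curves *)

Section CurveDerivatives.
Variable R : realType.
Implicit Types (gamma : R -> 'rV[R]_3) (a b : R).

Lemma is_derive_coord gamma n t j : derivable (derive1n n gamma) t 1 ->
  is_derive t 1 (fun u => derive1n n gamma u 0 j) (derive1n n.+1 gamma t 0 j).
Proof.
move=> dt; rewrite derive1nS derive1E derive_mx// mxE.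
by apply/derivableP; move/derivable_mxP : dt; apply.
Qed.

Lemma smooth_derives gamma a b n : smooth_on gamma a b ->
  derives_vec a b (derive1n n gamma) (derive1n n.+1 gamma).
Proof.
move=> [U [oU abU dU]] j t tab; apply: is_derive_coord; apply: dU.
by apply: abU; rewrite /= in_itv.
Qed.

Section AnalyticAt.
Variables (gamma : R -> 'rV[R]_3) (t0 r : R) (c : nat -> 'rV[R]_3).
Hypothesis r0 : 0 < r.
Hypothesis Hc : forall t, `|t - t0| < r ->
  series (fun n => (t - t0) ^+ n *: c n) @ \oo --> gamma t.

Let f n (j : 'I_3) := iter n (@pseries_diffs R) (fun k => c k 0 j).

Let cvg_coord j t : `|t - t0| < r ->
  pseries (f 0 j) (t - t0) @ \oo --> gamma t 0 j.
Proof.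
move=> /Hc h; rewrite (_ : pseries _ _ =
    (fun M : 'rV[R]_3 => M 0 j) \o series (fun n => (t - t0) ^+ n *: c n)).
  by apply: continuous_cvg h; exact: coord_continuous.
apply/funext => n; rewrite /pseries /series /= summxE.
by apply: eq_bigr => i _; rewrite !mxE mulrC.
Qed.

Lemma pconv_coord n j : pconv r (f n j).
Proof.
elim: n => [|n IH]; last exact: pconv_diffs.
move=> x xr; have := @cvg_coord j (x + t0); rewrite addrK => /(_ xr) h.
exact: cvgP h.
Qed.

Let derivable_psum n t : (forall u, `|u - t0| < r -> forall j,
    derive1n n gamma u 0 j = psum (f n j) (u - t0)) -> `|t - t0| < r ->
  forall j, is_derive t 1 (fun u => derive1n n gamma u 0 j) (psum (f n.+1 j) (t - t0)).
Proof.
move=> IH tr j.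
have d1 : is_derive t 1 (fun u => psum (f n j) (u - t0)) (psum (f n.+1 j) (t - t0)).
  have dp := is_derive_psum (@pconv_coord n j) tr.
  have ds : is_derive t 1 (fun u : R => u - t0) 1 by exact: is_derive_shift.
  by have := @is_derive1_comp R (psum (f n j)) (fun u => u - t0) t _ _ dp ds; rewrite mulr1.
apply: near_eq_is_derive d1; apply/nbhs_ballP; exists (r - `|t - t0|) => /=.
  by rewrite subr_gt0.
move=> u; rewrite /ball /= => tu; rewrite IH//.
have := ler_distD t u t0; rewrite (distrC u t); move: tu.
by move: (`|t - u|) (`|u - t0|) (`|t - t0|) => x y z; lra.
Qed.

Lemma analytic_derive1n n t : `|t - t0| < r ->
  derivable (derive1n n gamma) t 1 /\
  forall j, derive1n n gamma t 0 j = psum (f n j) (t - t0).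
Proof.
have derP m u : (forall u, `|u - t0| < r -> forall j,
    derive1n m gamma u 0 j = psum (f m j) (u - t0)) -> `|u - t0| < r ->
    derivable (derive1n m gamma) u 1.
  move=> IH ur; apply/derivable_mxP => i j; rewrite (ord1 i).
  by have [] := derivable_psum IH ur j.
elim: n t => [|n IH] t tr.
  have e0 u : `|u - t0| < r -> forall j,
      derive1n 0 gamma u 0 j = psum (f 0 j) (u - t0).
    by move=> ur j; apply/esym/cvg_lim => //; exact: cvg_coord.
  by split; [exact: derP | exact: e0].
have e0 u : `|u - t0| < r -> forall j,
    derive1n n.+1 gamma u 0 j = psum (f n.+1 j) (u - t0).
  move=> ur j.
  have IH' v : `|v - t0| < r -> forall j,
    derive1n n gamma v 0 j = psum (f n j) (v - t0) by move=> /IH[].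
  have [_ <-] := derivable_psum IH' ur j.
  have [+ _] := IH u ur => /(is_derive_coord j)[_ <-].
  by [].
by split; [exact: derP | exact: e0].
Qed.

(** The dichotomy for analytic curves: the component has a power series about t0, which either has a
    first nonzero coefficient, of index m, or is identically zero. *)
Lemma analytic_dotv (w : 'rV[R]_3) n :
  exists2 d, 0 < d &
    (forall t, `|t - t0| <= d -> dotv w (derive1n n gamma t) = 0) \/
    exists m k K, [/\ 0 < k, 0 < K & forall t, `|t - t0| <= d ->
      k * `|t - t0| ^+ m <= `|dotv w (derive1n n gamma t)| <= K * `|t - t0| ^+ m].
Proof.
pose g i := w 0 ord0 * f n ord0 i + w 0 (lift ord0 ord0) * f n (lift ord0 ord0) i +
  w 0 (lift ord0 (lift ord0 ord0)) * f n (lift ord0 (lift ord0 ord0)) i.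
have cg : pconv r g.
  by move=> x xr; apply: cvgP; apply: cvg_pseries_comb xr; exact: pconv_coord.
have gE t : `|t - t0| < r -> dotv w (derive1n n gamma t) = psum g (t - t0).
  move=> tr; have [_ e] := analytic_derive1n n tr; rewrite dotvE !e.
  apply/esym/cvg_lim => //.
  by apply: cvg_pseries_comb tr; exact: pconv_coord.
have [ex|nex] := pselect (exists i, g i != 0).
  have [m gm mmin] := ex_minnP ex.
  have g0 i : (i < m)%N -> g i = 0.
    by move=> im; apply/eqP; apply: contraTT im => /mmin; rewrite -leqNgt.
  have [d [k [K [d0 k0 K0 H]]]] := psum_order r0 cg gm g0.
  exists (Num.min d (r / 2)); first by rewrite lt_min d0 divr_gt0.
  right; exists m, k, K; split=> // t; rewrite le_min => /andP[td tr].
  by rewrite gE; [exact: H | move: r0 tr; lra].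
exists (r / 2); first by rewrite divr_gt0.
left=> t tr; rewrite gE; last by move: r0 tr; lra.
apply: psum_zero => i; apply/eqP; apply: contrapT => /negP gi.
by apply: nex; exists i.
Qed.

End AnalyticAt.

(** An expansion at one point gives all derivatives throughout its ball of convergence, so the union
    of these balls is an open set on which the curve is smooth. *)
Lemma analytic_smooth gamma a b : analytic_on gamma a b -> smooth_on gamma a b.
Proof.
move=> ga; pose U := \bigcup_(p in [set p : R * R | 0 < p.2 /\
  exists c : nat -> 'rV[R]_3, forall t, `|t - p.1| < p.2 ->
    series (fun n => (t - p.1) ^+ n *: c n) @ \oo --> gamma t]) ball p.1 p.2.
exists U; split.
- by apply: bigcup_open => p _; exact: ball_open.
- move=> t /ga[r r0 [c Hc]]; exists (t, r); first by split=> //; exists c.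
  exact: ballxx.
- move=> n t [[t0 r] /= [r0 [c Hc]]]; rewrite /ball /= distrC => tr.
  by have [] := analytic_derive1n Hc n tr.
Qed.

End CurveDerivatives.

(** * The frame along a curve, and bounds on the whole segment *)

Section Frames.
Variable R : realType.
Implicit Types (gamma : R -> 'rV[R]_3) (a b : R).

(** The endpoints are included, and F is known only on [a, b]. If f t0 were nonzero, f t0 * f would
    stay above half of (f t0)^2 on a nondegenerate part of [a, b] near t0, and f t0 * F would
    increase there. *)
Lemma derives_const_zero (F f : R -> R) (k : R) a b : a < b -> derives a b F f ->
  {within `[a, b], continuous f} -> (forall t, a <= t <= b -> F t = k) ->
  forall t, a <= t <= b -> f t = 0.
Proof.
move=> ab dF cf Fk t0 t0ab; apply: contrapT => /eqP f0.
have n0 : 0 < `|f t0| / 2 by rewrite divr_gt0// normr_gt0.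
have [d d0 H] := within_continuous_near cf t0ab n0.
pose s := Num.max a (t0 - d); pose s' := Num.min b (t0 + d).
have [at0 t0b] := andP t0ab.
have ss' : s < s'.
  rewrite /s /s' gt_max !lt_min ab.
  by apply/andP; split; apply/andP; split; lra.
have as_ : a <= s by rewrite le_max lexx.
have sb : s' <= b by rewrite ge_min lexx.
have key t : s <= t <= s' -> f t0 ^+ 2 / 2 * 1 <= f t0 * f t.
  move=> /andP[st ts].
  have tab : a <= t <= b by rewrite (le_trans as_ st) (le_trans ts sb).
  have td : `|t - t0| <= d.
    move: st ts; rewrite /s /s' ge_max le_min ler_norml => /andP[_ h1] /andP[_ h2].
    by apply/andP; split; lra.
  have h := H t tab td.
  have : `|f t0 * (f t - f t0)| <= f t0 ^+ 2 / 2.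
    by rewrite normrM -[f t0 ^+ 2](real_normK (num_real (f t0))) expr2 -mulrA ler_wpM2l.
  by rewrite ler_norml => /andP[h1 _]; move: h1; rewrite mulrBr -expr2; lra.
have := derives_le (ltW ss') (derivesZ (f t0 ^+ 2 / 2) (@derives_id R s s'))
  (derivesZ (f t0) (derives_sub as_ sb dF)) key.
rewrite !Fk ?as_ ?sb ?(le_trans _ sb) ?(ltW ss')//; last by rewrite (le_trans as_ (ltW ss')).
rewrite subrr leNgt -mulrBr mulr_gt0 ?subr_gt0//.
by rewrite divr_gt0// exprn_even_gt0.
Qed.

Lemma derives_dotv2 a b (F G F' G' : R -> 'rV[R]_3) : derives_vec a b F F' ->
  derives_vec a b G G' -> derives a b (fun t => dotv (F t) (G t))
    (fun t => dotv (F t) (G' t) + dotv (F' t) (G t)).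
Proof.
move=> dF dG; rewrite (_ : (fun t => dotv (F t) (G t)) = (fun t =>
  F t 0 ord0 * G t 0 ord0 + F t 0 (lift ord0 ord0) * G t 0 (lift ord0 ord0) +
  F t 0 (lift ord0 (lift ord0 ord0)) * G t 0 (lift ord0 (lift ord0 ord0)))); last first.
  by apply/funext => t; rewrite dotvE.
apply: derives_eq (derivesD (derivesD (derivesM (dF _) (dG _)) (derivesM (dF _) (dG _)))
  (derivesM (dF _) (dG _))) => t _.
by rewrite !dotvE; ring.
Qed.

Lemma dotv_eq0 (v : 'rV[R]_3) : (dotv v v == 0) = (v == 0).
Proof.
apply/idP/eqP => [|->]; last by rewrite dotvE !mxE !mul0r !addr0.
rewrite psumr_eq0 => [/allP v0|i _]; last by rewrite -expr2 sqr_ge0.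
apply/rowP => j; have := v0 j (mem_index_enum j).
by rewrite mxE /= mulf_eq0 orbb => /eqP.
Qed.

(** Cramer's identity det(T, N, x) n = (n.x) T x N + (n.T) N x x + (n.N) x x T, paired with n. With
    n normal to the plane of a curve, it shows that the third derivative has no component along T x
    N. *)
Lemma cross_plane (n T N x : 'rV[R]_3) : n != 0 -> dotv n T = 0 -> dotv n N = 0 ->
  dotv n x = 0 -> dotv (cross T N) x = 0.
Proof.
move=> n0 nT nN nx.
have : dotv (cross T N) x * dotv n n = dotv n x * dotv (cross T N) n +
    dotv n T * dotv (cross N x) n + dotv n N * dotv (cross x T) n.
  rewrite !dotvE; have [-> -> ->] := crossE T N; have [-> -> ->] := crossE N x.
  by have [-> -> ->] := crossE x T; ring.
rewrite nT nN nx !mul0r !addr0 => /eqP; rewrite mulf_eq0 => /orP[/eqP//|].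
by rewrite dotv_eq0 (negbTE n0).
Qed.

Lemma plane_normal (P : set 'rV[R]_3) : affine_plane P ->
  exists n k, n != 0 /\ forall x, P x -> dotv n x = k.
Proof.
move=> [p [V [Vfree ->]]].
have /rowV0Pn[n /sub_kermxP nV n0] : kermx V^T != 0.
  rewrite -mxrank_eq0 mxrank_ker mxrank_tr; move: Vfree; rewrite /row_free => /eqP ->.
  by [].
exists n, (dotv n p); split=> // x [w _ <-].
have dotvM u v : dotv u v = (u *m v^T) 0 0.
  by rewrite !mxE; apply: eq_bigr => i _; rewrite mxE.
by rewrite !dotvM linearD /= trmx_mul mulmxDr mulmxA nV mul0mx addr0.
Qed.

Lemma det3E (M : 'M[R]_3) :
  \det M = dotv (cross (row 0 M) (row (inord 1) M)) (row (inord 2) M).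
Proof.
pose f (n m : nat) := M (inord n) (inord m).
have ME i j : M i j = f i j by rewrite /f !inord_val.
rewrite dotvE; have [-> -> ->] := crossE (row 0 M) (row (inord 1) M).
rewrite (expand_det_row _ ord0) !big_ord_recl big_ord0 /cofactor.
rewrite !(expand_det_row _ ord0) !big_ord_recl !big_ord0 /cofactor !det_mx11.
rewrite !mxE !ME !inordK//; move: f {ME} => f /=.
have -> : (0 + bump 0 0 = 1)%N by [].
have -> : (0 + bump 0 (bump 0 0) = 2)%N by [].
rewrite /bump /= !add0n !addn0 !expr0 expr1 sqrrN expr1n.
by ring.
Qed.

Lemma torsionE gamma t : \det (\matrix_(i < 3, j < 3) derive1n i.+1 gamma t 0 j) =
  dotv (cross (derive1n 1 gamma t) (derive1n 2 gamma t)) (derive1n 3 gamma t).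
Proof.
rewrite det3E; congr (dotv (cross _ _) _); apply/rowP => j; rewrite !mxE ?inordK//.
Qed.

Lemma norm_near_bounds (x y : R) : `|x - y| <= `|y| / 2 ->
  `|y| / 2 <= `|x| <= 2 * `|y|.
Proof.
have := ler_normD (x - y) y; rewrite subrK.
have := ler_normB x (x - y); rewrite opprB subrKC.
move: `|x - y| `|x| `|y| (normr_ge0 y) => p q w w0 h1 h2 h3.
by apply/andP; split; lra.
Qed.

Lemma arc_boundW gamma s s' (sigma tau : R) : sigma <= tau ->
  arc_bound gamma s s' sigma -> arc_bound gamma s s' tau.
Proof.
move=> st h eps eps0; have [C C0 HC] := h eps eps0; exists C => // lambda l1 a E dE.
apply: le_trans (HC lambda l1 a E dE) _.
rewrite ler_wpM2r ?coeff_sqnorm_ge0// ler_wpM2l// ler_powR ?(ltW l1)//.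
by rewrite lerD2r.
Qed.

Section GlobalBounds.
Variables (gamma : R -> 'rV[R]_3) (a b : R).
Hypotheses (ab : a < b) (sg : smooth_on gamma a b) (ag : arclength_param gamma a b).
Let G n := derive1n n gamma.

Let dG n : derives_vec a b (G n) (G n.+1).
Proof. exact: smooth_derives. Qed.

Let cG n j : {within `[a, b], continuous (fun t => G n t 0 j)}.
Proof. exact: derives_continuous (dG n j). Qed.

Lemma unit_tangent t : a <= t <= b -> dotv (G 1 t) (G 1 t) = 1.
Proof.
move=> tab; have := ag (_ : t \in `[a, b]); rewrite in_itv /= => /(_ tab).
by rewrite -enorm_sqr => ->; rewrite expr1n.
Qed.

Lemma tangent_normal t : a <= t <= b -> dotv (G 1 t) (G 2 t) = 0.
Proof.
move=> tab; have d12 := derives_dotv2 (dG 1) (dG 2).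
have d21 := derives_dotv2 (dG 2) (dG 1).
have := derives_const_zero ab (derives_dotv2 (dG 1) (dG 1))
  (derives_continuous (derivesD d12 d21)) unit_tangent tab.
by rewrite [dotv (G 2 t) _]dotvC => h; lra.
Qed.

Lemma torsion_arc_bound : nonvanishing_torsion gamma a b ->
  arc_bound gamma a b (2 / 3).
Proof.
move=> tor; apply: (@segment_induction R (fun s s' => arc_bound gamma s s' (2 / 3)) _ _ (ltW ab))
   => [s m s' _ sm ms' _|t0 t0ab].
  exact: arc_boundD.
have := tor t0; rewrite in_itv /= => /(_ t0ab); rewrite torsionE -/(G _) -/(G 2) -/(G 3).
set B := cross _ _ => f0.
(* Nonzero torsion forces nonzero curvature: |T x N| = |N|, and T x N = 0 would make the determinant
   vanish. *)
have N0 : 0 < dotv (G 2 t0) (G 2 t0).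
  rewrite lt_def dotv_ge0 andbT -(cross_sqr (unit_tangent t0ab) (tangent_normal t0ab)).
  rewrite dotv_eq0; apply: contra_neq f0; rewrite -/B => ->.
  by rewrite dotvE !mxE !mul0r !addr0.
have e0 : 0 < `|dotv B (G 3 t0)| / 2 by rewrite divr_gt0// normr_gt0.
have [d d0 H] := within_continuous_near (within_continuous_dotv (w := B) (@cG 3)) t0ab e0.
apply: (@twisted_arc_bound R a b gamma (G 1) (G 2) (G 3) (dG 0) (dG 1) (dG 2) (@cG 3)
    t0 t0ab (unit_tangent t0ab) (tangent_normal t0ab) N0 d
    (`|dotv B (G 3 t0)| / 2) (2 * `|dotv B (G 3 t0)|) 0%N) => //.
  by rewrite mulr_gt0// normr_gt0.
by move=> t tab td; rewrite expr0 !mulr1; apply: norm_near_bounds; exact: H.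
Qed.

Let curvature_gt0 t : nonvanishing_curvature gamma a b -> a <= t <= b ->
  0 < dotv (G 2 t) (G 2 t).
Proof.
move=> cur tab; rewrite lt_def dotv_ge0 andbT dotv_eq0.
by apply: cur; rewrite in_itv.
Qed.

Lemma analytic_arc_bound : analytic_on gamma a b -> nonvanishing_curvature gamma a b ->
  arc_bound gamma a b (2 / 3).
Proof.
move=> ga cur; apply: (@segment_induction R (fun s s' => arc_bound gamma s s' (2 / 3)) _ _ (ltW ab))
   => [s m s' _ sm ms' _|t0 t0ab].
  exact: arc_boundD.
have N0 := curvature_gt0 cur t0ab.
have := ga t0; rewrite in_itv /= => /(_ t0ab)[r r0 [c Hc]].
have [d d0 [H|[m [k [K [k0 K0 H]]]]]] := analytic_dotv r0 Hc (cross (G 1 t0) (G 2 t0)) 3.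
  have [d1 d10 H1] := planar_arc_bound (dG 0) (dG 1) (dG 2) (@cG 3) t0ab
    (unit_tangent t0ab) (tangent_normal t0ab) N0 d0 (fun t _ => H t).
  exists d1 => // s s' as_ ss' sb ts st.
  by apply: arc_boundW (H1 _ _ as_ ss' sb ts st); lra.
exact: (twisted_arc_bound (dG 0) (dG 1) (dG 2) (@cG 3) t0ab
  (unit_tangent t0ab) (tangent_normal t0ab) N0 d0 k0 K0 (fun t _ => H t)).
Qed.

Lemma planar_curve_arc_bound : planar gamma a b -> nonvanishing_curvature gamma a b ->
  arc_bound gamma a b (1 / 2).
Proof.
move=> [P [affP gP]] cur; have [n [k [n0 nk]]] := plane_normal affP.
have d n' := derives_dotv n (dG n').
have n1 : forall t, a <= t <= b -> dotv n (G 1 t) = 0.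
  apply: (derives_const_zero ab (d 0%N) (derives_continuous (d 1%N)) (k := k)).
  by move=> t tab; apply/nk/gP; exists t => //=; rewrite in_itv.
have n2 := derives_const_zero ab (d 1%N) (derives_continuous (d 2%N)) n1.
have n3 := derives_const_zero ab (d 2%N) (derives_continuous (d 3%N)) n2.
apply: (@segment_induction R (fun s s' => arc_bound gamma s s' (1 / 2)) _ _ (ltW ab))
   => [s m s' _ sm ms' _|t0 t0ab].
  exact: arc_boundD.
apply: (planar_arc_bound (dG 0) (dG 1) (dG 2) (@cG 3) t0ab
  (unit_tangent t0ab) (tangent_normal t0ab) (curvature_gt0 cur t0ab) ltr01).
by move=> t tab _; apply: (cross_plane n0); [exact: n1 | exact: n2 | exact: n3].
Qed.

End GlobalBounds.
End Frames.

(** * Passage to the norms *)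

Section Restriction.
Variable R : realType.
Implicit Types (gamma : R -> 'rV[R]_3) (a b : R).
Local Notation normc := ComplexField.Normc.normc.

Lemma within_continuous_sum (s s' : R) (I : Type) (r : seq I) (f : I -> R -> R) :
  (forall i, {within `[s, s'], continuous (f i)}) ->
  {within `[s, s'], continuous (fun t => \sum_(i <- r) f i t)}.
Proof.
move=> cf; elim: r => [|i r IH].
  rewrite (_ : (fun t => _) = cst 0); first by move=> x; exact: cvg_cst.
  by apply/funext => t; rewrite big_nil.
rewrite (_ : (fun t => _) = (fun t => f i t + \sum_(j <- r) f j t)).
  by move=> x; apply: cvgD; [exact: cf | exact: IH].
by apply/funext => t; rewrite big_cons.
Qed.

Lemma wave_continuous gamma a b lambda (c : 'rV[int]_3 -> R[i]) :
  (forall j, {within `[a, b], continuous (fun t => gamma t 0 j)}) ->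
  {within `[a, b], continuous (fun t => normc (wave lambda c (gamma t)) ^+ 2)}.
Proof.
move=> cg; rewrite (_ : (fun t => _) = fun t => \sum_(x <- sphere_seq lambda)
    \sum_(y <- sphere_seq lambda) trig_pair (c x) (c y)
      (dotv (2 * pi *: (intv R x - intv R y)) (gamma t))); last first.
  apply/funext => t; rewrite normc_trig_sum; apply: eq_bigr => x _.
  by apply: eq_bigr => y _; congr trig_pair; rewrite !dotvE !mxE; ring.
apply: within_continuous_sum => x; apply: within_continuous_sum => y t.
apply: (@continuous_comp _ _ _ (fun t : subspace `[a, b] => dotv _ (gamma t))).
  exact: within_continuous_dotv.
exact: trig_pair_continuous.
Qed.

Lemma eigenfunction_wave lambda (e : 'rV[R]_3 -> R[i]) : eigenfunction lambda e ->
  exists c, e = wave lambda c.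
Proof.
move=> [c ec]; exists c; apply/funext => x.
by rewrite ec fsbig_finite//; exact: finite_lattice_sphere.
Qed.

(** The squared norm on the curve is an increment of an antiderivative, and the squared norm on the
    torus is the sum of the squared coefficients by Parseval. Taking square roots halves the
    exponent, so the arc bound is used at 2 * eps. *)
Lemma arc_bound_restriction gamma a b (s : R) : a < b ->
  (forall j, {within `[a, b], continuous (fun t => gamma t 0 j)}) ->
  arc_bound gamma a b (2 * s) -> restriction_bound gamma a b s.
Proof.
move=> ab cg H eps eps0; have [|C C0 HC] := H (2 * eps); first by rewrite mulr_gt0.
exists (C `^ 2^-1) => lambda l1 e /eigenfunction_wave[c ->].
have cw := @wave_continuous gamma a b lambda c cg.
have [E dE] := antiderivative_exists (ltW ab) cw.
rewrite /L2norm_curve /L2norm_torus /L2norm /=.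
rewrite (integral_derives ab dE cw) integral_torus_wave !poweR_EFin -EFinM lee_fin.
have S0 := coeff_sqnorm_ge0 lambda c.
have -> : C `^ 2^-1 * lambda `^ (s + eps) * coeff_sqnorm lambda c `^ 2^-1 =
    (C * lambda `^ (2 * s + 2 * eps) * coeff_sqnorm lambda c) `^ 2^-1.
  rewrite !powRM ?mulr_ge0 ?powR_ge0// -[(lambda `^ _) `^ _]powRrM.
  by congr (_ * _ `^ _ * _); field.
apply: ge0_ler_powR; rewrite ?nnegrE ?mulr_ge0 ?powR_ge0//.
  have := derives_le (ltW ab) (@derives_cst R a b 0) dE.
  by rewrite subrr; apply => t _; rewrite sqr_ge0.
exact: HC.
Qed.

End Restriction.

Theorem theorem6p2 (R : realType) (gamma : R -> 'rV[R]_3) (a b : R)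
    (hab : a < b) :
  ([\/ geodesic_segment gamma a b,
       smooth_curve_segment gamma a b /\ nonvanishing_torsion gamma a b |
       analytic_curve_segment gamma a b /\
         nonvanishing_curvature gamma a b] ->
    restriction_bound gamma a b (1 / 3)) /\
  ([/\ smooth_curve_segment gamma a b, planar gamma a b &
       nonvanishing_curvature gamma a b] ->
    restriction_bound gamma a b (1 / 4)).
Proof.
have smooth_cont : smooth_on gamma a b ->
    forall j, {within `[a, b], continuous (fun t => gamma t 0 j)}.
  by move=> sg j; exact: derives_continuous (@smooth_derives R gamma a b 0 sg j).
split=> [[gs|[[sg ag] tor]|[[ang ag] cur]]|[[sg ag] pl cur]].
- apply: arc_bound_restriction => //; last first.
    by rewrite mulrA mulr1; exact: geodesic_arc_bound.
  (* [gamma] is prescribed on [a, b] only, so continuity is obtained from an affine function that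
     agrees with it there. *)
  have [p [v [_ gE]]] := gs => j.
  apply: (@subspace_eq_continuous _ _ _ (fun t : R => p 0 j + t * v 0 j)).
    by move=> t; rewrite inE /= => tab; rewrite /from_subspace gE// !mxE.
  by apply: continuous_subspaceT => t; apply: cvgD; [exact: cvg_cst|exact: mulrr_continuous].
- apply: arc_bound_restriction (smooth_cont sg) _ => //.
  by rewrite mulrA mulr1; exact: torsion_arc_bound.
- have sg := analytic_smooth ang.
  apply: arc_bound_restriction (smooth_cont sg) _ => //.
  by rewrite mulrA mulr1; exact: analytic_arc_bound.
- apply: arc_bound_restriction (smooth_cont sg) _ => //.
  rewrite (_ : 2 * (1 / 4) = 1 / 2); last by field.
  exact: planar_curve_arc_bound.
Qed.
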